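(* Let $p,q\ge0$, $n=p+q+1$, $(G,K)=(\mathrm{SO}_{2n}(\mathbb C),\mathrm{SO}_{2p+1}(\mathbb C)\times\mathrm{SO}_{2q+1}(\mathbb C))$ (symmetric pair of type DI, odd case), and let $P=P_S\subset\mathrm{SO}_{2n}$, $Q_1=Q_{T_1}\subset\mathrm{SO}_{2p+1}$, $Q_2=Q_{T_2}\subset\mathrm{SO}_{2q+1}$ be parabolic subgroups with $S\subset\{\alpha_1,\dots,\alpha_n\}$, $T_1\subset\{\beta_1,\dots,\beta_p\}$, $T_2\subset\{\gamma_1,\dots,\gamma_q\}$ in the notation of the context. The double flag variety $(\mathrm{SO}_{2p+1}/Q_1\times\mathrm{SO}_{2q+1}/Q_2)\times\mathrm{SO}_{2n}/P$ has finitely many $K$-orbits in each of the following cases (indices $i,j$ arbitrary): (1) $S=\{\alpha_1\}$, $\{\alpha_{n-1}\}$ or $\{\alpha_n\}$; $T_1$ any; $T_2$ any; (2) $S=\{\alpha_i\}$, $\{\alpha_{n-1},\alpha_n\}$, $\{\alpha_1,\alpha_{n-1}\}$ or $\{\alpha_1,\alpha_n\}$; $T_1$ any; $T_2=\emptyset$; (3) $S=\{\alpha_i,\alpha_{n-1}\}$ or $\{\alpha_i,\alpha_n\}$; $T_1=\{\beta_j\}$; $T_2=\emptyset$; (4) $q=0$ (so $\mathrm{SO}_{2q+1}=\mathrm{SO}_1$); $S$ any; $T_1$ any.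
   Context: $K$ is the product of the special orthogonal groups of the two summands in an orthogonal decomposition $\mathbb C^{2n}=\mathbb C^{2p+1}\oplus\mathbb C^{2q+1}$ of a nondegenerate quadratic space, acting diagonally on the double flag variety. For $\mathrm{SO}_{2n}$ with simple roots $\alpha_1,\dots,\alpha_n$ (standard numbering of $D_n$), the root $\alpha_i$ with $i\le n-2$ corresponds to isotropic subspaces of dimension $i$, the roots $\alpha_{n-1},\alpha_n$ correspond to the two families of Lagrangian ($n$-dimensional isotropic) subspaces, and a subset $S$ corresponds to the stabilizer of a system of mutually incident subspaces of the indicated types (an isotropic subspace of smaller dimension being contained in the larger ones, two Lagrangians of different families meeting in dimension $n-1$). For $\mathrm{SO}_{2p+1}$, the set $\{\beta_{j_1},\dots,\beta_{j_l}\}$ corresponds to the stabilizer of a flag of isotropic subspaces of dimensions $j_1<\dots<j_l\le p$; the same convention with $\gamma$ for $\mathrm{SO}_{2q+1}$. In all cases the set of roots is the complement $\Pi\setminus J$ of the set of simple roots generating the Levi part; the empty set corresponds to the whole group. *)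

(* Defs.v *)
From HB Require Import structures.
From mathcomp Require Import all_boot all_order all_algebra.
From mathcomp Require Import boolp classical_sets functions cardinality reals.
From mathcomp Require Export complex.

Set Implicit Arguments.
Unset Strict Implicit.
Unset Printing Implicit Defensive.

Import Order.TTheory GRing.Theory Num.Theory.
Local Open Scope ring_scope.
Local Open Scope classical_set_scope.

(** Vectors of F^m are written as rows, and a subspace is the row space of a
    square matrix, as in mxalgebra.  A matrix g acts on columns by v |-> g v,
    hence on rows, and on row spaces, by v |-> v *m g^T.  The bilinear form
    with Gram matrix B is (v, w) |-> v *m B *m w^T. *)

Section Orthogonal.
Variables (F : fieldType) (m : nat).
Implicit Types (B U : 'M[F]_m).

Definition nondegenerate_symmetric B : Prop := B^T = B /\ B \in unitmx.

Definition SO B : set 'M[F]_m := [set g | g^T *m B *m g = B /\ \det g = 1].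

Definition isotropic B U : Prop := U *m B *m U^T = 0.

(** Simple roots are numbered from 1 for both types below: the ordinal
    k stands for the simple root of index k.+1. *)
Definition root_indices (r : nat) (S : {set 'I_r}) : seq nat :=
  [seq (nat_of_ord k).+1 | k in S].

Definition stabilizer B (r : nat) (S : {set 'I_r}) (E : 'I_r -> 'M[F]_m) :
    set 'M[F]_m :=
  [set g | SO B g /\ forall k, k \in S -> (E k *m g^T == E k)%MS].

(** Type B_r, with m = 2r + 1.  Only the values of E on T matter. *)
Definition flag_B B (r : nat) (T : {set 'I_r}) (E : 'I_r -> 'M[F]_m) : Prop :=
  (forall k, k \in T -> isotropic B (E k) /\ \rank (E k) = k.+1) /\
  (forall k l, k \in T -> l \in T -> (k < l)%N -> (E k <= E l)%MS).

Definition parabolic_B B (r : nat) (T : {set 'I_r}) (Q : set 'M[F]_m) : Prop :=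
  exists2 E : 'I_r -> 'M[F]_m, flag_B B T E & Q = stabilizer B T E.

(** Type D_n, with m = 2n. *)
Definition lagrangian (n : nat) B U : Prop := isotropic B U /\ \rank U = n.

(** Two Lagrangians are in the same family iff their intersection has even
    codimension in each of them. *)
Definition same_family (n : nat) (U U' : 'M[F]_m) : bool :=
  ~~ odd (n - \rank (U :&: U')%MS).

(** The two families of Lagrangians are told apart by a reference Lagrangian
    L0, whose family is the one attached to the root of index n. *)
Definition has_type_D (n : nat) B (L0 : 'M[F]_m) (i : nat) U : Prop :=
  if (i.+2 <= n)%N then isotropic B U /\ \rank U = i
  else lagrangian n B U /\ same_family n U L0 = (i == n).

(** Incidence of subspaces of types i < j; for i = n - 1 and j = n these are
    Lagrangians of different families. *)
Definition incident_D (n i : nat) (U U' : 'M[F]_m) : Prop :=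
  if (i.+2 <= n)%N then is_true (U <= U')%MS
  else \rank (U :&: U')%MS = n.-1.

Definition system_D (n : nat) B (L0 : 'M[F]_m) (S : {set 'I_n})
    (E : 'I_n -> 'M[F]_m) : Prop :=
  (forall k, k \in S -> has_type_D n B L0 k.+1 (E k)) /\
  (forall k l, k \in S -> l \in S -> (k < l)%N ->
     incident_D n k.+1 (E k) (E l)).

Definition parabolic_D (n : nat) B (L0 : 'M[F]_m) (S : {set 'I_n})
    (P : set 'M[F]_m) : Prop :=
  exists2 E : 'I_n -> 'M[F]_m, system_D B L0 S E & P = stabilizer B S E.

Definition translate (g : 'M[F]_m) (A : set 'M[F]_m) : set 'M[F]_m :=
  [set g *m a | a in A].

(** The homogeneous space G / H, as the set of left cosets. *)
Definition cosets (G H : set 'M[F]_m) : set (set 'M[F]_m) :=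
  [set translate g H | g in G].

End Orthogonal.

Section DoubleFlag.
Variables (F : fieldType) (m1 m2 : nat).
Variables (B1 : 'M[F]_m1) (B2 : 'M[F]_m2).

Definition orthogonal_sum : 'M[F]_(m1 + m2) := block_mx B1 0 0 B2.

Definition double_flag_variety (Q1 : set 'M[F]_m1) (Q2 : set 'M[F]_m2)
    (P : set 'M[F]_(m1 + m2)) :
    set ((set 'M[F]_m1 * set 'M[F]_m2) * set 'M[F]_(m1 + m2)) :=
  (cosets (SO B1) Q1 `*` cosets (SO B2) Q2) `*` cosets (SO orthogonal_sum) P.

(** K consists of the pairs (a, b), embedded in the special orthogonal group
    of the sum as block-diagonal matrices. *)
Definition K_group : set ('M[F]_m1 * 'M[F]_m2) := SO B1 `*` SO B2.

Definition K_act (k : 'M[F]_m1 * 'M[F]_m2)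
    (x : (set 'M[F]_m1 * set 'M[F]_m2) * set 'M[F]_(m1 + m2)) :
    (set 'M[F]_m1 * set 'M[F]_m2) * set 'M[F]_(m1 + m2) :=
  ((translate k.1 x.1.1, translate k.2 x.1.2),
   translate (block_mx k.1 0 0 k.2) x.2).

Definition K_orbit (x : (set 'M[F]_m1 * set 'M[F]_m2) * set 'M[F]_(m1 + m2)) :
    set ((set 'M[F]_m1 * set 'M[F]_m2) * set 'M[F]_(m1 + m2)) :=
  [set K_act k x | k in K_group].

Definition finitely_many_K_orbits (Q1 : set 'M[F]_m1) (Q2 : set 'M[F]_m2)
    (P : set 'M[F]_(m1 + m2)) : Prop :=
  finite_set [set K_orbit x | x in double_flag_variety Q1 Q2 P].

End DoubleFlag.

(* Main.v *)
Require Import Defs.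
From HB Require Import structures.
From mathcomp Require Import all_boot all_order all_fingroup all_algebra zify ring.
From mathcomp Require Import boolp classical_sets functions cardinality reals.
From mathcomp Require Import complex.

(** K differs from O(V1) x O(V2) by signs only, so it suffices to count the orbits
    of O(V1) x O(V2) on configurations of isotropic subspaces of V1, V2 and
    V = V1 + V2.  If a linear isomorphism h preserves V1, V2 and carries one
    configuration, together with all orthogonal subspaces, to another one, then
    h can be corrected by the square root of the self-adjoint map
    h B h^T B^-1, a polynomial in it, to an isometry.  What remains is a linear
    problem: three flags in V, namely those ending in V1 and in V2 and a flag of
    isotropic subspaces and their orthogonals.

    One Coxeter functor turns it into a problem on a subspace of V: two flags
    and a vector (case 1), a flag, two subspaces U, N and a vector of U (case 2),
    or three flags of lengths 3, 1, 2 (case 3).  In the first two problems, as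
    well as in case 4, there is a basis in which every subspace has a 0/1
    generating matrix and the vector has 0/1 coordinates.  The third problem has
    type E_7, where the Coxeter transformation satisfies c^9 = -1: hence the
    ninth power of the Coxeter functor vanishes, and a triple of flags is
    determined by the ranks occurring in its first nine iterates. *)

Set Implicit Arguments.
Unset Strict Implicit.
Unset Printing Implicit Defensive.

Import Order.TTheory GRing.Theory Num.Theory.
Local Open Scope ring_scope.

(** * Extension of linear maps *)

(** The Coxeter functor helps because the first two flags end in [V1] and [V2], which meet in zero:
    this empties the first step of the third arm. The gain is essential. In case 3 the original arms
    have lengths 3, 1, 3, which is the extended diagram of [E_7] and has infinite families in
    general.

    The Coxeter transformation computes dimensions only when the functor kills no summand. Instead
    of decomposing into indecomposables, the proof represents direct summands by idempotents: an
    idempotent of the image lifts to one whose summand avoids the killed part, so the transformation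
    applies to it exactly.

    Finiteness is always stated through labels in a finite type such that a common label forces
    equivalence. The linear classification is valid over any field; closedness of the field enters
    with the square roots of matrices.

    As for signs, [V1] and [V2] have odd dimension, so changing the sign of both components of an
    isometry flips both determinants and moves no subspace. Only the product of the determinants
    remains, and it costs a finite factor, as does a possible swap of two Lagrangians. *)

Section LinearExtension.
Variable F : fieldType.

(** The pseudo-inverse extends the map by killing a complement, so the image stays within that of
    [Y]. This bound later makes a glued endomorphism idempotent. *)
Lemma ext_map k m n (X : 'M[F]_(k, m)) (Y : 'M[F]_(k, n)) :
  (forall u : 'rV_k, u *m X = 0 -> u *m Y = 0) ->
  exists2 h : 'M_(m, n), X *m h = Y & (h <= Y)%MS.
Proof.
move=> XY; exists (pinvmx X *m Y); last exact: submxMl.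
apply/eqP; rewrite -subr_eq0; apply/eqP/row_matrixP => i.
rewrite mulmxA -{2}[Y]mul1mx -mulmxBl row_mul row0; apply: XY.
by rewrite -row_mul mulmxBl mulmxKpV // mul1mx subrr row0.
Qed.

Lemma ext_iso k m (X Y : 'M[F]_(k, m)) :
  (forall u : 'rV_k, u *m X = 0 <-> u *m Y = 0) ->
  exists2 h : 'M_m, h \in unitmx & X *m h = Y.
Proof.
move=> XY.
have [f Xf _] := ext_map (fun u => proj1 (XY u)).
have [g Yg _] := ext_map (fun u => proj2 (XY u)).
have rX : \rank (X *m f) = \rank X.
  apply/eqP; rewrite eqn_leq mxrankM_maxl /= Xf -{1}Yg.
  exact: mxrankM_maxl.
by have [h h_unit Eh] := complete_unitmx rX; exists h; rewrite // -Eh.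
Qed.

Lemma agree_sub k l m n (A : 'M[F]_(k, m)) (X : 'M[F]_(l, m))
    (f g : 'M[F]_(m, n)) :
  (X <= A)%MS -> A *m f = A *m g -> X *m f = X *m g.
Proof. by case/submxP=> D -> E; rewrite -!mulmxA E. Qed.

Lemma inj_on k l m n (A : 'M[F]_(k, m)) (X : 'M[F]_(l, m)) (f : 'M[F]_(m, n)) :
  \rank (A *m f) = \rank A -> (X <= A)%MS -> X *m f = 0 -> X = 0.
Proof.
move=> rf XA Xf; apply/eqP; rewrite -submx0.
have /eqP <- : (A :&: kermx f)%MS == 0.
  by rewrite -mxrank_eq0 -(eqn_add2l (\rank (A *m f))) mxrank_mul_ker rf addn0.
by rewrite sub_capmx XA; apply/sub_kermxP.
Qed.

Lemma inj_on_rank k m n (A : 'M[F]_(k, m)) (f : 'M[F]_(m, n)) :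
  (forall u : 'rV_m, (u <= A)%MS -> u *m f = 0 -> u = 0) ->
  \rank (A *m f) = \rank A.
Proof.
move=> inj; apply/eqP.
rewrite -(mxrank_mul_ker A f) -{1}[\rank (A *m f)]addn0 eqn_add2l eq_sym.
rewrite mxrank_eq0 -submx0; apply/rV_subP => u.
rewrite sub_capmx => /andP[uA /sub_kermxP uf].
by rewrite (inj u) ?sub0mx.
Qed.

Lemma glue_disjoint k l m n (A : 'M[F]_(k, m)) (D : 'M[F]_(l, m))
    (f g : 'M[F]_(m, n)) : (A :&: D)%MS = 0 ->
  exists h : 'M_(m, n), A *m h = A *m f /\ D *m h = D *m g.
Proof.
move=> AD0.
have [|h] := @ext_map _ _ _ (col_mx A D) (col_mx (A *m f) (D *m g)).
  move=> u; rewrite -[u]hsubmxK !mul_row_col => /eqP; rewrite addr_eq0 => /eqP E.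
  have uA : lsubmx u *m A = 0.
    apply/eqP; rewrite -submx0 -AD0 sub_capmx submxMl E eqmx_opp.
    exact: submxMl.
  have uD : rsubmx u *m D = 0 by apply/eqP; rewrite -oppr_eq0 -E uA.
  by rewrite !mulmxA uA uD !mul0mx addr0.
by rewrite mul_col_mx => /eq_col_mx[? ?] _; exists h.
Qed.

(** The extension is zero on a complement of [A :&: B] in [B], so only the image of the intersection
    constrains it. *)
Lemma glue_step k l m n (A : 'M[F]_(k, m)) (B : 'M[F]_(l, m))
    (f : 'M[F]_(m, n)) (C : 'M[F]_n) :
  ((A :&: B)%MS *m f <= C)%MS ->
  exists2 h : 'M_(m, n), A *m h = A *m f & (B *m h <= C)%MS.
Proof.
move=> ABC; pose D := (B :\: A)%MS.
have AD0 : (A :&: D)%MS = 0.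
  apply/eqP; rewrite -submx0 -(capmx_diff B A) sub_capmx capmxSr /=.
  exact: capmxSl.
have [h [Ah Dh]] := glue_disjoint f 0 AD0.
exists h => //; rewrite mulmx0 in Dh.
rewrite (submx_trans (submxMr h (_ : B <= (A :&: B) + D)%MS)) //.
  by rewrite addsmxC capmxC addsmx_diff_cap_eq.
rewrite addsmxMr addsmx_sub Dh sub0mx andbT.
by rewrite (agree_sub (capmxSl A B) Ah).
Qed.
End LinearExtension.

(** * Extension of linear maps along a flag *)

Section Filtrations.
Variable F : fieldType.

Definition filtration m (W : nat -> 'M[F]_m) := forall i, (W i <= W i.+1)%MS.

Lemma filtrationS m (W : nat -> 'M[F]_m) i j :
  filtration W -> (i <= j)%N -> (W i <= W j)%MS.
Proof.
move=> mW; elim: j => [|j IHj]; first by rewrite leqn0 => /eqP->.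
rewrite leq_eqVlt => /predU1P[-> //|]; rewrite ltnS => /IHj Wij.
exact: submx_trans Wij (mW j).
Qed.

(** Induction on the steps: once the map is fixed on [S + W t], the modular law gives the
    intersection with [W t.+1] as [(S :&: W t.+1) + W t], where the required inclusion is known. *)
Lemma filtration_ext k m n (S : 'M[F]_(k, m)) (f : 'M[F]_(m, n))
    (W : nat -> 'M[F]_m) (W' : nat -> 'M[F]_n) t :
    filtration W -> filtration W' ->
    (forall i, (i <= t)%N -> ((S :&: W i)%MS *m f <= W' i)%MS) ->
  exists2 h : 'M_(m, n), S *m h = S *m f &
    forall i, (i <= t)%N -> (W i *m h <= W' i)%MS.
Proof.
move=> mW mW'; elim: t => [|t IHt] SW.
  have [h Sh Wh] := glue_step (SW 0 (leqnn 0)).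
  by exists h => // i; rewrite leqn0 => /eqP->.
have [i it|h Sh Wh] := IHt; first exact/SW/leqW.
have [|h' Sh' Wh'] := @glue_step _ _ _ _ _ (S + W t)%MS (W t.+1) h (W' t.+1).
  rewrite capmxC -(eqmxMr h (matrix_modr S (mW t))) capmxC.
  rewrite addsmxMr addsmx_sub (submx_trans (Wh t _)) // andbT.
  by rewrite (agree_sub (capmxSl S _) Sh) SW.
exists h' => [|i]; first by rewrite -Sh (agree_sub (addsmxSl S (W t)) Sh').
rewrite leq_eqVlt => /predU1P[-> //|]; rewrite ltnS => it.
rewrite (agree_sub (submx_trans (filtrationS mW it) _) Sh') ?addsmxSr //.
exact: Wh.
Qed.

(** As [B] and [C] have equal rank, so have the complements of the two intersections; a basis of one
    is sent to a basis of the other. *)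
Lemma glue_step_iso k m (A : 'M[F]_(k, m)) (B C f : 'M[F]_m) :
    \rank (A *m f) = \rank A -> ((A :&: B)%MS *m f :=: A *m f :&: C)%MS ->
    \rank B = \rank C ->
  exists2 h : 'M_m, h \in unitmx & A *m h = A *m f /\ (B *m h :=: C)%MS.
Proof.
move=> rf AB rBC; pose D := (B :\: A)%MS; pose D' := (C :\: (A *m f))%MS.
have BE : (B :=: (A :&: B) + D)%MS.
  by rewrite addsmxC capmxC; apply/eqmx_sym/addsmx_diff_cap_eq.
have CE : (C :=: (A *m f :&: C) + D')%MS.
  by rewrite addsmxC capmxC; apply/eqmx_sym/addsmx_diff_cap_eq.
have AD0 : (A :&: D)%MS = 0.
  apply/eqP; rewrite -submx0 -(capmx_diff B A) sub_capmx capmxSr /=.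
  exact: capmxSl.
have AD0' : (A *m f :&: D')%MS = 0.
  apply/eqP; rewrite -submx0 -(capmx_diff C (A *m f)) sub_capmx capmxSr /=.
  exact: capmxSl.
have rD : \rank D = \rank D'.
  have r1 : \rank ((A :&: B)%MS *m f) = \rank (A :&: B)%MS.
    apply: inj_on_rank => u uAB; apply: (inj_on rf).
    exact: submx_trans uAB (capmxSl _ _).
  have d1 : ((A :&: B) :&: D = 0)%MS.
    by apply/eqP; rewrite -submx0 -AD0 capmxS ?capmxSl.
  have d2 : ((A *m f :&: C) :&: D' = 0)%MS.
    by apply/eqP; rewrite -submx0 -AD0' capmxS ?capmxSl.
  have := rBC; rewrite BE CE !mxrank_disjoint_sum //.
  by rewrite -AB r1 => /addnI.
have [|g Dg _] := @ext_map F _ _ _ (row_base D) (castmx (esym rD, erefl m)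
  (row_base D')).
  move=> u /eqP; rewrite mulmx_free_eq0 ?row_base_free // => /eqP->.
  by rewrite mul0mx.
have Dg' : (D *m g :=: D')%MS.
  apply: eqmx_trans (eqmxMr g (eqmx_sym (eq_row_base D))) _; rewrite Dg.
  apply: eqmx_trans (eq_row_base D').
  by case: _ / (esym rD); rewrite castmx_id; apply: eqmx_refl.
have rg : \rank (D *m g) = \rank D by rewrite Dg'.
have [|h h_unit] := @ext_iso F _ _ (col_mx A D) (col_mx (A *m f) (D *m g)).
  move=> u; rewrite -[u]hsubmxK !mul_row_col !mulmxA; split=> /eqP.
    rewrite addr_eq0 => /eqP E.
    have uA : lsubmx u *m A = 0.
      apply/eqP; rewrite -submx0 -AD0 sub_capmx submxMl E eqmx_opp.
      exact: submxMl.
    have uD : rsubmx u *m D = 0 by apply/eqP; rewrite -oppr_eq0 -E uA.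
    by rewrite uA uD !mul0mx addr0.
  rewrite addr_eq0 => /eqP E.
  have uA : lsubmx u *m A *m f = 0.
    apply/eqP; rewrite -submx0 -AD0' sub_capmx -{1}mulmxA submxMl E eqmx_opp.
    by rewrite -Dg' -mulmxA submxMl.
  have uD : rsubmx u *m D *m g = 0 by apply/eqP; rewrite -oppr_eq0 -E uA.
  rewrite (inj_on rf _ uA) ?submxMl // (inj_on rg _ uD) ?submxMl //.
  by rewrite addr0.
rewrite mul_col_mx => /eq_col_mx[Ah Dh]; exists h => //; split=> //.
apply: eqmx_trans (eqmxMr h BE) (eqmx_trans (addsmxMr _ _ _) _).
apply: eqmx_trans _ (eqmx_sym CE); apply: adds_eqmx.
  by rewrite (agree_sub (capmxSl A B) Ah).
by rewrite Dh.
Qed.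

Lemma filtration_ext_iso k m (S : 'M[F]_(k, m)) (f : 'M[F]_m)
    (W W' : nat -> 'M[F]_m) t :
    filtration W -> filtration W' -> \rank (S *m f) = \rank S ->
    (forall i, (i <= t)%N -> ((S :&: W i)%MS *m f :=: S *m f :&: W' i)%MS) ->
    (forall i, (i <= t)%N -> \rank (W i) = \rank (W' i)) ->
  exists2 h : 'M_m, h \in unitmx &
    S *m h = S *m f /\ forall i, (i <= t)%N -> (W i *m h :=: W' i)%MS.
Proof.
move=> mW mW' rf; elim: t => [|t IHt] SW rW.
  have [h h_unit [Sh Wh]] := glue_step_iso rf (SW 0 (leqnn 0)) (rW 0 (leqnn 0)).
  by exists h => //; split=> // i; rewrite leqn0 => /eqP->.
have [i it|i it|h h_unit [Sh Wh]] := IHt; [exact/SW/leqW | exact/rW/leqW|].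
have rh : \rank ((S + W t)%MS *m h) = \rank (S + W t)%MS.
  by apply: mxrankMfree; rewrite row_free_unit.
have [|h' h'_unit [Sh' Wh']] := glue_step_iso rh _ (rW t.+1 (leqnn _)).
  have E := matrix_modr S (mW t).
  have E' := matrix_modr (S *m f) (mW' t).
  rewrite capmxC; apply: eqmx_trans (eqmxMr h (eqmx_sym E)) _.
  apply: eqmx_trans (addsmxMr _ _ _) _; rewrite capmxC.
  rewrite (agree_sub (capmxSl S _) Sh).
  apply: eqmx_trans (adds_eqmx (SW _ (leqnn _)) (Wh t (leqnn t))) _.
  rewrite capmxC; apply: eqmx_trans E' _; rewrite capmxC.
  apply: cap_eqmx => //; apply: eqmx_trans (eqmx_sym (addsmxMr _ _ _)).
  by rewrite Sh; apply: adds_eqmx => //; apply: eqmx_sym (Wh t _).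
exists h' => //; split=> [|i].
  by rewrite -Sh (agree_sub (addsmxSl S (W t)) Sh').
rewrite leq_eqVlt => /predU1P[-> //|]; rewrite ltnS => it.
rewrite (agree_sub (submx_trans (filtrationS mW it) _) Sh') ?addsmxSr //.
exact: Wh.
Qed.
End Filtrations.

(** * Triples of flags and the Coxeter functor *)

Section Triads.
Variable F : fieldType.

Lemma sub_imgP k m n (v : 'rV[F]_n) (A : 'M[F]_(k, m)) (f : 'M[F]_(m, n)) :
  (v <= A *m f)%MS -> exists2 u : 'rV_m, (u <= A)%MS & v = u *m f.
Proof. by case/submxP=> D ->; exists (D *m A); rewrite ?submxMl ?mulmxA. Qed.

Lemma mulmx_ext m n (A B : 'M[F]_(m, n)) :
  (forall u : 'rV_m, u *m A = u *m B) -> A = B.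
Proof. by move=> AB; apply/row_matrixP => i; rewrite !rowE. Qed.

Definition preimmx m n (f : 'M[F]_(m, n)) (A : 'M[F]_n) := kermx (f *m cokermx A).

Lemma sub_preimmx k m n (B : 'M[F]_(k, m)) (f : 'M[F]_(m, n)) (A : 'M[F]_n) :
  (B <= preimmx f A)%MS = (B *m f <= A)%MS.
Proof. by rewrite sub_kermx mulmxA submxE. Qed.

Definition proj3 m (k : 'I_3) : 'M[F]_(3 * m, m) := lin1_mx (row k \o vec_mx).

Definition tuple3 m (x : 'I_3 -> 'rV[F]_m) : 'rV_(3 * m) :=
  mxvec (\matrix_k x k).

Lemma tuple3K m (x : 'I_3 -> 'rV[F]_m) k : tuple3 x *m proj3 m k = x k.
Proof. by rewrite mul_rV_lin1 /= mxvecK rowK. Qed.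

Lemma proj3_inj m (u v : 'rV[F]_(3 * m)) :
  (forall k, u *m proj3 m k = v *m proj3 m k) -> u = v.
Proof.
move=> uv; apply: (can_inj vec_mxK); apply/row_matrixP => k.
by have := uv k; rewrite !mul_rV_lin1.
Qed.

(** Zero-sum triples are the relations between the three subspaces, so a map respecting them is well
    defined on the sum. Its image is spanned by the three images, whence the last clause. *)
Lemma glue3 m n (W : 'I_3 -> 'M[F]_m) (h : 'I_3 -> 'M[F]_(m, n)) :
    (forall x : 'I_3 -> 'rV_m, (forall k, x k <= W k)%MS -> \sum_k x k = 0 ->
      \sum_k x k *m h k = 0) ->
  exists2 H : 'M_(m, n), (forall k, W k *m H = W k *m h k) &
    forall C : 'M_n, (forall k, W k *m h k <= C)%MS -> (H <= C)%MS.
Proof.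
move=> Wh.
pose X := \sum_k proj3 m k *m W k; pose Y := \sum_k proj3 m k *m (W k *m h k).
have [|H XH HY] := @ext_map F _ _ _ X Y.
  move=> u; rewrite /X /Y !mulmx_sumr => uX.
  under eq_bigr do rewrite 2!mulmxA.
  apply: Wh => [k|]; first by rewrite submxMl.
  by rewrite -[RHS]uX; apply: eq_bigr => k _; rewrite mulmxA.
exists H => [k|C WC]; last first.
  apply: submx_trans HY _; rewrite summx_sub // => k _.
  exact: submx_trans (submxMl _ _) (WC k).
apply: mulmx_ext => v;
  have := congr1 (mulmx (tuple3 (fun j => if j == k then v else 0))) XH.
rewrite mulmxA /X /Y !mulmx_sumr (bigD1 k) // [RHS](bigD1 k) //= !mulmxA tuple3K
  eqxx.
rewrite !big1 ?addr0 // => j /negPf jk.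
  by rewrite !mulmxA tuple3K jk !mul0mx.
by rewrite mulmxA tuple3K jk !mul0mx.
Qed.

Lemma glue3_iso m (W h : 'I_3 -> 'M[F]_m) :
    (forall x : 'I_3 -> 'rV_m, (forall k, x k <= W k)%MS ->
      \sum_k x k = 0 <-> \sum_k x k *m h k = 0) ->
  exists2 H : 'M_m, H \in unitmx & forall k, W k *m H = W k *m h k.
Proof.
move=> Wh.
have [x xW x0|H WH HY] := @glue3 _ _ W h; first by apply/(Wh x xW).
have [|H' H'_unit E] := @complete_unitmx F _ _ (\sum_k W k)%MS H.
  apply: inj_on_rank => u /sub_sumsmxP[x ->] E.
  apply/(Wh (fun k => x k *m W k)) => [k|]; first exact: submxMl.
  by rewrite -[RHS]E mulmx_suml; apply: eq_bigr => k _; rewrite -!mulmxA WH.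
exists H' => // k; rewrite -WH; apply/esym.
by apply: agree_sub E; rewrite (sumsmx_sup k).
Qed.

(** The Coxeter functor lands in a subspace of the triples of vectors, so the total space is a
    subspace [tspace] of the ambient space and need not be all of it. *)
Record triad m := Triad { tspace : 'M[F]_m; tflag : 'I_3 -> nat -> 'M[F]_m }.

Definition triad_wf m (c : triad m) :=
  [/\ forall k, tflag c k 0 = 0, forall k, filtration (tflag c k)
    & forall k i, (tflag c k i <= tspace c)%MS].

Section Coxeter.
Variable r : 'I_3 -> nat.

Definition triad_iso m (c c' : triad m) :=
  exists2 h : 'M_m, h \in unitmx & (tspace c *m h :=: tspace c')%MS /\
    forall k i, (i <= r k)%N -> (tflag c k i *m h :=: tflag c' k i)%MS.

Definition same_ranks m (c c' : triad m) :=
  \rank (tspace c) = \rank (tspace c') /\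
  forall k i, (i <= r k)%N -> \rank (tflag c k i) = \rank (tflag c' k i).

(* The product of the three reflection functors of Gelfand and Ponomarev: triples
   of vectors of the three top subspaces with zero sum, filtered by one
   component lying in the previous step of its flag. *)
Definition cox_space m (c : triad m) : 'M[F]_(3 * m) :=
  (\bigcap_k preimmx (proj3 m k) (tflag c k (r k)) :&:
   kermx (\sum_k proj3 m k))%MS.

Definition cox m (c : triad m) : triad (3 * m) :=
  Triad (cox_space c) (fun k i =>
    if i is i'.+1 then (cox_space c :&: preimmx (proj3 m k) (tflag c k i'))%MS
    else 0).

Lemma cox_spaceP m (c : triad m) (u : 'rV_(3 * m)) :
  (u <= cox_space c)%MS <->
  (forall k, u *m proj3 m k <= tflag c k (r k))%MS /\
  \sum_k u *m proj3 m k = 0.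
Proof.
rewrite sub_capmx sub_kermx mulmx_sumr; split=> [/andP[/sub_bigcapmxP uW /eqP->]|].
  by split=> // k; rewrite -sub_preimmx uW.
case=> uW ->; rewrite eqxx andbT; apply/sub_bigcapmxP => k _.
by rewrite sub_preimmx.
Qed.

Lemma cox_flagS m (c : triad m) k i (u : 'rV_(3 * m)) :
  (u <= tflag (cox c) k i.+1)%MS =
  (u <= cox_space c)%MS && (u *m proj3 m k <= tflag c k i)%MS.
Proof. by rewrite sub_capmx sub_preimmx. Qed.

(** The functor shifts indices by one, and the step just past the end of an arm is everything. A map
    compatible with the steps up to [r k] is therefore compatible with one more. *)
Lemma cox_flag_top m (c : triad m) k :
  (tflag (cox c) k (r k).+1 :=: cox_space c)%MS.
Proof.
apply/eqmxP; rewrite /= capmxSl; apply/rV_subP => u uE.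
by rewrite cox_flagS uE; have [-> _] := (cox_spaceP c u).1 uE.
Qed.

Lemma cox_wf m (c : triad m) : triad_wf c -> triad_wf (cox c).
Proof.
case=> W0 mW WE; split=> // [k [|i]|k [|i]] /=; rewrite ?sub0mx ?capmxSl //.
apply: capmxS => //; rewrite sub_preimmx.
by apply: submx_trans (mW k i); rewrite -sub_preimmx.
Qed.

Lemma cox_img_cap m (c : triad m) k i :
  (cox_space c *m proj3 m k :&: tflag c k i :=:
   tflag (cox c) k i.+1 *m proj3 m k)%MS.
Proof.
apply/eqmxP/andP; split; apply/rV_subP => v.
  rewrite sub_capmx => /andP[/sub_imgP[u uE ->] uW].
  by apply: submxMr; rewrite cox_flagS uE.
case/sub_imgP=> u; rewrite cox_flagS sub_capmx => /andP[uE uW] ->.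
by rewrite uW andbT submxMr.
Qed.

(* The functor only kills summands supported on a single arm, and the number of
   these is determined by the ranks. *)
Lemma cox_reflects_iso m (c c' : triad m) :
    triad_wf c -> triad_wf c' -> same_ranks c c' ->
    triad_iso (cox c) (cox c') ->
  triad_iso c c'.
Proof.
move=> wf wf' [rE rW] [g g_unit [/= Eg Wg]].
have [W0 mW WE] := wf; have [W0' mW' WE'] := wf'.
have {}Wg k i : (i <= (r k).+1)%N ->
    (tflag (cox c) k i *m g :=: tflag (cox c') k i)%MS.
  rewrite leq_eqVlt => /predU1P[-> |]; last exact: Wg.
  apply: eqmx_trans (eqmxMr g (cox_flag_top c k)) _.
  exact: eqmx_trans Eg (eqmx_sym (cox_flag_top c' k)).
pose E := cox_space c; pose S k := E *m proj3 m k.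
have mem_g (u : 'rV_(3 * m)) : (u *m g <= cox_space c')%MS = (u <= E)%MS.
  by rewrite -Eg submxMfree // row_free_unit.
(* The elements of [E] with zero component [k] form step 1 of arm [k], which [g] preserves; hence
   [g] descends to the components. *)
have ker_g k (u : 'rV_(3 * m)) : (u <= E)%MS ->
    u *m proj3 m k = 0 <-> u *m g *m proj3 m k = 0.
  move=> uE; have W1 d (u' : triad d) : triad_wf u' -> forall v : 'rV_(3 * d),
    (v <= cox_space u')%MS -> (v *m proj3 d k == 0) = (v <= tflag (cox u') k 1)%MS.
    by move=> [w0 _ _] v vE; rewrite cox_flagS vE w0 submx0.
  have E1 := W1 _ c wf u uE; have E2 := W1 _ c' wf' (u *m g).
  rewrite mem_g -(Wg k 1) // submxMfree ?row_free_unit // in E2.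
  by split=> /eqP u0; apply/eqP; move: u0; rewrite E1 (E2 uE).
have /fin_all_exists[a Ea] k : exists a : 'M_m,
    E *m (proj3 m k *m a) = E *m (g *m proj3 m k).
  have [u|a Ea _] := @ext_map F _ _ _ (S k) (E *m g *m proj3 m k).
    by rewrite /S !mulmxA; have [] := ker_g k (u *m E) (submxMl u E).
  by exists a; rewrite !mulmxA.
have Sa k : S k *m a k = E *m g *m proj3 m k by rewrite -!mulmxA Ea.
have ra k : \rank (S k *m a k) = \rank (S k).
  apply: inj_on_rank => _ /sub_imgP[u uE ->].
  by rewrite -mulmxA (agree_sub uE (Ea k)) mulmxA; have [] := ker_g k u uE.
(* The descended map [a k] is prescribed on the components of [E] only; equality of ranks extends it
   to an isomorphism of the whole flag [k]. *)
have /fin_all_exists[h hP] k : exists h : 'M_m, h \in unitmx /\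
   S k *m h = S k *m a k /\
   forall i, (i <= r k)%N -> (tflag c k i *m h :=: tflag c' k i)%MS.
  have [i i_le|i i_le|h hU hP] :=
    filtration_ext_iso (t := r k) (mW k) (mW' k) (ra k); last by exists h.
    have EW : (tflag (cox c) k i.+1 *m (proj3 m k *m a k) =
               tflag (cox c) k i.+1 *m (g *m proj3 m k)).
      by apply: agree_sub (Ea k); rewrite capmxSl.
    apply: eqmx_trans (eqmxMr _ (cox_img_cap c k i)) _.
    rewrite -mulmxA EW mulmxA; apply: eqmx_trans (eqmxMr _ (Wg k _ _)) _ => //.
    apply: eqmx_trans (eqmx_sym (cox_img_cap c' k i)) _.
    apply: cap_eqmx; last exact: eqmx_refl.
    rewrite Sa; exact: eqmxMr (eqmx_sym Eg).
  exact: rW.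
have hU k : h k \in unitmx by have [] := hP k.
have Sh k : S k *m h k = S k *m a k by have [_ []] := hP k.
have Wh k i : (i <= r k)%N -> (tflag c k i *m h k :=: tflag c' k i)%MS.
  by have [_ [_]] := hP k; apply.
have uh k (u : 'rV_(3 * m)) : (u <= E)%MS ->
    u *m proj3 m k *m h k = u *m g *m proj3 m k.
  move=> uE; rewrite -!mulmxA; apply: agree_sub uE _.
  by rewrite [LHS]mulmxA [RHS]mulmxA (Sh k) (Sa k).
(* Zero-sum triples of top vectors are exactly the elements of [E], where the three maps [h k] come
   from the single map [g]; so they can be glued. *)
have [|H HU WH] := @glue3_iso m (fun k => tflag c k (r k)) h.
  move=> x xW; split=> x0.
    pose u := tuple3 x.
    have uE : (u <= E)%MS.
      apply/cox_spaceP; split=> [k|]; first by rewrite tuple3K.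
      by rewrite -[RHS]x0; apply: eq_bigr => k _; rewrite tuple3K.
    under eq_bigr => k _ do rewrite -(tuple3K x k) uh //.
    by have := uE; rewrite -mem_g => /cox_spaceP[].
  pose u := tuple3 (fun k => x k *m h k) *m invmx g.
  have ug : u *m g = tuple3 (fun k => x k *m h k) by rewrite mulmxKV.
  have uE : (u <= E)%MS.
    rewrite -mem_g ug; apply/cox_spaceP.
    split=> [k|]; last by rewrite -[RHS]x0; apply: eq_bigr => k _; rewrite tuple3K.
    by rewrite tuple3K -(Wh k (r k)) // submxMr.
  have [_ u0] := (cox_spaceP c u).1 uE; rewrite -[RHS]u0; apply: eq_bigr => k _.
  by apply: (can_inj (mulmxK (hU k))); rewrite uh // ug tuple3K.
have WH' k i : (i <= r k)%N -> (tflag c k i *m H :=: tflag c' k i)%MS.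
  move=> ik; rewrite (agree_sub (filtrationS (mW k) ik) (WH k)); exact: Wh.
pose A := (\sum_k tflag c k (r k))%MS.
have AE : (A <= tspace c)%MS by apply/sumsmx_subP.
have rH : \rank (A *m H) = \rank A by apply: mxrankMfree; rewrite row_free_unit.
(* A complement of the sum of the flags in [tspace] carries no structure, so there the equality of
   ranks is enough. *)
have [|h' h'U [Ah' Eh']] := glue_step_iso rH _ rE.
  apply: eqmx_trans (eqmxMr H (capmx_idPl AE)) (eqmx_sym _).
  apply/capmx_idPl; rewrite sumsmxMr; apply/sumsmx_subP => k _.
  by rewrite WH' // WE'.
exists h' => //; split=> // k i ik.
rewrite (agree_sub _ Ah') //; first exact: WH'.
by rewrite (sumsmx_sup k) // filtrationS.
Qed.
End Coxeter.
End Triads.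

Lemma ord3_others (k : 'I_3) :
  exists l j : 'I_3, perm_eq (index_enum 'I_3) [:: k; l; j].
Proof.
by case: k => -[|[|[|//]]] i;
  [ exists (@Ordinal 3 1 isT), (@Ordinal 3 2 isT)
  | exists (@Ordinal 3 0 isT), (@Ordinal 3 2 isT)
  | exists (@Ordinal 3 0 isT), (@Ordinal 3 1 isT)];
  apply: (uniq_perm (index_enum_uniq _)) => // -[[|[|[|//]]] j];
  rewrite mem_index_enum.
Qed.

(** * Direct summands under the Coxeter functor *)

Section CoxeterLift.
Variables (F : fieldType) (r : 'I_3 -> nat).

Definition idem_endo m (c : triad F m) (e : 'M[F]_m) :=
  [/\ (tspace c *m e <= tspace c)%MS,
      forall k i, (i <= r k)%N -> (tflag c k i *m e <= tflag c k i)%MS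
    & tspace c *m e *m e = tspace c *m e].

(* Direct summands are encoded by idempotent endomorphisms e; the image of the
   lift d has no summand killed by the functor, whence the rank formula. *)
Lemma cox_lift m (c : triad F m) (e : 'M_(3 * m)) :
    triad_wf c -> idem_endo (cox r c) e ->
  exists2 d, idem_endo c d &
    (\rank (tspace (cox r c) *m e) + \rank (tspace c *m d) =
       \sum_k \rank (tflag c k (r k) *m d))%N /\
    forall k i, (i <= r k)%N ->
      (\rank (tflag (cox r c) k i.+1 *m e) + \rank (tspace c *m d) =
       \rank (tflag c k i *m d) + \sum_(l | l != k) \rank (tflag c l (r l) *m d))%N.
Proof.
move=> wf [/= Ee We ee]; have [W0 mW WE] := wf.
have [_ mW' WE'] := cox_wf r wf.
pose E := cox_space r c; pose W' k i := tflag (cox r c) k i.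
have {}We k i : (i <= (r k).+1)%N -> (W' k i *m e <= W' k i)%MS.
  rewrite leq_eqVlt => /predU1P[->|]; last exact: We.
  by rewrite (eqmxMr e (cox_flag_top r c k)) cox_flag_top.
have eK l (X : 'M_(l, _)) : (X <= E *m e)%MS -> X *m e = X.
  by case/submxP=> D ->; rewrite -mulmxA ee.
have eE (u : 'rV_(3 * m)) : (u <= E)%MS -> (u *m e <= E)%MS.
  by move=> uE; apply: submx_trans (submxMr e uE) Ee.
have /fin_all_exists[a Ea] k : exists a : 'M_m,
    E *m (proj3 F m k *m a) = E *m (e *m proj3 F m k).
  have [u|a Ea _] := @ext_map F _ _ _ (E *m proj3 F m k) (E *m e *m proj3 F m k).
    rewrite !mulmxA => u0; apply/eqP; rewrite -submx0 -(W0 k).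
    have uW : (u *m E <= W' k 1)%MS by rewrite cox_flagS submxMl u0 sub0mx.
    have := submx_trans (submxMr e uW) (We k 1 isT).
    by rewrite cox_flagS => /andP[].
  by exists a; rewrite !mulmxA.
pose X k i := W' k i.+1 *m e *m proj3 F m k.
have mW'' k : filtration (fun i => <<X k i>>%MS).
  by move=> i; rewrite !genmxE !submxMr // mW'.
have XW k i : (i <= r k)%N -> (X k i <= tflag c k i)%MS.
  move=> ik; apply/rV_subP => _ /sub_imgP[u uW ->].
  by have := submx_trans uW (We k i.+1 ik); rewrite cox_flagS => /andP[].
(* The extension of [a k] is forced into [X k], the flag of components of the image of [e], so that
   the lift acquires nothing else. *)
have /fin_all_exists[h hP] k : exists h : 'M_m,
    E *m proj3 F m k *m h = E *m proj3 F m k *m a k /\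
    forall i, (i <= r k)%N -> (tflag c k i *m h <= X k i)%MS.
  have [i ik|h Eh Wh] := filtration_ext (S := E *m proj3 F m k) (f := a k) (t := r
    k)
    (mW k) (mW'' k).
    rewrite genmxE (eqmxMr _ (cox_img_cap r c k i)) -mulmxA.
    by rewrite (agree_sub (capmxSl _ _) (Ea k)) !mulmxA.
  by exists h; split=> // i /Wh; rewrite genmxE.
have uh k (u : 'rV_(3 * m)) : (u <= E)%MS ->
    u *m proj3 F m k *m h k = u *m e *m proj3 F m k.
  move=> uE; rewrite -!mulmxA; apply: agree_sub uE _.
  by rewrite [LHS]mulmxA (hP k).1 -mulmxA Ea.
have Wh k i : (i <= r k)%N -> (tflag c k i *m h k <= X k i)%MS.
  exact: (hP k).2.
have [|d Wd dX] := @glue3 F m m (fun k => tflag c k (r k)) h.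
  move=> x xW x0; pose u := tuple3 x.
  have uE : (u <= E)%MS.
    apply/cox_spaceP; split=> [k|]; first by rewrite tuple3K.
    by rewrite -[RHS]x0; apply: eq_bigr => k _; rewrite tuple3K.
  under eq_bigr => k _ do rewrite -(tuple3K x k) uh //.
  by have /cox_spaceP[] := eE u uE.
have Wid k i l (Y : 'M_(l, m)) : (i <= r k)%N -> (Y <= tflag c k i)%MS -> Y *m d =
  Y *m h k.
  by move=> ik YW; apply: agree_sub (Wd k);
    apply: submx_trans YW (filtrationS (mW k) ik).
have XE k i : (X k i <= E *m e *m proj3 F m k)%MS by rewrite !submxMr ?WE'.
(* As [e] is idempotent, the lift is the identity on the components of its image. These span the
   image of the lift, which is thus idempotent too. *)
have dfix k l (Y : 'M_(l, m)) : (Y <= E *m e *m proj3 F m k)%MS -> Y *m d = Y.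
  case/submxP=> D ->; rewrite -mulmxA; congr (_ *m _); apply: mulmx_ext => v.
  have uE : (v *m E *m e <= E)%MS by rewrite eE // submxMl.
  have uW := ((cox_spaceP r c _).1 uE).1 k.
  by rewrite !mulmxA (Wid k (r k)) // uh // eK // -mulmxA submxMl.
have XdE k i : (i <= r k)%N -> (tflag c k i *m d :=: X k i)%MS.
  move=> ik; apply/eqmxP/andP; split; first by rewrite (Wid k i) // Wh.
  by rewrite -(dfix k _ (X k i) (XE k i)) submxMr // XW.
have Xtop k : (X k (r k) :=: E *m e *m proj3 F m k)%MS.
  by do 2 apply: eqmxMr; apply: cox_flag_top.
pose D := (\sum_k <<E *m e *m proj3 F m k>>)%MS.
have DE : (D <= tspace c)%MS.
  by apply/sumsmx_subP => k _; rewrite genmxE -Xtop (submx_trans (XW k _ _)).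
have Dfix l (Y : 'M_(l, m)) : (Y <= D)%MS -> Y *m d = Y.
  case/sub_sumsmxP=> B ->; rewrite mulmx_suml; apply: eq_bigr => k _.
  by rewrite (dfix k) // (submx_trans (submxMl _ _)) ?genmxE.
have dD : (d <= D)%MS.
  apply: dX => k; apply: submx_trans (Wh k _ (leqnn _)) _.
  by rewrite (sumsmx_sup k) // genmxE XE.
have EdD : (tspace c *m d :=: D)%MS.
  apply/eqmxP; rewrite (submx_trans (submxMl _ _) dD) /=.
  by rewrite -{1}(Dfix _ D) // submxMr.
exists d.
  split=> [|k i ik|]; first by rewrite EdD.
    by rewrite XdE // XW.
  by apply: Dfix; apply: submx_trans (submxMl _ _) dD.
(* The projection to component [k] has image [X k i]. Its kernel [K] consists of triples
   [(0, v, -v)], so it is the intersection of the other two tops of [X], while [D] is their sum. *)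
have key k i : (i <= r k)%N ->
   (\rank (W' k i.+1 *m e) + \rank D =
     \rank (X k i) + \sum_(l | l != k) \rank (X l (r l)))%N.
  move=> ik; have [l [j P]] := ord3_others k.
  have Pu : uniq [:: k; l; j] by rewrite -(perm_uniq P) index_enum_uniq.
  have [kl kj lj] : [/\ l != k, j != k & l != j].
    by move: Pu; rewrite /= !inE negb_or !(eq_sym k) => /and3P[/andP[-> ->] ->].
  have sum3 (V : nmodType) (G : 'I_3 -> V) : \sum_k G k = G k + (G l + G j).
    by rewrite (perm_big _ P) /= !big_cons big_nil addr0.
  rewrite (perm_big _ P) /= !big_cons big_nil eqxx kl kj addn0.
  pose K := (W' k i.+1 *m e :&: kermx (proj3 F m k))%MS.
  have KP (u : 'rV_(3 * m)) : (u <= K)%MS -> [/\ (u <= E *m e)%MS, u *m proj3 F m k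
    = 0
       & u *m proj3 F m j = - (u *m proj3 F m l)].
    rewrite sub_capmx sub_kermx => /andP[uW /eqP u0].
    have uEe := submx_trans uW (submxMr e (WE' k i.+1)).
    split=> //; apply/eqP; rewrite -addr_eq0 addrC; apply/eqP.
    have [_] := (cox_spaceP r c u).1 (submx_trans uEe Ee).
    by rewrite sum3 u0 add0r.
  have rK : \rank (K *m proj3 F m l) = \rank K.
    apply: inj_on_rank => u /KP[_ uk uj] ul; apply: proj3_inj => i'.
    have : i' \in [:: k; l; j] by rewrite -(perm_mem P) mem_index_enum.
    by rewrite !inE mul0mx => /or3P[]/eqP->; rewrite ?uj ?ul ?uk ?oppr0.
  have KX : (K *m proj3 F m l :=: X l (r l) :&: X j (r j))%MS.
    apply/eqmxP/andP; split; apply/rV_subP => v.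
      case/sub_imgP=> u /KP[uE uk uj] ->; rewrite sub_capmx !Xtop submxMr //=.
      by rewrite -eqmx_opp -uj submxMr.
    rewrite sub_capmx => /andP[vl vj].
    pose x i' := if i' == l then v else if i' == j then - v else 0.
    have xk : x k = 0 by rewrite /x !(eq_sym k) (negPf kl) (negPf kj).
    have xl : x l = v by rewrite /x eqxx.
    have xj : x j = - v by rewrite /x eqxx eq_sym (negPf lj).
    have uE : (tuple3 x <= E)%MS.
      apply/cox_spaceP; split; last by rewrite sum3 !tuple3K xk xl xj subrr addr0.
      move=> i'; have : i' \in [:: k; l; j] by rewrite -(perm_mem P) mem_index_enum.
      rewrite !inE tuple3K => /or3P[]/eqP->;
        rewrite ?xk ?xl ?xj ?sub0mx ?eqmx_opp //.
        exact: submx_trans vl (XW l _ _).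
      exact: submx_trans vj (XW j _ _).
    have ue : tuple3 x *m e = tuple3 x.
      apply: proj3_inj => i'; rewrite -uh //;
        have uW := ((cox_spaceP r c _).1 uE).1 i'.
      rewrite -(Wid i' (r i')) // tuple3K.
      have : i' \in [:: k; l; j] by rewrite -(perm_mem P) mem_index_enum.
      rewrite !inE => /or3P[]/eqP->; rewrite ?xk ?xl ?xj ?mul0mx ?mulNmx //.
        by rewrite (dfix l) // -Xtop.
      by rewrite (dfix j) // -Xtop.
    rewrite -xl -(tuple3K x l) submxMr // sub_capmx sub_kermx tuple3K xk eqxx andbT.
    by rewrite -ue submxMr // cox_flagS uE tuple3K xk sub0mx.
  have XlD i' : (X i' (r i') <= D)%MS by rewrite (sumsmx_sup i') // genmxE XE.
  have DX : (D :=: X l (r l) + X j (r j))%MS.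
    apply/eqmxP/andP; split; last by rewrite addsmx_sub !XlD.
    apply/sumsmx_subP => i' _; rewrite genmxE.
    have : i' \in [:: k; l; j] by rewrite -(perm_mem P) mem_index_enum.
    rewrite !inE => /or3P[]/eqP->; last 2 first.
    - by rewrite -Xtop addsmxSl.
    - by rewrite -Xtop addsmxSr.
    apply/rV_subP => _ /sub_imgP[u uE ->].
    have [_] := (cox_spaceP r c u).1 (submx_trans uE Ee).
    rewrite sum3 => /eqP; rewrite addr_eq0 => /eqP->; rewrite eqmx_opp.
    by rewrite addmx_sub_adds // Xtop submxMr.
  rewrite -(mxrank_mul_ker _ (proj3 F m k)) -/(X k i) -/K -rK KX DX.
  by rewrite -addnA [(\rank (_ :&: _) + _)%N]addnC mxrank_sum_cap.
have rX k i : (i <= r k)%N -> \rank (tflag c k i *m d) = \rank (X k i).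
  by move=> ik; rewrite XdE.
under eq_bigr do rewrite rX //.
split=> [|k i ik]; last first.
  by under eq_bigr do rewrite rX //; rewrite EdD rX // -key.
rewrite EdD (bigD1 ord0) //= -key //; congr (_ + _)%N.
by rewrite (eqmxMr e (cox_flag_top r c ord0)).
Qed.
End CoxeterLift.

(** The labels are given by a relation [C], so no normal form has to be chosen for an element. *)
Definition finite_mod (X : Type) (D : X -> Prop) (R : X -> X -> Prop) :=
  exists (T : finType) (C : X -> T -> Prop),
    (forall x, D x -> exists t, C x t) /\
    forall x y t, D x -> D y -> C x t -> C y t -> R x y.

Lemma finite_mod_refine X Y (D : X -> Prop) R (D' : Y -> Prop) R'
    (T : finType) (f : X -> Y) (g : X -> T) :
    finite_mod D' R' -> (forall x, D x -> D' (f x)) ->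
    (forall x y, D x -> D y -> g x = g y -> R' (f x) (f y) -> R x y) ->
  finite_mod D R.
Proof.
move=> [T' [C [Cex CR]]] DD' RR'; exists (T * T')%type.
exists (fun x t => g x = t.1 /\ C (f x) t.2); split=> [x Dx|x y t Dx Dy].
  by have [t Ct] := Cex _ (DD' x Dx); exists (g x, t).
case=> <- Cx [gy Cy]; apply: RR' => //.
by apply: CR Cx Cy; apply: DD'.
Qed.

Lemma bounded_codes (X : Type) (I : finType) (f : X -> I -> nat) N :
    (forall x i, (f x i <= N)%N) ->
  exists g : X -> {ffun I -> 'I_N.+1}, forall x y, g x = g y -> f x =1 f y.
Proof.
move=> fN; exists (fun x => [ffun i => inord (f x i)]) => x y /ffunP E i.
by have := congr1 val (E i); rewrite !ffunE /= !inordK ?ltnS.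
Qed.

(** * Finiteness through nilpotency of the Coxeter functor; type [E_7] *)

Section FiniteTriads.
Variable F : fieldType.

(** All ranks are at most [m], so they form a finite invariant; with the class of [cox r c] they
    determine that of [c] by [cox_reflects_iso]. *)
Lemma finite_mod_cox r m (D : triad F m -> Prop) (D' : triad F (3 * m) -> Prop) :
    (forall c, D c -> triad_wf c) -> (forall c, D c -> D' (cox r c)) ->
    finite_mod D' (@triad_iso F r _) ->
  finite_mod D (@triad_iso F r _).
Proof.
move=> Dwf DD' fin; pose N := (\max_k r k)%N.+1.
pose f (c : triad F m) (o : option ('I_3 * 'I_N)) :=
  if o is Some (k, i) then \rank (tflag c k i) else \rank (tspace c).
have [|g gP] := bounded_codes (f := f) (N := m).
  by move=> c [[k i]|]; apply: rank_leq_row.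
apply: (finite_mod_refine (g := g) fin) (DD') _ => c c' Dc Dc' /gP E.
apply: cox_reflects_iso; [exact: Dwf | exact: Dwf |].
split=> [|k i ik]; first exact: (E None).
have iN : (i < N)%N by rewrite ltnS; apply: leq_trans ik (leq_bigmax k).
exact: (E (Some (k, Ordinal iN))).
Qed.

(** The factor 3 is put into the argument so that the type agrees by computation with the recursion
    of [iter_cox], which applies the innermost functor first. *)
Fixpoint iter_dim t m := if t is t'.+1 then iter_dim t' (3 * m)%N else m.

Fixpoint iter_cox r t : forall m, triad F m -> triad F (iter_dim t m) :=
  if t is t'.+1 then fun m c => iter_cox r t' (cox r c) else fun m c => c.

Lemma finite_mod_nilpotent r t m :
  finite_mod (fun c : triad F m => triad_wf c /\ tspace (iter_cox r t c) = 0)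
    (@triad_iso F r _).
Proof.
elim: t m => [|t IHt] m /=.
  exists unit, (fun _ _ => True); split=> [c _|c c' _ [wf E0] [wf' E0'] _ _].
    by exists tt.
  have W0 (c1 : triad F m) k i : triad_wf c1 -> tspace c1 = 0 -> tflag c1 k i = 0.
    by move=> [_ _ WE] c10; apply/eqP; rewrite -submx0 -c10 WE.
  exists 1%:M; rewrite ?unitmx1 // mulmx1 E0 E0'; split=> // k i _.
  by rewrite mulmx1 !W0.
apply: finite_mod_cox (IHt (3 * m)%N) => [c [//]|c [wf c0]].
by split=> //; apply: cox_wf.
Qed.

Definition arm0 : 'I_3 := ord0.
Definition arm1 : 'I_3 := lift ord0 ord0.
Definition arm2 : 'I_3 := lift ord0 (lift ord0 ord0).

(** Together with the vertex of the total space, arms of 3, 1 and 2 vertices form the Dynkin diagram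
    [E_7]. *)
Definition arms_E7 (k : 'I_3) : nat := nth 0%N [:: 3; 1; 2] k.

Definition rank_E7 m (c : triad F m) (d : 'M_m) : seq int :=
  [seq (\rank (A *m d))%:Z | A <- [:: tspace c;
    tflag c arm0 1; tflag c arm0 2; tflag c arm0 3; tflag c arm1 1;
    tflag c arm2 1; tflag c arm2 2]].

(** The Coxeter transformation on dimension vectors, read off from the rank formulas of [cox_lift].
    Integers are used because of the subtractions. *)
Definition cox_E7 (v : seq int) : seq int :=
  if v is [:: e; a1; a2; a3; b1; c1; c2] then
    [:: a3 + b1 + c2 - e;
        b1 + c2 - e; a1 + b1 + c2 - e; a2 + b1 + c2 - e;
        a3 + c2 - e;
        a3 + b1 - e; c1 + a3 + b1 - e]
  else v.

(** A closed form for a third of the half period, which keeps the linear expressions short. *)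
Lemma cox_E7_iter3 (a b c d e f g : int) :
  iter 3 cox_E7 [:: a; b; c; d; e; f; g] =
    [:: b + c + d + e + e + f + g - a - a - a;
       c + e - a;
       c + d + e + f - a - a;
       c + d + e + e + f + g - a - a - a;
       b + d + e + g - a - a;
       b + e + f - a;
       b + c + e + f + g - a - a].
Proof. by rewrite /=; do ![congr (_ :: _)]; lia. Qed.

(* The Coxeter number of E_7 is 18 and -1 lies in its Weyl group. *)
Lemma cox_E7_half_period (a b c d e f g : int) :
  iter 9 cox_E7 [:: a; b; c; d; e; f; g] =
    [:: - a; - b; - c; - d; - e; - f; - g].
Proof.
rewrite (iterD 6 3 cox_E7) cox_E7_iter3 (iterD 3 3 cox_E7) !cox_E7_iter3.
by do ![congr (_ :: _)]; lia.
Qed.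

Lemma cox_lift_E7 m (c : triad F m) (e : 'M_(3 * m)) :
    triad_wf c -> idem_endo arms_E7 (cox arms_E7 c) e ->
  exists2 d, idem_endo arms_E7 c d &
    rank_E7 (cox arms_E7 c) e = cox_E7 (rank_E7 c d).
Proof.
move=> wf he; have [d hd [R0 R]] := cox_lift wf he; exists d => //.
have [W0 _ _] := wf.
have sum3 (G : 'I_3 -> nat) : (\sum_k G k = G arm0 + G arm1 + G arm2)%N.
  by rewrite !big_ord_recl big_ord0 addn0 addnA.
have sumk (k : 'I_3) (G : 'I_3 -> nat) :
  (\sum_(l | l != k) G l = (arm0 != k) * G arm0 + (arm1 != k) * G arm1 + (arm2 != k) * G
    arm2)%N.
  by rewrite big_mkcond sum3; do 3 case: (_ != _); rewrite ?mul1n ?mul0n.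
have [r0 r1 r2] : [/\ arms_E7 arm0 = 3, arms_E7 arm1 = 1 & arms_E7 arm2 = 2]%N by [].
have := (R arm0 0 isT, R arm0 1 isT, R arm0 2 isT, (R arm1 0 isT, R arm2 0 isT, R arm2 1
  isT))%N.
move: R0; rewrite sum3 !sumk !W0 !mul0mx !mxrank0 ![_ != _]/= !mul1n !mul0n.
rewrite r0 r1 r2 /rank_E7 /= => R0 [[[R1 R2] R3] [[R4 R5] R6]].
by do ![congr (_ :: _)]; lia.
Qed.

Lemma cox_lift_iter_E7 t m (c : triad F m) e :
    triad_wf c -> idem_endo arms_E7 (iter_cox arms_E7 t c) e ->
  exists2 d, idem_endo arms_E7 c d &
    rank_E7 (iter_cox arms_E7 t c) e = iter t cox_E7 (rank_E7 c d).
Proof.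
elim: t m c e => [|t IHt] m c e wf he; first by exists e.
have [d hd ->] := IHt _ _ _ (cox_wf arms_E7 wf) he.
by have [d' hd' ->] := cox_lift_E7 wf hd; exists d'; rewrite // -iterSr.
Qed.

(** The identity of the ninth iterate lifts to an idempotent of [c], with dimension vector [v] say.
    The iterate then has dimension vector [- v]; both have nonnegative entries, so both vanish. *)
Lemma cox_nilpotent_E7 m (c : triad F m) :
  triad_wf c -> tspace (iter_cox arms_E7 9 c) = 0.
Proof.
move=> wf; have [|d _] := @cox_lift_iter_E7 9 m c 1%:M wf.
  by split=> [|k i _|]; rewrite !mulmx1.
rewrite [iter_cox _ _ _]lock /rank_E7 cox_E7_half_period -lock;
  case=> E _ _ _ _ _ _.
apply/eqP; rewrite -mxrank_eq0 -[tspace _]mulmx1.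
have opp0 (a b : nat) : a%:Z = - b%:Z -> a == 0%N by lia.
exact: opp0 E.
Qed.

Theorem finite_mod_E7 m :
  finite_mod (@triad_wf F m) (@triad_iso F arms_E7 m).
Proof.
have [T [C [Cex CR]]] := finite_mod_nilpotent arms_E7 9 m.
exists T, C; split=> [c wf|c c' t wf wf']; first by apply: Cex;
  rewrite cox_nilpotent_E7.
by apply: CR; rewrite cox_nilpotent_E7.
Qed.
End FiniteTriads.

(** * Zero-one normal forms *)

Section ZeroOneForms.
Variable F : fieldType.

Definition zero_one k l (M : 'M[bool]_(k, l)) : 'M[F]_(k, l) :=
  map_mx (fun b : bool => b%:R) M.

Lemma zero_one0 k l : zero_one (const_mx false : 'M_(k, l)) = 0.
Proof. by apply/matrixP => i j; rewrite !mxE. Qed.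

(* A basis e of Y in which every W i has a 0/1 generating matrix, and v has 0/1
   coordinates: a configuration is determined by M and w up to isomorphism. *)
Definition zero_one_form (I : Type) m (Y : 'M[F]_m) (W : I -> 'M[F]_m)
    (v : 'rV[F]_m) k (M : I -> 'M[bool]_k) (w : 'rV[bool]_k) :=
  exists e : 'M[F]_(k, m), [/\ row_free e, (e :=: Y)%MS,
    forall i, (W i :=: zero_one (M i) *m e)%MS & v = zero_one w *m e].

Definition has_zero_one_form I m Y (W : I -> 'M[F]_m) v :=
  exists k (M : I -> 'M_k) w, zero_one_form Y W v M w.

Lemma zero_one_form_iso I m (Y Y' : 'M[F]_m) (W W' : I -> 'M[F]_m) v v' k
    (M : I -> 'M_k) w :
    zero_one_form Y W v M w -> zero_one_form Y' W' v' M w ->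
  exists2 h : 'M_m, h \in unitmx &
    [/\ (Y *m h :=: Y')%MS, forall i, (W i *m h :=: W' i)%MS & v *m h = v'].
Proof.
move=> [e [fe eY We ve]] [e' [fe' eY' We' ve']].
have [u|h h_unit eh] := @ext_iso F _ _ e e'.
  by split=> /eqP; rewrite mulmx_free_eq0 // => /eqP->; rewrite mul0mx.
exists h => //; split=> [|i|].
- by apply: eqmx_trans (eqmxMr h (eqmx_sym eY)) _; rewrite eh.
- apply: eqmx_trans (eqmxMr h (We i)) _; rewrite -mulmxA eh.
  exact: eqmx_sym.
- by rewrite ve ve' -mulmxA eh.
Qed.

Lemma has_zero_one_form0 I m (Y : 'M[F]_m) (W : I -> 'M[F]_m) v :
    Y = 0 -> (forall i, (W i <= Y)%MS) -> (v <= Y)%MS ->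
  has_zero_one_form Y W v.
Proof.
move=> -> W0 v0; exists 0, (fun _ => const_mx false), (const_mx false), 0; split.
- by rewrite /row_free mxrank0.
- by apply/eqmxP; rewrite !sub0mx.
- by move=> i; have := W0 i; rewrite submx0 => /eqP->; rewrite mulmx0; apply/eqmxP;
    rewrite !sub0mx.
- by rewrite mulmx0; apply/eqP; rewrite -submx0.
Qed.

Lemma idem_decomp k m (X : 'M[F]_(k, m)) (P : 'M[F]_m) :
  (X *m P <= X)%MS -> (X :=: X *m P + X *m (1%:M - P))%MS.
Proof.
move=> XP; apply/eqmxP/andP; split.
  have {1}-> : X = X *m P + X *m (1%:M - P) by rewrite -mulmxDr addrC subrK mulmx1.
  exact: addmx_sub_adds.
rewrite addsmx_sub XP mulmxBr mulmx1 addmx_sub // eqmx_opp //.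
Qed.

Lemma idem_disjoint k l m (X : 'M[F]_(k, m)) (Z : 'M[F]_(l, m)) (P : 'M[F]_m) :
  P *m P = P -> (X *m P :&: Z *m (1%:M - P) = 0)%MS.
Proof.
move=> PP; apply/eqP; rewrite -submx0; apply/rV_subP => u.
rewrite sub_capmx => /andP[/submxP[a ->] /submxP[b E]].
by rewrite mulmxA -[P]PP mulmxA -(mulmxA a X P) E -!mulmxA mulmxBl mul1mx PP subrr
  !mulmx0 sub0mx.
Qed.

Lemma idem_rank k m (X : 'M[F]_(k, m)) (P : 'M[F]_m) :
  P *m P = P -> (X *m P <= X)%MS ->
  \rank X = (\rank (X *m P) + \rank (X *m (1%:M - P)))%N.
Proof.
move=> PP XP; rewrite {1}(idem_decomp XP) mxrank_disjoint_sum //.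
exact: idem_disjoint.
Qed.

(** The idempotent [P] splits the configuration into a summand with basis [e] and coordinates [f],
    already in 0/1 form, and the image of [Q]. The scalar [c] is absorbed by rescaling the whole of
    [e], which changes no subspace. *)
Lemma zero_one_split I m (Y : 'M[F]_m) (W : I -> 'M[F]_m) v k
    (e : 'M[F]_(k, m)) (f : 'M[F]_(m, k)) (M : I -> 'M[bool]_k) w c :
    let P := f *m e in let Q := 1%:M - P in
    e *m f = 1%:M -> (e <= Y)%MS -> (forall i, (zero_one (M i) *m e <= W i)%MS) ->
    (forall i, (W i *m f <= zero_one (M i))%MS) ->
    v *m f = c *: zero_one w ->
    has_zero_one_form (Y *m Q) (fun i => W i *m Q) (v *m Q) ->
  has_zero_one_form Y W v.
Proof.
move=> P Q ef eY MW WM vf [k' [M' [w' [e' [fe' eY' We' ve']]]]].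
have WP i : (W i *m P <= W i)%MS.
  by apply: submx_trans (MW i); rewrite mulmxA submxMr.
have Wf i : (W i *m f :=: zero_one (M i))%MS.
  apply/eqmxP; rewrite WM -[zero_one _]mulmx1 -ef mulmxA submxMr //.
have PP : P *m P = P by rewrite /P mulmxA -(mulmxA f) ef mulmx1.
have YP : (Y *m P <= Y)%MS by rewrite mulmxA (submx_trans (submxMl _ _)).
have eP : e *m P = e by rewrite mulmxA ef mul1mx.
(* For [c = 0] the basis is kept and the coordinates of [v] are set to zero instead. *)
pose a := if c == 0 then 1 else c.
have a0 : a != 0 by rewrite /a; case: (altP (c =P 0)) => // _; apply: oner_neq0.
exists (k + k')%N.
exists (fun i => block_mx (M i) (const_mx false) (const_mx false) (M' i)).
exists (row_mx (if c == 0 then const_mx false else w) w').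
exists (col_mx (a *: e) e').
have YPe : (Y *m P :=: a *: e)%MS.
  apply: eqmx_trans (eqmx_sym (eqmx_scale _ a0)).
  by apply/eqmxP; rewrite mulmxA submxMl -{1}eP -mulmxA submxMr.
split.
- rewrite /row_free -addsmxE mxrank_disjoint_sum.
    rewrite (eqmx_scale _ a0) (eqP fe') eqn_add2r.
    by apply/row_freeP; exists f.
  by apply/eqP; rewrite -submx0 (cap_eqmx (eqmx_sym YPe) eY') idem_disjoint.
- apply: eqmx_trans (eqmx_sym (addsmxE _ _)) _.
  apply: eqmx_trans (eqmx_sym (idem_decomp YP)).
  by apply: adds_eqmx => //; apply: eqmx_sym.
- move=> i; apply: eqmx_trans (idem_decomp (WP i)) _.
  rewrite /zero_one map_block_mx -!/(zero_one _) !zero_one0 mul_block_col.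
  rewrite !mul0mx addr0 add0r; apply: eqmx_trans (addsmxE _ _).
  apply: adds_eqmx => //; rewrite -scalemxAr.
  apply: eqmx_trans (eqmx_sym (eqmx_scale _ a0)); rewrite mulmxA.
  exact: eqmxMr.
- have vP : v *m P = zero_one (if c == 0 then const_mx false else w) *m (a *: e).
    rewrite mulmxA vf -scalemxAl /a.
    case: (altP (c =P 0)) => [->|_]; first by rewrite scale0r zero_one0 mul0mx.
    by rewrite scalemxAr.
  rewrite /zero_one map_row_mx -!/(zero_one _) mul_row_col -ve' -vP -mulmxDr.
  by rewrite addrC subrK mulmx1.
Qed.

Lemma separating_form k m (x : 'rV[F]_m) (C : 'M[F]_(k, m)) :
  ~~ (x <= C)%MS -> exists f : 'cV_m, x *m f = 1%:M /\ C *m f = 0.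
Proof.
move=> xC; have [|f] := @ext_map F _ _ _ (col_mx x C) (col_mx 1%:M (0 : 'cV_k)).
  move=> u; rewrite -[u]hsubmxK !mul_row_col mulmx1 mulmx0 addr0 => /eqP.
  rewrite addr_eq0 [lsubmx u]mx11_scalar mul_scalar_mx => /eqP E.
  have [->|a0] := eqVneq (lsubmx u 0 0) 0; first by rewrite raddf0.
  by case/negP: xC; rewrite -(eqmx_scale _ a0) E eqmx_opp submxMl.
by rewrite mul_col_mx => /eq_col_mx[? ?] _; exists f.
Qed.

Lemma mulmx0_sub k l m n (A : 'M[F]_(k, m)) (C : 'M[F]_(l, m)) (f : 'M_(m, n)) :
  (A <= C)%MS -> C *m f = 0 -> A *m f = 0.
Proof. by case/submxP=> D ->; rewrite -mulmxA => ->; rewrite mulmx0. Qed.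

Lemma zero_one_split_line I m (Y : 'M[F]_m) (W : I -> 'M[F]_m) v
    (x : 'rV_m) (f : 'cV_m) :
    let Q := 1%:M - f *m x in
    x *m f = 1%:M -> (x <= Y)%MS ->
    (forall i, W i *m f = 0 \/ (x <= W i)%MS) ->
    has_zero_one_form (Y *m Q) (fun i => W i *m Q) (v *m Q) ->
  has_zero_one_form Y W v.
Proof.
move=> Q xf xY Wf; apply: (zero_one_split (e := x) (f := f)
  (M := fun i => const_mx (W i *m f != 0)) (w := const_mx true)
  (c := (v *m f) 0 0)) => // [i|i|].
- case: (altP (W i *m f =P 0)) => [_|nz] /=;
    first by rewrite zero_one0 mul0mx sub0mx.
  by case: (Wf i) nz => [->|xW _]; rewrite ?eqxx // (submx_trans (submxMl _ _)).
- case: (altP (W i *m f =P 0)) => [->|_] /=; first exact: sub0mx.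
  have -> : zero_one (const_mx true) = 1%:M :> 'M[F]_1.
    by apply/matrixP => j k; rewrite !mxE !ord1.
  exact: submx1.
- by apply/matrixP => j k; rewrite !ord1 !mxE mulr1.
Qed.

Definition below m (C : nat -> 'M[F]_m) j := if j is j'.+1 then C j' else 0.

Lemma sub_below m (C : nat -> 'M[F]_m) t j :
  filtration C -> (t < j)%N -> (C t <= below C j)%MS.
Proof. by case: j => // j mC; rewrite ltnS; apply: filtrationS. Qed.

Lemma filtration_mulr m (C : nat -> 'M[F]_m) Q :
  filtration C -> filtration (fun i => C i *m Q).
Proof. by move=> mC i; apply: submxMr. Qed.

Lemma idem_rank1 m (x : 'rV[F]_m) (f : 'cV[F]_m) (Y : 'M[F]_m) :
    x *m f = 1%:M -> (x <= Y)%MS ->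
  (\rank (Y *m (1%:M - f *m x)) < \rank Y)%N.
Proof.
move=> xf xY; rewrite (@idem_rank _ _ Y (f *m x)).
- rewrite -[X in (X < _)%N]add0n ltn_add2r lt0n mxrank_eq0.
  apply/eqP => YP; have : x *m (f *m x) = 0.
    by apply/eqP; rewrite -submx0 -YP submxMr.
  rewrite mulmxA xf mul1mx => x0; move: xf; rewrite x0 mul0mx.
  by move/matrixP/(_ 0 0)/eqP; rewrite !mxE eq_sym oner_eq0.
- by rewrite mulmxA -(mulmxA f) xf mulmx1.
- by rewrite mulmxA (submx_trans (submxMl _ _)).
Qed.

(** A line splits off: [x] lies in the first nonzero [A i] and in the first [B j] meeting it, and
    [f] separates it from the step of [B] before [j]. Earlier steps of [A] are zero, so [f] kills
    every step that does not contain [x]. *)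
Lemma two_flags_zero_one m (Y : 'M[F]_m) (A B : nat -> 'M[F]_m) v r s :
    filtration A -> filtration B ->
    (forall i, A i <= Y)%MS -> (forall i, B i <= Y)%MS ->
    (A r :=: Y)%MS -> (B s :=: Y)%MS -> (v <= Y)%MS ->
  has_zero_one_form Y (fun i : bool * nat => (if i.1 then A else B) i.2) v.
Proof.
have [n] := ubnP (\rank Y);
  elim: n Y A B v => // n IHn Y A B v rY mA mB AY BY Ar Bs vY.
have [Y0|Y0] := eqVneq Y 0.
  by apply: has_zero_one_form0 => // -[[] i] /=.
have exA : exists i, A i != 0 by exists r; rewrite -mxrank_eq0 Ar mxrank_eq0.
have [i Ai0 imin] := ex_minnP exA.
have exB : exists j, (A i :&: B j)%MS != 0.
  by exists s;
    rewrite -mxrank_eq0 (cap_eqmx (eqmx_refl _) Bs) (capmx_idPl (AY i)) mxrank_eq0.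
have [j Bj0 jmin] := ex_minnP exB.
pose x := nz_row (A i :&: B j)%MS.
have x0 : x != 0 by rewrite nz_row_eq0.
have [xA xB] : (x <= A i)%MS /\ (x <= B j)%MS.
  by apply/andP; rewrite -sub_capmx nz_row_sub.
have [|f [xf Bf]] := @separating_form _ _ x (below B j).
  apply/negP; case Dj: j => [|j'] /= xB'; first by move: xB';
    rewrite submx0 (negPf x0).
  have /jmin : (A i :&: B j')%MS != 0.
    apply: contraNneq x0 => C0; rewrite -submx0 -C0 sub_capmx xA; exact: xB'.
  by rewrite Dj ltnn.
have xY : (x <= Y)%MS := submx_trans xA (AY i).
apply: (zero_one_split_line xf xY) => [[[] t] /=|].
- case: (ltnP t i) => ti; last by right; apply: submx_trans xA (filtrationS mA ti).
  left; have [->|At0] := eqVneq (A t) 0; first by rewrite mul0mx.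
  by have := imin t At0; rewrite leqNgt ti.
- case: (ltnP t j) => tj; last by right; apply: submx_trans xB (filtrationS mB tj).
  by left; apply: mulmx0_sub Bf; apply: sub_below.
- pose Q := 1%:M - f *m x.
  have [k [M [w H]]] : has_zero_one_form (Y *m Q)
      (fun i : bool * nat => (if i.1 then fun i => A i *m Q else fun i => B i *m Q)
        i.2) (v *m Q).
    apply: IHn; try exact: filtration_mulr.
    - exact: leq_trans (idem_rank1 xf xY) rY.
    - by move=> t; apply: submxMr.
    - by move=> t; apply: submxMr.
    - exact: eqmxMr.
    - exact: eqmxMr.
    - exact: submxMr.
  exists k, M, w; case: H => e [fe eY We ve]; exists e; split=> // -[b t].
  by have := We (b, t); case: b.
Qed.

Definition bool_block2 (a b c d : bool) : 'M[bool]_(1 + 1) :=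
  block_mx (const_mx a) (const_mx b) (const_mx c) (const_mx d).

Lemma zero_one_block2 a b c d :
  zero_one (bool_block2 a b c d) =
  col_mx (row_mx a%:R%:M b%:R%:M) (row_mx c%:R%:M d%:R%:M).
Proof.
have E (e : bool) : map_mx (fun b : bool => b%:R) (const_mx e) = e%:R%:M :> 'M[F]_1.
  by apply/matrixP => i j; rewrite !mxE !ord1.
by rewrite /zero_one map_block_mx !E block_mxEv.
Qed.

Lemma zero_one_block2_mul m a b c d (x y : 'rV[F]_m) :
  zero_one (bool_block2 a b c d) *m col_mx x y =
  col_mx (a%:R *: x + b%:R *: y) (c%:R *: x + d%:R *: y).
Proof. by rewrite zero_one_block2 -block_mxEv mul_block_col !mul_scalar_mx. Qed.

Definition subspaces_and_flag m (U N : 'M[F]_m) (C : nat -> 'M[F]_m) (i : bool +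
  nat) :=
  match i with inl true => U | inl false => N | inr t => C t end.

Lemma has_zero_one_form_eq I m (Y : 'M[F]_m) (W W' : I -> 'M[F]_m) v :
  W =1 W' -> has_zero_one_form Y W v -> has_zero_one_form Y W' v.
Proof.
move=> WW' [k [M [w [e [fe eY We ve]]]]]; exists k, M, w, e; split=> // i.
by rewrite -WW'.
Qed.

(* The indecomposable triples (U, N, C) are of type D: either lines, or planes
   spanned by x in U and y in N with x + y in C i and x, y in C j for some
   i < j.  In both cases the trace on U is at most a line, so that the
   component of v there can be rescaled to 0 or 1. *)
Lemma subspaces_and_flag_zero_one m (Y U N : 'M[F]_m) (C : nat -> 'M[F]_m) v r :
    filtration C -> (U <= Y)%MS -> (N <= Y)%MS -> (forall i, C i <= Y)%MS ->
    (C r :=: Y)%MS -> (v <= U)%MS ->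
  has_zero_one_form Y (subspaces_and_flag U N C) v.
Proof.
have [n] := ubnP (\rank Y).
elim: n Y U N C v => // n IHn Y U N C v rY mC UY NY CY Cr vU.
have [Y0|Y0] := eqVneq Y 0.
  by apply: has_zero_one_form0 => // [[[]|i]|] /=; rewrite ?(submx_trans vU).
have IH Q : (\rank (Y *m Q) < \rank Y)%N ->
    has_zero_one_form (Y *m Q) (fun i => subspaces_and_flag U N C i *m Q) (v *m Q).
  move=> rYQ; apply: (has_zero_one_form_eq
    (W := subspaces_and_flag (U *m Q) (N *m Q) (fun i => C i *m Q))).
    by case=> [[]|].
  apply: IHn; rewrite ?submxMr //; first exact: leq_trans rYQ rY.
  - exact: filtration_mulr.
  - by move=> i; rewrite submxMr.
  - exact: eqmxMr.
have split_line (x : 'rV_m) (f : 'cV_m) j : x *m f = 1%:M -> (x <= C j)%MS ->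
    U *m f = 0 \/ (x <= U)%MS -> N *m f = 0 \/ (x <= N)%MS ->
    below C j *m f = 0 -> has_zero_one_form Y (subspaces_and_flag U N C) v.
  move=> xf xC fU fN fC.
  have xY := submx_trans xC (CY j).
  apply: (zero_one_split_line xf xY) => [[[]|t] //|] /=.
    case: (ltnP t j) => tj; last by right;
      apply: submx_trans xC (filtrationS mC tj).
    by left; apply: mulmx0_sub fC; apply: sub_below.
  by apply: IH; apply: idem_rank1.
(* If [U] and [N] meet, a line of the intersection lying in the earliest possible step of [C] splits
   off. *)
have [UN0|UN0] := eqVneq (U :&: N)%MS 0; last first.
  have exC : exists j, (U :&: N :&: C j)%MS != 0.
    exists r; rewrite -mxrank_eq0 (cap_eqmx (eqmx_refl _) Cr).
    by rewrite (capmx_idPl _) ?mxrank_eq0 // (submx_trans (capmxSl _ _)).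
  have [j Cj0 jmin] := ex_minnP exC.
  pose x := nz_row (U :&: N :&: C j)%MS.
  have x0 : x != 0 by rewrite nz_row_eq0.
  have /and3P[xU xN xC] : [&& x <= U, x <= N & x <= C j]%MS.
    by rewrite andbA -!sub_capmx nz_row_sub.
  have [|f [xf Cf]] := @separating_form _ _ x (below C j).
    apply/negP; case Dj: j => [|j'] /= xC'; first by move: xC';
      rewrite submx0 (negPf x0).
    have /jmin : (U :&: N :&: C j')%MS != 0.
      by apply: contraNneq x0 => C0; rewrite -submx0 -C0 !sub_capmx xU xN.
    by rewrite Dj ltnn.
  by apply: (split_line x f j) => //; right.
(* A vector outside [U + N] in the earliest possible step of [C] splits off a line: by minimality a
   form killing [U + N] kills the earlier steps. *)
have [YUN|YUN] := boolP (Y <= U + N)%MS; last first.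
  have exC : exists j, ~~ (C j <= U + N)%MS by exists r; rewrite Cr.
  have [j Cj jmin] := ex_minnP exC.
  have [i iC] := row_subPn Cj.
  have [f [xf UNf]] := separating_form iC.
  apply: (split_line (row i (C j)) f j) => //; first exact: row_sub.
  - by left; apply: mulmx0_sub UNf; apply: addsmxSl.
  - by left; apply: mulmx0_sub UNf; apply: addsmxSr.
  - apply: mulmx0_sub UNf; case Dj: j => [|j'] /=; rewrite ?sub0mx //.
    by apply/negPn/negP => /jmin; rewrite Dj ltnn.
have exC : exists j, C j != 0 by exists r; rewrite -mxrank_eq0 Cr mxrank_eq0.
have [i Ci0 imin] := ex_minnP exC.
have C0 t : (t < i)%N -> C t = 0.
  by move=> ti; apply/eqP/negPn/negP => /imin; rewrite leqNgt ti.
have Ci : below C i = 0 by case: i {Ci0 imin} C0 => //= i; apply.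
(* Now [Y] is the direct sum of [U] and [N]. If the first nonzero step of [C] meets one of them, a
   common line splits off by a form that kills the other. *)
have [CU0|CU0] := eqVneq (C i :&: U)%MS 0; last first.
  pose x := nz_row (C i :&: U)%MS; have x0 : x != 0 by rewrite nz_row_eq0.
  have /andP[xC xU] : (x <= C i)%MS && (x <= U)%MS by rewrite -sub_capmx nz_row_sub.
  have [|f [xf Nf]] := @separating_form _ _ x N.
    by apply: contra x0 => xN; rewrite -submx0 -UN0 sub_capmx xU.
  by apply: (split_line x f i) => //; [right | left | rewrite Ci mul0mx].
have [CN0|CN0] := eqVneq (C i :&: N)%MS 0; last first.
  pose x := nz_row (C i :&: N)%MS; have x0 : x != 0 by rewrite nz_row_eq0.
  have /andP[xC xN] : (x <= C i)%MS && (x <= N)%MS by rewrite -sub_capmx nz_row_sub.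
  have [|f [xf Uf]] := @separating_form _ _ x U.
    by apply: contra x0 => xU; rewrite -submx0 -UN0 sub_capmx xU.
  by apply: (split_line x f i) => //; [left | right | rewrite Ci mul0mx].
(* Otherwise a vector [z] of that step has nonzero components [x] in [U] and [y] in [N], which span
   the plane to be split off. *)
pose z := nz_row (C i); have z0 : z != 0 by rewrite nz_row_eq0.
have zC : (z <= C i)%MS by rewrite nz_row_sub.
have zUN : (z <= U + N)%MS := submx_trans (submx_trans zC (CY i)) YUN.
pose x := z *m proj_mx U N; pose y := z *m proj_mx N U.
have xyz : x + y = z by apply: add_proj_mx.
have xU : (x <= U)%MS by apply: proj_mx_sub.
have yN : (y <= N)%MS by apply: proj_mx_sub.
have NU0 : (N :&: U)%MS = 0 by rewrite capmxC.
clearbody x y.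
have [p pU pN] : exists2 p : 'M[F]_m,
    forall k (X : 'M_(k, m)), (X <= U)%MS -> X *m p = X &
    forall k (X : 'M_(k, m)), (X <= N)%MS -> X *m p = 0.
  by exists (proj_mx U N) => k X; [apply: proj_mx_id | apply: proj_mx_0].
have [p' pN' pU'] : exists2 p' : 'M[F]_m,
    forall k (X : 'M_(k, m)), (X <= N)%MS -> X *m p' = X &
    forall k (X : 'M_(k, m)), (X <= U)%MS -> X *m p' = 0.
  by exists (proj_mx N U) => k X; [apply: proj_mx_id | apply: proj_mx_0].
have pp' k (X : 'M_(k, m)) : (X <= Y)%MS -> X *m p + X *m p' = X.
  move=> XY; have /sub_addsmxP[[a b] ->] := submx_trans XY YUN.
  rewrite !mulmxDl pU ?submxMl // pN ?submxMl // pU' ?submxMl // pN' ?submxMl //.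
  by rewrite addr0 add0r.
have xC : ~~ (x <= C i)%MS.
  apply: contra z0 => xC; have x0 : x = 0.
    by apply/eqP; rewrite -submx0 -CU0 sub_capmx xC.
  by rewrite -submx0 -CN0 sub_capmx zC -xyz x0 add0r.
have exj : exists j, (x <= C j)%MS by exists r; rewrite Cr (submx_trans xU).
have [j xCj jmin] := ex_minnP exj.
have ij : (i < j)%N.
  by rewrite ltnNge; apply: contra xC => ji;
    apply: submx_trans xCj (filtrationS mC ji).
have zCb : (z <= below C j)%MS by apply: submx_trans zC (sub_below mC ij).
have [|th [xth Cth]] := @separating_form _ _ x (below C j).
  case Dj: j => [|j'] /=; first by rewrite Dj in ij.
  by apply/negP=> /jmin; rewrite Dj ltnn.
have yCj : (y <= C j)%MS.
  have -> : y = z - x by rewrite -xyz addrAC subrr add0r.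
  by rewrite addmx_sub ?eqmx_opp // (submx_trans zC) // filtrationS // ltnW.
(* The form [th] is 1 on [x], -1 on [y], and zero on the steps of [C] before [j]. On such a step the
   two coordinates in [f] agree, so its trace on the plane is contained in the line of [x + y]. *)
pose f := row_mx (p *m th) (- (p' *m th)).
pose e := col_mx x y.
have zth : z *m th = 0 := mulmx0_sub zCb Cth.
have yth : y *m th = - 1%:M.
  by apply/eqP; rewrite -addr_eq0 addrC -xth -mulmxDl xyz zth.
have Xf k (X : 'M_(k, m)) : X *m f = row_mx (X *m p *m th) (- (X *m p' *m th)).
  by rewrite mul_mx_row mulmxN !mulmxA.
have ef : e *m f = 1%:M.
  rewrite /e mul_col_mx !Xf pU // pU' // pN // pN' // xth yth !mul0mx opprK oppr0.
  by rewrite -block_mxEv -scalar_mx_block.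
have eY : (e <= Y)%MS.
  by rewrite -addsmxE addsmx_sub (submx_trans xU) // (submx_trans yN).
pose M (s : bool + nat) := match s with
  | inl true => bool_block2 true false false false
  | inl false => bool_block2 false false false true
  | inr t => if (t < i)%N then bool_block2 false false false false
             else if (t < j)%N then bool_block2 true true false false
             else bool_block2 true false false true end.
apply: (zero_one_split (e := e) (f := f) (M := M)
  (w := row_mx (const_mx true) (const_mx false)) (c := (v *m th) 0 0)) => //.
- have Me a b c d : (zero_one (bool_block2 a b c d) *m e <=
      (a%:R *: x + b%:R *: y)%R + (c%:R *: x + d%:R *: y)%R)%MS.
    by rewrite zero_one_block2_mul -addsmxE.
  case=> [[]|t] /=; rewrite ?(fun_if, if_arg).
  + apply: submx_trans (Me _ _ _ _) _.
    by rewrite !scale1r !scale0r !addr0 addsmx_sub xU sub0mx.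
  + apply: submx_trans (Me _ _ _ _) _.
    by rewrite !scale1r !scale0r !add0r addsmx_sub yN sub0mx.
  case: ltnP => ti;
    first by rewrite (submx_trans (Me _ _ _ _)) // !scale0r !addr0 addsmx_sub
      sub0mx.
  case: ltnP => tj; apply: submx_trans (Me _ _ _ _) _; rewrite !scale1r !scale0r.
    by rewrite xyz addr0 addsmx_sub sub0mx andbT (submx_trans zC) // filtrationS.
  have jt := filtrationS mC tj.
  by rewrite addr0 add0r addsmx_sub (submx_trans xCj) // (submx_trans yCj).
- have fM (a b c d : bool) k (X : 'M_(k, 1)) : (X *m row_mx a%:R%:M b%:R%:M <=
      zero_one (bool_block2 a b c d))%MS.
    by rewrite zero_one_block2 -addsmxE (submx_trans (submxMl _ _)) // addsmxSl.
  case=> [[]|t] /=; rewrite Xf.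
  + rewrite pU // pU' // mul0mx oppr0.
    by have := fM true false false false _ (U *m th);
      rewrite mul_mx_row mulmx1 raddf0 mulmx0.
  + rewrite pN // pN' // mul0mx zero_one_block2 -addsmxE.
    apply: submx_trans (addsmxSr _ _).
    have -> : row_mx 0 (- (N *m th)) = - (N *m th) *m row_mx 0%:M 1%:M.
      by rewrite mul_mx_row mulmx1 raddf0 mulmx0.
    exact: submxMl.
  case: ltnP => ti; first by rewrite C0 // !mul0mx oppr0 row_mx0 sub0mx.
  case: ltnP => tj; last first.
    rewrite (_ : zero_one _ = 1%:M) ?submx1 // zero_one_block2 -block_mxEv.
    by rewrite raddf0 -scalar_mx_block.
  have /eqP : C t *m p *m th + C t *m p' *m th = 0.
    rewrite -mulmxDl pp' //; apply: mulmx0_sub Cth; exact: sub_below.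
  rewrite addr_eq0 => /eqP <-.
  by have := fM true true false false _ (C t *m p *m th); rewrite mul_mx_row mulmx1.
- rewrite Xf pU // pU' // mul0mx oppr0 /zero_one map_row_mx.
  apply/matrixP => a b; rewrite !ord1 !mxE; case: fintype.split => b';
    rewrite !ord1 !mxE.
    by rewrite mulr1.
  by rewrite mulr0.
apply: IH; rewrite (@idem_rank _ _ Y (f *m e)).
- rewrite -[X in (X < _)%N]add0n ltn_add2r lt0n mxrank_eq0; apply/eqP => YP.
  case/negP: z0; rewrite -xyz.
  have e0 : e = 0.
    by apply/eqP; rewrite -[e]mul1mx -ef -mulmxA -submx0 -YP submxMr.
  by move: e0; rewrite -(col_mx0 _ 1 1) => /eq_col_mx[-> ->]; rewrite addr0.
- by rewrite mulmxA -(mulmxA f) ef mulmx1.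
- by rewrite mulmxA (submx_trans (submxMl _ _)).
Qed.
End ZeroOneForms.

(** * Finiteness for the triples of flags of the four cases *)

Section FiniteCases.
Variable F : fieldType.

(** The basis has at most [m] vectors, so the 0/1 data range over a finite type. *)
Lemma finite_mod_zero_one (X : Type) (D : X -> Prop) (I : finType) m
    (Y : X -> 'M[F]_m) (W : X -> I -> 'M[F]_m) (v : X -> 'rV[F]_m) :
    (forall x, D x -> has_zero_one_form (Y x) (W x) (v x)) ->
  finite_mod D (fun x y => exists2 h : 'M_m, h \in unitmx &
    [/\ (Y x *m h :=: Y y)%MS, forall i, (W x i *m h :=: W y i)%MS
      & v x *m h = v y]).
Proof.
move=> Dx;
  pose T (k : 'I_m.+1) : finType := ({ffun I -> 'M[bool]_k} * 'rV[bool]_k)%type.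
exists {k : 'I_m.+1 & T k}.
pose C x (t : {k : 'I_m.+1 & T k}) := let: existT k Mw := t in
  let Mw' := Mw : {ffun I -> 'M[bool]_k} * 'rV[bool]_k in
  zero_one_form (Y x) (W x) (v x) (fun i => Mw'.1 i) Mw'.2.
exists C; split=> [x /Dx [k [M [w H]]]|x y [k Mw] _ _];
  last exact: zero_one_form_iso.
have km : (k < m.+1)%N.
  by case: H => e [fe _ _ _]; rewrite ltnS -(eqP fe) rank_leq_col.
exists (existT T (Ordinal km) ([ffun i => M i], w)); rewrite /C /=.
case: H => e [fe eY We ve]; exists e; split=> // i.
by rewrite /= ffunE.
Qed.

(** Allows a line to be passed as a vector to the 0/1 forms; the zero subspace is covered too, with
    zero vector. *)
Lemma rank_le1 m (L : 'M[F]_m) :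
  (\rank L <= 1)%N -> (L :=: nz_row L)%MS.
Proof.
move=> rL; have [->|L0] := eqVneq L 0.
  by apply/eqmxP; rewrite sub0mx submx0 nz_row_eq0 eqxx.
apply/eqmxP; rewrite nz_row_sub andbT.
have [_ <-] := mxrank_leqif_sup (nz_row_sub L).
rewrite eqn_leq mxrankS ?nz_row_sub //= (leq_trans rL) //.
by rewrite lt0n mxrank_eq0 nz_row_eq0.
Qed.

Section Tops.
Variable r : 'I_3 -> nat.

Definition triad_top m (c : triad F m) :=
  forall k, (tflag c k (r k).+1 :=: tspace c)%MS.

Definition disjoint01 m (c : triad F m) :=
  (tflag c arm0 (r arm0) :&: tflag c arm1 (r arm1))%MS = 0.

(** In a zero-sum triple with zero last component, the other two are opposite, hence lie in both of
    the first two tops. *)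
Lemma cox_flag21 m (c : triad F m) :
  triad_wf c -> disjoint01 c -> tflag (cox r c) arm2 1 = 0.
Proof.
move=> [W0 _ _] dis; apply/eqP; rewrite -submx0; apply/rV_subP => u.
rewrite cox_flagS W0 submx0 => /andP[/cox_spaceP[uW]].
rewrite !big_ord_recl big_ord0 addr0 -/arm1 -/arm2 => + /eqP u2; rewrite u2 addr0.
move/eqP; rewrite addr_eq0 => /eqP u01.
have u0 : u *m proj3 F m arm0 = 0.
  apply/eqP; rewrite -submx0 -dis sub_capmx uW /= u01 eqmx_opp; exact: uW.
have u1 : u *m proj3 F m arm1 = 0 by apply/eqP; rewrite -oppr_eq0 -u01 u0.
suff -> : u = 0 by rewrite sub0mx.
apply: proj3_inj => k; rewrite mul0mx.
have : k \in [:: arm0; arm1; arm2] by case: k => -[|[|[|//]]] i; rewrite !inE.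
by rewrite !inE => /or3P[]/eqP->.
Qed.

(** By [cox_flag21] the last component is injective here, and it lands in step 1 of the original
    arm: a line remains at most a line, one step further up. *)
Lemma cox_flag22 m (c : triad F m) :
    triad_wf c -> disjoint01 c ->
  (\rank (tflag (cox r c) arm2 2) <= \rank (tflag c arm2 1))%N.
Proof.
move=> wf dis; rewrite -(mxrank_mul_ker _ (proj3 F m arm2)).
have -> : (tflag (cox r c) arm2 2 :&: kermx (proj3 F m arm2))%MS = 0.
  apply/eqP; rewrite -submx0 -(cox_flag21 wf dis); apply/rV_subP => u.
  have [W0 _ _] := wf.
  rewrite sub_capmx cox_flagS [in X in _ -> X]cox_flagS sub_kermx W0 submx0.
  by case/andP=> /andP[-> _] ->.
rewrite mxrank0 addn0 mxrankS //; apply/rV_subP => _ /sub_imgP[u + ->].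
by rewrite cox_flagS => /andP[].
Qed.

(** After the functor the third arm is zero followed by at most a line, so two flags and a vector
    remain. *)
Lemma finite_mod_line_or_lagrangian m : r arm2 = 2%N ->
  finite_mod (fun c : triad F m => [/\ triad_wf c, disjoint01 c
    & (\rank (tflag c arm2 1) <= 1)%N]) (@triad_iso F r m).
Proof.
move=> r2.
pose D' (c : triad F (3 * m)) := [/\ triad_wf c, triad_top c,
   tflag c arm2 1 = 0 & (\rank (tflag c arm2 2) <= 1)%N].
apply: (@finite_mod_cox _ _ _ _ D') => [c []//|c [wf dis L1]|].
  split; [exact: cox_wf | exact: cox_flag_top | exact: cox_flag21 |].
  exact: leq_trans (cox_flag22 wf dis) L1.
pose N := (r arm0 + r arm1).+1.
have [|T [C [Cex CR]]] := @finite_mod_zero_one _ D' (bool * 'I_N)%type (3 * m)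
  (fun c => tspace c) (fun c i => tflag c (if i.1 then arm0 else arm1) i.2)
  (fun c => nz_row (tflag c arm2 2)).
  move=> c [[W0 mW WE] top L0 L1].
  have [k [M [w [e [fe eY We ve]]]]] : has_zero_one_form (tspace c)
     (fun i : bool * nat => (if i.1 then tflag c arm0 else tflag c arm1) i.2)
     (nz_row (tflag c arm2 2)).
    apply: two_flags_zero_one (top arm0) (top arm1) _ => //.
    exact: submx_trans (nz_row_sub _) (WE _ _).
  exists k, (fun i => M (i.1, val i.2)), w, e; split=> // i.
  by have := We (i.1, val i.2); case: i.1.
exists T, C; split=> // c c' t Dc Dc' Ct Ct'.
have [h h_unit [Eh Wh vh]] := CR c c' t Dc Dc' Ct Ct'.
have [[W0 _ _] _ L1 L2] := Dc; have [[W0' _ _] _ L1' L2'] := Dc'.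
exists h => //; split=> // k i.
have : k \in [:: arm0; arm1; arm2] by case: (k) => -[|[|[|//]]] ?; rewrite !inE.
rewrite !inE => /or3P[]/eqP-> ik.
- have iN : (i < N)%N by rewrite ltnS (leq_trans ik) ?leq_addr.
  exact: (Wh (true, Ordinal iN)).
- have iN : (i < N)%N by rewrite ltnS (leq_trans ik) ?leq_addl.
  exact: (Wh (false, Ordinal iN)).
move: ik; rewrite r2; case: i => [|[|[|//]]] _.
- by rewrite W0 W0' mul0mx; apply: eqmx_refl.
- by rewrite L1 L1' mul0mx; apply: eqmx_refl.
apply: eqmx_trans (eqmxMr h (rank_le1 L2)) _; rewrite vh.
exact: eqmx_sym (rank_le1 L2').
Qed.

(** After the functor, arm 0 is a flag, arm 1 a single subspace [N], and arm 2 reduces to a vector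
    inside its last step [U]. *)
Lemma finite_mod_line_in_isotropic m : r arm1 = 1%N -> r arm2 = 3%N ->
  finite_mod (fun c : triad F m => [/\ triad_wf c, disjoint01 c
    & (\rank (tflag c arm2 1) <= 1)%N]) (@triad_iso F r m).
Proof.
move=> r1 r2.
pose D' (c : triad F (3 * m)) := [/\ triad_wf c, triad_top c,
   tflag c arm2 1 = 0 & (\rank (tflag c arm2 2) <= 1)%N].
apply: (@finite_mod_cox _ _ _ _ D') => [c []//|c [wf dis L1]|].
  split; [exact: cox_wf | exact: cox_flag_top | exact: cox_flag21 |].
  exact: leq_trans (cox_flag22 wf dis) L1.
pose N := (r arm0).+1.
have [|T [C [Cex CR]]] := @finite_mod_zero_one _ D' (bool + 'I_N)%type (3 * m)
  (fun c => tspace c)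
  (fun c i => subspaces_and_flag (tflag c arm2 3) (tflag c arm1 1) (tflag c arm0)
     (match i with inl b => inl b | inr t => inr (val t) end))
  (fun c => nz_row (tflag c arm2 2)).
  move=> c [[W0 mW WE] top L0 L1].
  have [k [M [w [e [fe eY We ve]]]]] : has_zero_one_form (tspace c)
     (subspaces_and_flag (tflag c arm2 3) (tflag c arm1 1) (tflag c arm0))
     (nz_row (tflag c arm2 2)).
    apply: subspaces_and_flag_zero_one (top arm0) _ => //.
    exact: submx_trans (nz_row_sub _) (mW arm2 2%N).
  exists k, (fun i => M (match i with inl b => inl b | inr t => inr (val t) end)),
    w, e.
  by split=> // i; apply: We.
exists T, C; split=> // c c' t Dc Dc' Ct Ct'.
have [h h_unit [Eh Wh vh]] := CR c c' t Dc Dc' Ct Ct'.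
have [[W0 _ _] _ L1 L2] := Dc; have [[W0' _ _] _ L1' L2'] := Dc'.
exists h => //; split=> // k i.
have : k \in [:: arm0; arm1; arm2] by case: (k) => -[|[|[|//]]] ?; rewrite !inE.
rewrite !inE => /or3P[]/eqP-> ik.
- exact: (Wh (inr (Ordinal (ik : (i < N)%N)))).
- move: ik; rewrite r1; case: i => [|[|//]] _; last exact: (Wh (inl false)).
  by rewrite W0 W0' mul0mx; apply: eqmx_refl.
move: ik; rewrite r2; case: i => [|[|[|[|//]]]] _.
- by rewrite W0 W0' mul0mx; apply: eqmx_refl.
- by rewrite L1 L1' mul0mx; apply: eqmx_refl.
- apply: eqmx_trans (eqmxMr h (rank_le1 L2)) _; rewrite vh.
  exact: eqmx_sym (rank_le1 L2').
exact: (Wh (inl true)).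
Qed.

(** The functor makes step 1 of the third arm zero; [sh] removes this step by an index shift, which
    leaves the arms of [E_7]. *)
Lemma finite_mod_isotropic_in_lagrangian m :
    r arm0 = 3%N -> r arm1 = 1%N -> r arm2 = 3%N ->
  finite_mod (fun c : triad F m => triad_wf c /\ disjoint01 c)
    (@triad_iso F r m).
Proof.
move=> r0 r1 r2.
pose D' (c : triad F (3 * m)) := triad_wf c /\ tflag c arm2 1 = 0.
apply: (@finite_mod_cox _ _ _ _ D') => [c []//|c [wf dis]|].
  by split; [exact: cox_wf | exact: cox_flag21].
pose sh (c : triad F (3 * m)) := Triad (tspace c) (fun k i =>
  if k == arm2 then if i is 0 then 0 else tflag c arm2 i.+1 else tflag c k i).
apply: (finite_mod_refine (f := sh) (g := fun _ => tt) (finite_mod_E7 F (3 * m))).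
  move=> c [[W0 mW WE] L1]; split=> [k|k i|k i] /=.
  - by case: eqP.
  - case: eqP => _; last exact: mW.
    by case: i => [|i]; [rewrite sub0mx | apply: mW].
  - case: eqP => _; last exact: WE.
    by case: i => [|i]; [rewrite sub0mx | apply: WE].
move=> c c' [[W0 _ _] L1] [[W0' _ _] L1'] _ [h h_unit [Eh Wh]].
exists h => //; split=> // k i.
have : k \in [:: arm0; arm1; arm2] by case: (k) => -[|[|[|//]]] ?; rewrite !inE.
rewrite !inE => /or3P[]/eqP->.
- by rewrite r0; apply: (Wh arm0).
- by rewrite r1; apply: (Wh arm1).
rewrite r2; case: i => [|[|i]] ik.
- by rewrite W0 W0' mul0mx; apply: eqmx_refl.
- by rewrite L1 L1' mul0mx; apply: eqmx_refl.
exact: (Wh arm2 i.+1).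
Qed.

Lemma finite_mod_two_flags_line m : r arm1 = 1%N ->
  finite_mod (fun c : triad F m => triad_wf c /\ (\rank (tflag c arm1 1) <= 1)%N)
    (@triad_iso F r m).
Proof.
move=> r1; pose N := (r arm0 + r arm2).+1.
(* Past the end of its arm a flag is continued by [tspace], since [two_flags_zero_one] wants flags
   that end in the total space. *)
pose A (c : triad F m) k i := if (i <= r k)%N then tflag c k i else tspace c.
have [|T [C [Cex CR]]] := @finite_mod_zero_one _
  (fun c : triad F m => triad_wf c /\ (\rank (tflag c arm1 1) <= 1)%N)
  (bool * 'I_N)%type m
  (fun c => tspace c) (fun c i => A c (if i.1 then arm0 else arm2) i.2)
  (fun c => nz_row (tflag c arm1 1)).
  move=> c [[W0 mW WE] L1].
  have mA k : filtration (A c k).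
    move=> i; rewrite /A; case: (leqP i) => ik;
      last by rewrite [(_ <= _)%N]leqNgt (leqW ik).
    by case: ifP => _; [apply: mW | apply: WE].
  have AE k i : (A c k i <= tspace c)%MS by rewrite /A; case: ifP.
  have top k : (A c k (r k).+1 :=: tspace c)%MS by rewrite /A ltnn;
    apply: eqmx_refl.
  have [k [M [w [e [fe eY We ve]]]]] : has_zero_one_form (tspace c)
     (fun i : bool * nat => (if i.1 then A c arm0 else A c arm2) i.2)
     (nz_row (tflag c arm1 1)).
    apply: two_flags_zero_one (top arm0) (top arm2) _ => //.
    exact: submx_trans (nz_row_sub _) (WE _ _).
  exists k, (fun i => M (i.1, val i.2)), w, e; split=> // i.
  by have := We (i.1, val i.2); case: i.1.
exists T, C; split=> // c c' t Dc Dc' Ct Ct'.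
have [h h_unit [Eh Wh vh]] := CR c c' t Dc Dc' Ct Ct'.
have [[W0 _ _] L1] := Dc; have [[W0' _ _] L1'] := Dc'.
exists h => //; split=> // k i.
have : k \in [:: arm0; arm1; arm2] by case: (k) => -[|[|[|//]]] ?; rewrite !inE.
rewrite !inE => /or3P[]/eqP-> ik.
- have iN : (i < N)%N by rewrite ltnS (leq_trans ik) ?leq_addr.
  by have := Wh (true, Ordinal iN); rewrite /A /= ik.
- move: ik; rewrite r1; case: i => [|[|//]] _.
    by rewrite W0 W0' mul0mx; apply: eqmx_refl.
  apply: eqmx_trans (eqmxMr h (rank_le1 L1)) _; rewrite vh.
  exact: eqmx_sym (rank_le1 L1').
- have iN : (i < N)%N by rewrite ltnS (leq_trans ik) ?leq_addl.
  by have := Wh (false, Ordinal iN); rewrite /A /= ik.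
Qed.
End Tops.
End FiniteCases.

(** * From linear equivalences to isometries *)

Section SquareRoot.
Variable C : numClosedFieldType.

(* Hensel lifting, one linear factor at a time: a square root f of X modulo P is
   corrected to f + c P, where c solves a nondegenerate equation of degree at
   most 2. *)
Lemma poly_sqrtX (rs : seq C) :
  0 \notin rs -> exists f : {poly C}, \prod_(z <- rs) ('X - z%:P) %| f ^+ 2 - 'X.
Proof.
elim: rs => [|z rs IHrs]; first by exists 0; rewrite big_nil dvd1p.
rewrite inE negb_or eq_sym => /andP[z0 /IHrs[f]].
rewrite big_cons; set P := \prod_(_ <- rs) _ => /dvdpP[Q fQ].
have n2 : 2%:R != 0 :> C by rewrite pnatr_eq0.
have [c cz] : exists c, Q.[z] + 2%:R * c * f.[z] + c ^+ 2 * P.[z] = 0.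
  have := congr1 (horner^~ z) fQ; rewrite !hornerE => fz.
  (* If [P] vanishes at [z], the equation is linear in [c], with coefficient twice the value of [f]
     at [z]; the square of that value is [z], which is nonzero. *)
  have [Pz|Pz] := eqVneq P.[z] 0.
    have fz0 : f.[z] != 0.
      apply: contraNneq z0 => fz0; move: fz; rewrite Pz fz0 mulr0 expr0n /= add0r.
      by move/eqP; rewrite oppr_eq0.
    by exists (- Q.[z] / (2%:R * f.[z])); rewrite Pz; field; rewrite ?n2 ?fz0.
  exists ((sqrtC (f.[z] ^+ 2 - P.[z] * Q.[z]) - f.[z]) / P.[z]).
  have := sqrtCK (f.[z] ^+ 2 - P.[z] * Q.[z]); move: (sqrtC _) => s s2.
  have -> : Q.[z] = (f.[z] ^+ 2 - s ^+ 2) / P.[z] by rewrite s2; field.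
  by field.
exists (f + c *: P).
have -> : (f + c *: P) ^+ 2 - 'X = (Q + (2%:R * c) *: f + c ^+ 2 *: P) * P.
  have -> : 'X = f ^+ 2 - Q * P by rewrite -fQ opprB addrC subrK.
  by rewrite -!mul_polyC; ring.
apply: dvdp_mul => //; rewrite dvdp_XsubCl; apply/eqP.
by rewrite !hornerE.
Qed.

(** By Cayley-Hamilton, a square root of ['X] modulo the characteristic polynomial gives one of [A].
    As a polynomial in [A] it inherits stable subspaces and self-adjointness. *)
Lemma sqrt_mx m (A : 'M[C]_m) : A \in unitmx ->
  exists s : 'M_m, [/\ s *m s = A,
    forall X : 'M_m, (X *m A <= X)%MS -> (X *m s <= X)%MS
    & forall B : 'M_m, A *m B = B *m A^T -> s *m B = B *m s^T].
Proof.
case: m A => [|m] A Au.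
  by exists A; split=> // ; apply/matrixP => -[].
have [rs] := closed_field_poly_normal (char_poly A).
rewrite (monicP (char_poly_monic A)) scale1r => Ars.
have rs0 : 0 \notin rs.
  rewrite -root_prod_XsubC -Ars /root horner_coef0 char_poly_det.
  by rewrite mulf_eq0 signr_eq0 -unitfE -unitmxE Au.
have [f] := poly_sqrtX rs0; rewrite -Ars => /dvdpP[Q fQ].
exists (horner_mx A f); split=> [|X XA|B AB].
- have := congr1 (horner_mx A) fQ; rewrite rmorphM /= Cayley_Hamilton mulr0.
  by rewrite rmorphB rmorphXn /= horner_mx_X => /eqP;
    rewrite subr_eq0 expr2 => /eqP.
- exact: horner_mx_stable.
- elim/poly_ind: f {fQ} => [|f c IHf]; first by rewrite rmorph0 trmx0 mul0mx mulmx0.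
  have hA : horner_mx A f *m A = A *m horner_mx A f.
    have := congr1 (horner_mx A) (mulrC f 'X).
    by rewrite !rmorphM /= horner_mx_X.
  rewrite rmorphD rmorphM /= horner_mx_X horner_mx_C linearD /= tr_scalar_mx.
  rewrite mulmxDl mulmxDr scalar_mxC; congr (_ + _).
  rewrite -[_ * A]/(_ *m A) {2}hA trmx_mul -mulmxA AB.
  by rewrite mulmxA IHf -mulmxA.
Qed.
End SquareRoot.

(** * Orthogonals, and isometries obtained from linear maps *)

Section Orthogonalisation.
Variable F : fieldType.

Definition orthmx m (B X : 'M[F]_m) : 'M[F]_m := kermx (B *m X^T).

Lemma sub_orthmx k m (B X : 'M[F]_m) (Y : 'M_(k, m)) :
  (Y <= orthmx B X)%MS = (Y *m B *m X^T == 0).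
Proof. by rewrite sub_kermx mulmxA. Qed.

Lemma orthmx_sym k m (B X : 'M[F]_m) (Y : 'M_(k, m)) : B^T = B ->
  (Y <= orthmx B X)%MS = (X *m B *m Y^T == 0).
Proof.
move=> sB; rewrite sub_orthmx -(inj_eq trmx_inj) !trmx_mul trmxK sB trmx0.
by rewrite mulmxA.
Qed.

Lemma rank_orthmx m (B X : 'M[F]_m) :
  B \in unitmx -> \rank (orthmx B X) = (m - \rank X)%N.
Proof.
move=> Bu; rewrite mxrank_ker -(mxrank_tr (_ *m _)) trmx_mul trmxK mxrankMfree //.
by rewrite row_free_unit unitmx_tr.
Qed.

Lemma orthmxK m (B X : 'M[F]_m) :
  B^T = B -> B \in unitmx -> (orthmx B (orthmx B X) :=: X)%MS.
Proof.
move=> sB Bu; apply/eqmx_sym/eqmxP.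
have XX : (X <= orthmx B (orthmx B X))%MS.
  by rewrite orthmx_sym // -sub_orthmx.
by rewrite -(mxrank_leqif_eq XX) !rank_orthmx // subKn // rank_leq_row.
Qed.

Lemma orthmxS m (B X Y : 'M[F]_m) : (X <= Y)%MS -> (orthmx B Y <= orthmx B X)%MS.
Proof.
case/submxP=> D ->; rewrite sub_orthmx trmx_mul mulmxA.
have : (orthmx B Y <= orthmx B Y)%MS by [].
by rewrite sub_orthmx => /eqP->; rewrite mul0mx.
Qed.

Lemma orthmx_isometry m (B X g : 'M[F]_m) :
    g *m B *m g^T = B -> g \in unitmx ->
  (orthmx B X *m g :=: orthmx B (X *m g))%MS.
Proof.
move=> gB gu; apply/eqmxP.
have H (Y : 'M_m) : (Y *m g <= orthmx B (X *m g))%MS = (Y <= orthmx B X)%MS.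
  rewrite !sub_orthmx trmx_mul -{2}gB.
  by rewrite !mulmxA.
rewrite H submx_refl /= -[X in (X <= _)%MS](mulmxKV gu) submxMr // -H.
by rewrite mulmxKV.
Qed.
End Orthogonalisation.

(* If h carries the X j and their orthogonals to the Y j and theirs, then
   A = h B h^T B^-1 is self-adjoint and stabilises every X j, and so does its
   square root s; then s^-1 h is an isometry. *)
Lemma isometry_of_linear (C : numClosedFieldType) m (B h : 'M[C]_m) (J : Type)
    (X Y : J -> 'M[C]_m) :
    B^T = B -> B \in unitmx -> h \in unitmx ->
    (forall j, X j *m h :=: Y j)%MS ->
    (forall j, orthmx B (X j) *m h :=: orthmx B (Y j))%MS ->
  exists2 g : 'M_m, g *m B *m g^T = B & forall j, (X j *m g :=: Y j)%MS.
Proof.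
move=> sB Bu hu Xh Xh'; pose A := h *m B *m h^T *m invmx B.
have AB : A *m B = h *m B *m h^T by rewrite mulmxKV.
have Au : A \in unitmx by rewrite !unitmx_mul hu Bu unitmx_tr hu unitmx_inv.
have [s [ss sX sB']] := sqrt_mx Au.
have su : s \in unitmx.
  by move: Au; rewrite -ss unitmx_mul andbb.
(* [X j] is the orthogonal of its orthogonal [Z], and [X j *m A] is orthogonal to [Z] because [h]
   carries [X j] and [Z] to mutually orthogonal subspaces. *)
have {}sX j : (X j *m s :=: X j)%MS.
  apply/eqmxP; rewrite -(mxrank_leqif_eq (sX _ _)).
    by rewrite mxrankMfree // row_free_unit.
  rewrite -(orthmxK (X j) sB Bu) sub_orthmx -(mulmxA (X j)) AB.
  rewrite (_ : _ *m _^T = X j *m h *m B *m (orthmx B (X j) *m h)^T); last first.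
    move: (orthmx _ _) => Z; by rewrite trmx_mul !mulmxA.
  rewrite -orthmx_sym // (submx_trans _ (orthmxS B (_ : X j *m h <= Y j)%MS)) //.
    by rewrite Xh'.
  by rewrite Xh.
have {}sB' : s *m B = B *m s^T.
  apply: sB'; rewrite AB; apply: trmx_inj.
  by rewrite !trmx_mul !trmxK sB mulmxA -[A *m _]/(A *m B) AB.
exists (invmx s *m h) => [|j].
  rewrite trmx_mul trmx_inv !mulmxA -(mulmxA (invmx s) h) -(mulmxA (invmx s)) -AB.
  rewrite -ss -(mulmxA s) sB' !mulmxA (mulVmx su) mul1mx.
  by rewrite -mulmxA mulmxV ?mulmx1 // unitmx_tr.
rewrite mulmxA; apply: eqmx_trans (Xh j); apply: eqmxMr.
apply: eqmx_trans (eqmxMr (invmx s) (eqmx_sym (sX j))) _.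
by rewrite mulmxK.
Qed.

(** * Flags in an orthogonal sum *)

Lemma pairwise_rev (T : Type) (e : rel T) s :
  pairwise e (rev s) = pairwise (fun x y => e y x) s.
Proof.
elim: s => //= x s IHs; rewrite rev_cons pairwise_rcons IHs.
by rewrite all_rev.
Qed.

Section Chains.
Variable F : fieldType.

Definition isotropic_chain m (B : 'M[F]_m) (s : seq 'M[F]_m) :=
  pairwise submx s && all (fun X => (X <= orthmx B X)%MS) s.

(** The orthogonals are included because [isometry_of_linear] asks for compatibility with them; in
    reverse order they prolong the increasing chain. *)
Definition saturate m (B : 'M[F]_m) (s : seq 'M[F]_m) :=
  s ++ rev [seq orthmx B X | X <- s].

Lemma size_saturate m (B : 'M[F]_m) s : size (saturate B s) = (size s).*2.
Proof. by rewrite size_cat size_rev size_map addnn. Qed.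

Lemma nth_saturate_l m (B : 'M[F]_m) s x i :
  (i < size s)%N -> nth x (saturate B s) i = nth x s i.
Proof. by move=> si; rewrite nth_cat si. Qed.

Lemma nth_saturate_r m (B : 'M[F]_m) s x i : (i < size s)%N ->
  nth x (saturate B s) ((size s).*2.-1 - i) = orthmx B (nth x s i).
Proof.
move=> si; rewrite nth_cat ifF; last by lia.
rewrite nth_rev size_map; last by lia.
rewrite (_ : (_ - _)%N = i) ?(nth_map x) //; lia.
Qed.

Lemma pairwise_saturate m (B : 'M[F]_m) s : B^T = B ->
  isotropic_chain B s -> pairwise submx (saturate B s).
Proof.
move=> sB /andP[ps /allP iso]; rewrite pairwise_cat ps /=; apply/andP; split.
  apply/allrelP => X Z Xs; rewrite mem_rev => /mapP[Y Ys ->].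
  have [XY|YX] : (X <= Y)%MS \/ (Y <= X)%MS.
    move: Xs Ys ps => /(nthP 0)[i si <-] /(nthP 0)[j sj <-] /(pairwiseP 0) ps.
    case: (ltngtP i j) => [ij|ji|->]; [left|right|by left]; exact: ps.
    exact: submx_trans XY (iso Y Ys).
  rewrite sub_orthmx -orthmx_sym //; exact: submx_trans YX (iso X Xs).
rewrite pairwise_rev pairwise_map.
by apply: sub_pairwise ps => X Y /=; apply: orthmxS.
Qed.

(** Step 0 is zero, and the default value of [nth] makes every step past the end of [s] equal to
    [top]. *)
Definition chain_flag m (top : 'M[F]_m) (s : seq 'M[F]_m) (i : nat) :=
  nth top (0 :: s) i.

Lemma chain_flag_filtration m (top : 'M[F]_m) s :
  pairwise submx s -> all (fun X => (X <= top)%MS) s ->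
  filtration (chain_flag top s).
Proof.
move=> ps /allP st [|i]; first exact: sub0mx.
rewrite /chain_flag /=; case: (ltnP i.+1 (size s)) => is1.
  by move/(pairwiseP top): ps; apply; rewrite ?inE // ltnW.
rewrite [X in (_ <= X)%MS]nth_default //; case: (ltnP i (size s)) => si.
  exact/st/mem_nth.
by rewrite nth_default.
Qed.
End Chains.

Lemma sub_orthmx_genmx (F : fieldType) k l m (B : 'M[F]_m) (X : 'M[F]_(l, m))
    (v : 'M[F]_(k, m)) :
  (v <= orthmx B <<X>>)%MS = (v *m B *m X^T == 0).
Proof.
rewrite sub_orthmx -(inj_eq trmx_inj) trmx0 trmx_mul trmxK -[LHS]sub_kermx genmxE.
by rewrite sub_kermx -(inj_eq trmx_inj) trmx0 trmx_mul trmxK.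
Qed.

(** * The triple of flags attached to a configuration *)

Section DirectSum.
Variables (F : fieldType) (m1 m2 : nat) (B1 : 'M[F]_m1) (B2 : 'M[F]_m2).
Hypotheses (sB1 : B1^T = B1) (uB1 : B1 \in unitmx).
Hypotheses (sB2 : B2^T = B2) (uB2 : B2 \in unitmx).
Local Notation m := (m1 + m2)%N.
Local Notation B := (block_mx B1 0 0 B2 : 'M[F]_m).

Lemma block_sym : B^T = B.
Proof. by rewrite tr_block_mx sB1 sB2 !trmx0. Qed.

Lemma block_unit : B \in unitmx.
Proof. by rewrite unitmxE det_ublock unitrM -!unitmxE uB1. Qed.

Definition inj1 : 'M[F]_(m1, m) := row_mx 1%:M 0.
Definition inj2 : 'M[F]_(m2, m) := row_mx 0 1%:M.
Definition prj1 : 'M[F]_(m, m1) := col_mx 1%:M 0.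
Definition prj2 : 'M[F]_(m, m2) := col_mx 0 1%:M.

Lemma inj1K : inj1 *m prj1 = 1%:M.
Proof. by rewrite mul_row_col mulmx1 mulmx0 addr0. Qed.
Lemma inj2K : inj2 *m prj2 = 1%:M.
Proof. by rewrite mul_row_col mulmx1 mulmx0 add0r. Qed.
Lemma inj1_prj2 : inj1 *m prj2 = 0.
Proof. by rewrite mul_row_col mulmx1 mulmx0 addr0. Qed.
Lemma inj2_prj1 : inj2 *m prj1 = 0.
Proof. by rewrite mul_row_col mulmx1 mulmx0 addr0. Qed.

Lemma prj_inj : prj1 *m inj1 + prj2 *m inj2 = 1%:M.
Proof.
rewrite !mul_col_row !mul1mx !mul0mx ?mulmx1 ?mulmx0 add_block_mx !addr0 !add0r.
by rewrite -scalar_mx_block.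
Qed.

Definition sub1 (X : 'M[F]_m1) : 'M[F]_m := <<X *m inj1>>%MS.
Definition sub2 (X : 'M[F]_m2) : 'M[F]_m := <<X *m inj2>>%MS.

Lemma mem_sub1 k (v : 'M[F]_(k, m)) X :
  (v <= sub1 X)%MS = (v *m prj1 <= X)%MS && (v *m prj2 == 0).
Proof.
rewrite genmxE; apply/idP/andP => [/submxP[D ->]|[vX /eqP v2]].
  by rewrite -!mulmxA inj1K inj1_prj2 !mulmx0 mulmx1 submxMl.
by rewrite -[v]mulmx1 -prj_inj mulmxDr !mulmxA v2 mul0mx addr0 submxMr.
Qed.

Lemma mem_sub2 k (v : 'M[F]_(k, m)) X :
  (v <= sub2 X)%MS = (v *m prj1 == 0) && (v *m prj2 <= X)%MS.
Proof.
rewrite genmxE; apply/idP/andP => [/submxP[D ->]|[/eqP v2 vX]].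
  by rewrite -!mulmxA inj2K inj2_prj1 !mulmx0 mulmx1 submxMl.
by rewrite -[v]mulmx1 -prj_inj mulmxDr !mulmxA v2 mul0mx add0r submxMr.
Qed.

Lemma orthmx_sub1 X : (orthmx B (sub1 X) :=: sub1 (orthmx B1 X) + sub2 1%:M)%MS.
Proof.
have E k (v : 'M_(k, m)) : (v <= orthmx B (sub1 X))%MS = (v *m prj1 <= orthmx B1
  X)%MS.
  rewrite sub_orthmx_genmx sub_orthmx trmx_mul tr_row_mx.
  rewrite trmx1 trmx0 -[v]hsubmxK mul_row_block !mulmx0 addr0 add0r.
  by rewrite !mulmxA mul_row_col !mulmx1 mulmx0 addr0 mul_row_col mulmx1 mulmx0
    addr0.
apply/eqmxP/andP; split; last first.
  rewrite addsmx_sub !E !(eqmxMr _ (genmxE _)) -!mulmxA inj1K inj2_prj1 mulmx1.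
  by rewrite mulmx0 sub0mx submx_refl.
apply/rV_subP => v; rewrite E => v1.
rewrite -[v]mulmx1 -prj_inj mulmxDr !mulmxA addmx_sub_adds // genmxE submxMr //.
exact: submx1.
Qed.

Lemma orthmx_sub2 X : (orthmx B (sub2 X) :=: sub1 1%:M + sub2 (orthmx B2 X))%MS.
Proof.
have E k (v : 'M_(k, m)) : (v <= orthmx B (sub2 X))%MS = (v *m prj2 <= orthmx B2
  X)%MS.
  rewrite sub_orthmx_genmx sub_orthmx trmx_mul tr_row_mx.
  rewrite trmx1 trmx0 -[v]hsubmxK mul_row_block !mulmx0 addr0 add0r.
  by rewrite !mulmxA mul_row_col !mulmx1 mulmx0 add0r mul_row_col mulmx1 mulmx0
    add0r.
apply/eqmxP/andP; split; last first.
  rewrite addsmx_sub !E !(eqmxMr _ (genmxE _)) -!mulmxA inj2K inj1_prj2 mulmx1.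
  by rewrite mulmx0 sub0mx submx_refl.
apply/rV_subP => v; rewrite E => v1.
rewrite -[v]mulmx1 -prj_inj mulmxDr !mulmxA addmx_sub_adds // genmxE submxMr //.
exact: submx1.
Qed.

Record config := Config
  { flags1 : seq 'M[F]_m1; flags2 : seq 'M[F]_m2; flags : seq 'M[F]_m }.

Definition isometric (D D' : config) :=
  exists (g1 : 'M_m1) (g2 : 'M_m2),
  [/\ g1 *m B1 *m g1^T = B1, g2 *m B2 *m g2^T = B2,
      forall i, (i < size (flags1 D))%N ->
        (nth 0 (flags1 D) i *m g1 :=: nth 0 (flags1 D') i)%MS,
      forall i, (i < size (flags2 D))%N ->
        (nth 0 (flags2 D) i *m g2 :=: nth 0 (flags2 D') i)%MS
    & forall i, (i < size (flags D))%N ->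
        (nth 0 (flags D) i *m block_mx g1 0 0 g2 :=: nth 0 (flags D') i)%MS].

Definition config_wf (n1 n2 n : nat) (D : config) :=
  [/\ isotropic_chain B1 (flags1 D), isotropic_chain B2 (flags2 D),
      isotropic_chain B (flags D) &
      [/\ size (flags1 D) = n1, size (flags2 D) = n2 & size (flags D) = n]].

(** The third arm is left to the parameters [l] and [E], because each case arranges the isotropic
    subspaces and their orthogonals differently. *)
Definition triad_of (D : config) (l : seq 'M[F]_m) (E : 'M[F]_m) : triad F m :=
  Triad 1%:M (fun k =>
    if k == arm0 then fun i => sub1 (chain_flag 1%:M (saturate B1 (flags1 D)) i)
    else if k == arm1 then fun i => sub2 (chain_flag 1%:M (saturate B2 (flags2 D)) i)
    else chain_flag E l).

(** A saturated chain doubles the number of subspaces, and one more step reaches the summand [V1] or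
    [V2]; the third arm has [n] terms followed by its top. *)
Definition arms (n1 n2 n : nat) (k : 'I_3) : nat :=
  nth 0%N [:: n1.*2.+1; n2.*2.+1; n.+1] k.

Lemma triad_of_wf n1 n2 n D l E : config_wf n1 n2 n D ->
  pairwise submx l -> all (fun X => (X <= E)%MS) l -> triad_wf (triad_of D l E).
Proof.
move=> [c1 c2 _ _] pl lE.
have all1 d (s : seq 'M[F]_d) : all (fun X => (X <= (1%:M : 'M_d))%MS) s.
  by apply/allP => X _; apply: submx1.
have f1 := chain_flag_filtration (pairwise_saturate sB1 c1) (all1 _ _).
have f2 := chain_flag_filtration (pairwise_saturate sB2 c2) (all1 _ _).
split=> [k|k i|k i] /=; last exact: submx1.
  by case: eqP => _; [|case: eqP => _ //]; apply/eqP;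
     rewrite -submx0 genmxE mul0mx sub0mx.
case: eqP => _; [|case: eqP => _]; last exact: chain_flag_filtration.
  by rewrite !genmxE submxMr // f1.
by rewrite !genmxE submxMr // f2.
Qed.

Lemma triad_of_top0 D l E n2 n :
  tflag (triad_of D l E) arm0 (arms (size (flags1 D)) n2 n arm0) = sub1 1%:M.
Proof. by rewrite /= /chain_flag /= nth_default ?size_saturate. Qed.

Lemma triad_of_top1 D l E n1 n :
  tflag (triad_of D l E) arm1 (arms n1 (size (flags2 D)) n arm1) = sub2 1%:M.
Proof. by rewrite /= /chain_flag /= nth_default ?size_saturate. Qed.

Lemma triad_of_disjoint n1 n2 n k D l E : config_wf n1 n2 n D ->
  disjoint01 (arms n1 n2 k) (triad_of D l E).
Proof.
case=> _ _ _ [<- <- _]; rewrite /disjoint01 triad_of_top0 triad_of_top1.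
apply/eqP; rewrite -submx0; apply/rV_subP => v.
rewrite sub_capmx mem_sub1 mem_sub2 => /andP[/andP[_ /eqP v2] /andP[/eqP v1 _]].
by rewrite -[v]mulmx1 -prj_inj mulmxDr !mulmxA v1 v2 !mul0mx addr0 sub0mx.
Qed.
End DirectSum.

Section Isometry.
Variables (C : numClosedFieldType) (m1 m2 : nat) (B1 : 'M[C]_m1) (B2 : 'M[C]_m2).
Hypotheses (sB1 : B1^T = B1) (uB1 : B1 \in unitmx).
Hypotheses (sB2 : B2^T = B2) (uB2 : B2 \in unitmx).
Local Notation m := (m1 + m2)%N.
Local Notation B := (block_mx B1 0 0 B2 : 'M[C]_m).
Local Notation V1 := (@sub1 C m1 m2 1%:M).
Local Notation V2 := (@sub2 C m1 m2 1%:M).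

Lemma orthmx_V1 : (orthmx B V1 :=: V2)%MS.
Proof.
apply: eqmx_trans (orthmx_sub1 _ _ _) _.
have -> : orthmx B1 1%:M = 0 by apply/eqP;
  rewrite -mxrank_eq0 rank_orthmx // mxrank1 subnn.
have -> : sub1 m2 (0 : 'M[C]_m1) = 0.
  by apply/eqP; rewrite -submx0 genmxE mul0mx sub0mx.
by rewrite adds0mx_id; apply: eqmx_refl.
Qed.

Lemma orthmx_V2 : (orthmx B V2 :=: V1)%MS.
Proof.
apply: eqmx_trans (orthmx_sub2 _ _ _) _.
have -> : orthmx B2 1%:M = 0 by apply/eqP;
  rewrite -mxrank_eq0 rank_orthmx // mxrank1 subnn.
have -> : sub2 m1 (0 : 'M[C]_m2) = 0.
  by apply/eqP; rewrite -submx0 genmxE mul0mx sub0mx.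
by rewrite addsmx0_id; apply: eqmx_refl.
Qed.

Lemma block_of_stable (g : 'M[C]_m) : (V1 *m g <= V1)%MS -> (V2 *m g <= V2)%MS ->
  exists (g1 : 'M_m1) (g2 : 'M_m2), g = block_mx g1 0 0 g2.
Proof.
rewrite mem_sub1 mem_sub2 => /andP[_ /eqP g12] /andP[/eqP g21 _].
exists (ulsubmx g), (drsubmx g); rewrite -[LHS]submxK.
have -> : ursubmx g = 0.
  have : inj1 C m1 m2 *m g *m prj2 C m1 m2 = 0.
    by apply: mulmx0_sub g12; rewrite submxMr // genmxE mul1mx.
  by rewrite -{1}[g]submxK mul_row_block mul_row_col !mul1mx !mul0mx !addr0 mulmx0
    add0r mulmx1.
have -> // : dlsubmx g = 0.
have : inj2 C m1 m2 *m g *m prj1 C m1 m2 = 0.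
  by apply: mulmx0_sub g21; rewrite submxMr // genmxE mul1mx.
by rewrite -{1}[g]submxK mul_row_block mul_row_col !mul1mx !mul0mx !add0r mulmx0
  addr0 mulmx1.
Qed.

Lemma sub1_block g1 g2 (X Y : 'M[C]_m1) :
  (sub1 m2 X *m block_mx g1 0 0 g2 :=: sub1 m2 Y)%MS -> (X *m g1 :=: Y)%MS.
Proof.
move=> XY;
  have H : (X *m inj1 C m1 m2 *m block_mx g1 0 0 g2 :=: Y *m inj1 C m1 m2)%MS.
  apply: eqmx_trans (eqmxMr _ (eqmx_sym (genmxE _))) _.
  exact: eqmx_trans XY (genmxE _).
have := eqmxMr (prj1 C m1 m2) H.
rewrite -[Y *m _ *m _]mulmxA inj1K mulmx1 -!mulmxA mul_block_col mul_row_col.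
by rewrite !mulmx1 !mul1mx !mulmx0 !mul0mx !addr0.
Qed.

Lemma sub2_block g1 g2 (X Y : 'M[C]_m2) :
  (sub2 m1 X *m block_mx g1 0 0 g2 :=: sub2 m1 Y)%MS -> (X *m g2 :=: Y)%MS.
Proof.
move=> XY;
  have H : (X *m inj2 C m1 m2 *m block_mx g1 0 0 g2 :=: Y *m inj2 C m1 m2)%MS.
  apply: eqmx_trans (eqmxMr _ (eqmx_sym (genmxE _))) _.
  exact: eqmx_trans XY (genmxE _).
have := eqmxMr (prj2 C m1 m2) H.
rewrite -[Y *m _ *m _]mulmxA inj2K mulmx1 -!mulmxA mul_block_col mul_row_col.
by rewrite !mulmx1 !mul1mx !mulmx0 !mul0mx !add0r.
Qed.

(** The family given to [isometry_of_linear] includes [V1] and [V2], each the orthogonal of the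
    other, so the isometry is block diagonal. The orthogonal of a subspace of [V1] is its orthogonal
    within [V1] plus [V2], and similarly for [V2]; hence the saturated arms control these
    orthogonals. *)
Lemma isometric_of_triad_iso n1 n2 n k (D D' : config C m1 m2) l l' E E' :
    config_wf B1 B2 n1 n2 n D -> config_wf B1 B2 n1 n2 n D' ->
    triad_iso (arms n1 n2 k) (triad_of B1 B2 D l E) (triad_of B1 B2 D' l' E') ->
    (forall h : 'M_m, (forall i, (i <= k.+1)%N ->
        (chain_flag E l i *m h :=: chain_flag E' l' i)%MS) ->
      forall i, (i < n)%N ->
        (nth 0 (flags D) i *m h :=: nth 0 (flags D') i)%MS /\
        (orthmx B (nth 0 (flags D) i) *m h :=: orthmx B (nth 0 (flags D') i))%MS) ->
  isometric B1 B2 D D'.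
Proof.
move=> wf wf' [h hu [_ Wh]] Hh.
have [_ _ _ [z1 z2 z]] := wf; have [_ _ _ [z1' z2' z']] := wf'.
have h1 : (V1 *m h :=: V1)%MS.
  have := Wh arm0 _ (leqnn _).
  by rewrite -{1 2}z1 triad_of_top0 z1 -{1}z1' triad_of_top0.
have h2 : (V2 *m h :=: V2)%MS.
  have := Wh arm1 _ (leqnn _).
  by rewrite -{1 2}z2 triad_of_top1 z2 -{1}z2' triad_of_top1.
have s1h i : (i < n1)%N ->
   (sub1 m2 (nth 0 (flags1 D) i) *m h :=: sub1 m2 (nth 0 (flags1 D') i))%MS /\
   (sub1 m2 (orthmx B1 (nth 0 (flags1 D) i)) *m h :=:
    sub1 m2 (orthmx B1 (nth 0 (flags1 D') i)))%MS.
  move=> i1; split.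
    have := Wh arm0 i.+1; rewrite /= /chain_flag /= !nth_saturate_l ?z1 ?z1' //.
    rewrite !(set_nth_default 0 1%:M) ?z1 ?z1' //; apply; rewrite /arms /=; lia.
  have := @nth_saturate_r _ _ B1 (flags1 D) 1%:M i.
  have := @nth_saturate_r _ _ B1 (flags1 D') 1%:M i.
  rewrite z1 z1' => /(_ i1) E1' /(_ i1) E1.
  have := Wh arm0 (n1.*2.-1 - i).+1; rewrite /= /chain_flag /= E1 E1'.
  rewrite !(set_nth_default 0 1%:M) ?z1 ?z1' //; apply; rewrite /arms /=; lia.
have s2h i : (i < n2)%N ->
   (sub2 m1 (nth 0 (flags2 D) i) *m h :=: sub2 m1 (nth 0 (flags2 D') i))%MS /\
   (sub2 m1 (orthmx B2 (nth 0 (flags2 D) i)) *m h :=: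
    sub2 m1 (orthmx B2 (nth 0 (flags2 D') i)))%MS.
  move=> i1; split.
    have := Wh arm1 i.+1; rewrite /= /chain_flag /= !nth_saturate_l ?z2 ?z2' //.
    rewrite !(set_nth_default 0 1%:M) ?z2 ?z2' //; apply; rewrite /arms /=; lia.
  have := @nth_saturate_r _ _ B2 (flags2 D) 1%:M i.
  have := @nth_saturate_r _ _ B2 (flags2 D') 1%:M i.
  rewrite z2 z2' => /(_ i1) E1' /(_ i1) E1.
  have := Wh arm1 (n2.*2.-1 - i).+1; rewrite /= /chain_flag /= E1 E1'.
  rewrite !(set_nth_default 0 1%:M) ?z2 ?z2' //; apply; rewrite /arms /=; lia.
have sh i : (i < n)%N -> (nth 0 (flags D) i *m h :=: nth 0 (flags D') i)%MS /\
        (orthmx B (nth 0 (flags D) i) *m h :=: orthmx B (nth 0 (flags D') i))%MS.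
  by apply: Hh => j jk; apply: (Wh arm2).
pose X (G : config C m1 m2) (j : bool + ('I_n1 + ('I_n2 + 'I_n))) : 'M[C]_m :=
  match j with
  | inl true => V1
  | inl false => V2
  | inr (inl i) => sub1 m2 (nth 0 (flags1 G) i)
  | inr (inr (inl i)) => sub2 m1 (nth 0 (flags2 G) i)
  | inr (inr (inr i)) => nth 0 (flags G) i
  end.
have [| |g gB Xg] := @isometry_of_linear C m B h _ (X D) (X D')
    (block_sym sB1 sB2) (block_unit uB1 uB2) hu.
- case=> [[]|[i|[i|i]]] //=; first exact: (s1h i (ltn_ord i)).1.
    exact: (s2h i (ltn_ord i)).1.
  exact: (sh i (ltn_ord i)).1.
- case=> [[]|[i|[i|i]]] /=.
  + apply: eqmx_trans (eqmxMr h orthmx_V1) (eqmx_trans h2 (eqmx_sym orthmx_V1)).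
  + apply: eqmx_trans (eqmxMr h orthmx_V2) (eqmx_trans h1 (eqmx_sym orthmx_V2)).
  + apply: eqmx_trans (eqmxMr h (orthmx_sub1 _ _ _)) _.
    apply: eqmx_trans (eqmx_sym (orthmx_sub1 _ _ _)).
    apply: eqmx_trans (addsmxMr _ _ _) (adds_eqmx _ h2).
    exact: (s1h i (ltn_ord i)).2.
  + apply: eqmx_trans (eqmxMr h (orthmx_sub2 _ _ _)) _.
    apply: eqmx_trans (eqmx_sym (orthmx_sub2 _ _ _)).
    apply: eqmx_trans (addsmxMr _ _ _) (adds_eqmx h1 _).
    exact: (s2h i (ltn_ord i)).2.
  exact: (sh i (ltn_ord i)).2.
have [||g1 [g2 Eg]] := block_of_stable (g := g).
- by rewrite (Xg (inl true)).
- by rewrite (Xg (inl false)).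
exists g1, g2; rewrite Eg in gB Xg.
have [gB1 gB2] : g1 *m B1 *m g1^T = B1 /\ g2 *m B2 *m g2^T = B2.
  move: gB; rewrite tr_block_mx !mulmx_block !trmx0 !(mulmx0, mul0mx, addr0, add0r).
  by case/eq_block_mx.
split=> // i.
- rewrite z1 => i1; apply: sub1_block; exact: (Xg (inr (inl (Ordinal i1)))).
- rewrite z2 => i1; apply: sub2_block; exact: (Xg (inr (inr (inl (Ordinal i1))))).
- rewrite z => i1; exact: (Xg (inr (inr (inr (Ordinal i1))))).
Qed.
End Isometry.

(** * Finiteness for configurations of isotropic subspaces *)

Section FiniteConfigs.
Variables (C : numClosedFieldType) (m1 m2 : nat) (B1 : 'M[C]_m1) (B2 : 'M[C]_m2).
Hypotheses (sB1 : B1^T = B1) (uB1 : B1 \in unitmx).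
Hypotheses (sB2 : B2^T = B2) (uB2 : B2 \in unitmx).
Local Notation m := (m1 + m2)%N.
Local Notation B := (block_mx B1 0 0 B2 : 'M[C]_m).

(** The last hypothesis expresses that the third arm determines the isotropic subspaces of the sum
    and their orthogonals. *)
Lemma finite_mod_triad_of n1 n2 n k (P : config C m1 m2 -> Prop)
    (Q : triad C m -> Prop) (l : config C m1 m2 -> seq 'M[C]_m)
    (E : config C m1 m2 -> 'M[C]_m) :
    (forall D, P D -> config_wf B1 B2 n1 n2 n D) ->
    (forall D, P D -> Q (triad_of B1 B2 D (l D) (E D))) ->
    finite_mod Q (@triad_iso C (arms n1 n2 k) m) ->
    (forall D D' (h : 'M_m), P D -> P D' ->
      (forall i, (i <= k.+1)%N ->
        (chain_flag (E D) (l D) i *m h :=: chain_flag (E D') (l D') i)%MS) ->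
      forall i, (i < n)%N ->
        (nth 0 (flags D) i *m h :=: nth 0 (flags D') i)%MS /\
        (orthmx B (nth 0 (flags D) i) *m h :=: orthmx B (nth 0 (flags D') i))%MS) ->
  finite_mod P (isometric B1 B2).
Proof.
move=> Pwf PQ finQ Hh.
apply: (finite_mod_refine (f := fun D => triad_of B1 B2 D (l D) (E D))
  (g := fun _ => tt) finQ PQ) => D D' PD PD' _ iso.
apply: (isometric_of_triad_iso sB1 uB1 sB2 uB2 (Pwf D PD) (Pwf D' PD') iso).
by move=> h; apply: Hh.
Qed.

Definition flag0 (D : config C m1 m2) := nth 0 (flags D) 0.
Definition flag1 (D : config C m1 m2) := nth 0 (flags D) 1.

Lemma flags_1 n1 n2 D : config_wf B1 B2 n1 n2 1 D ->
  (flag0 D <= orthmx B (flag0 D))%MS.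
Proof.
rewrite /flag0; case=> _ _ + [_ _]; case: (flags D) => [|X [|]] //=.
by case/andP=> _ /=; rewrite andbT.
Qed.

Lemma flags_2 n1 n2 D : config_wf B1 B2 n1 n2 2 D ->
  [/\ (flag0 D <= flag1 D)%MS, (flag0 D <= orthmx B (flag0 D))%MS
    & (flag1 D <= orthmx B (flag1 D))%MS].
Proof.
rewrite /flag0 /flag1; case=> _ _ + [_ _]; case: (flags D) => [|X [|Y [|]]] //=.
by rewrite /isotropic_chain /= !andbT => /andP[-> /andP[-> ->]].
Qed.

Lemma finite_mod_config_line n1 n2 :
  finite_mod (fun D => config_wf B1 B2 n1 n2 1 D /\ (\rank (flag0 D) <= 1)%N)
    (isometric B1 B2).
Proof.
apply: (finite_mod_triad_of (n1 := n1) (n2 := n2) (n := 1) (k := 1)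
  (l := fun D => [:: flag0 D]) (E := fun D => orthmx B (flag0 D)) _ _
  (@finite_mod_line_or_lagrangian C (arms n1 n2 1) m erefl)).
- by move=> D [wf _].
- move=> D [wf rL]; split=> //; last exact: triad_of_disjoint wf.
  by apply: (triad_of_wf sB1 sB2 wf) => //=; rewrite (flags_1 wf).
- move=> D D' h _ _ Wh [|//] _.
  by split; [apply: (Wh 1%N) | apply: (Wh 2%N)].
Qed.

(* Here and in the next lemma, a zero subspace stands for the missing line. *)
Lemma finite_mod_config_lagrangian n1 n2 :
  finite_mod (fun D => config_wf B1 B2 n1 n2 1 D /\ (orthmx B (flag0 D) :=: flag0
    D)%MS)
    (isometric B1 B2).
Proof.
apply: (finite_mod_triad_of (n1 := n1) (n2 := n2) (n := 1) (k := 1)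
  (l := fun D => [:: 0]) (E := fun D => flag0 D) _ _
  (@finite_mod_line_or_lagrangian C (arms n1 n2 1) m erefl)).
- by move=> D [wf _].
- move=> D [wf rL]; split; [|exact: triad_of_disjoint wf|by rewrite /= mxrank0].
  by apply: (triad_of_wf sB1 sB2 wf) => //=; rewrite sub0mx.
- move=> D D' h [_ LD] [_ LD'] Wh [|//] _.
  have Uh : (flag0 D *m h :=: flag0 D')%MS by apply: (Wh 2%N).
  split=> //; apply: eqmx_trans (eqmxMr h LD) _.
  exact: eqmx_trans Uh (eqmx_sym LD').
Qed.

Lemma finite_mod_config_isotropic n1 :
  finite_mod (fun D => config_wf B1 B2 n1 0 1 D) (isometric B1 B2).
Proof.
apply: (finite_mod_triad_of (n1 := n1) (n2 := 0) (n := 1) (k := 2)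
  (l := fun D => [:: 0; flag0 D]) (E := fun D => orthmx B (flag0 D)) _ _
  (@finite_mod_line_in_isotropic C (arms n1 0 2) m erefl erefl)) => //.
- move=> D wf; split; [|exact: triad_of_disjoint wf|by rewrite /= mxrank0].
  by apply: (triad_of_wf sB1 sB2 wf) => //=; rewrite ?sub0mx ?(flags_1 wf).
- move=> D D' h _ _ Wh [|//] _.
  by split; [apply: (Wh 2%N) | apply: (Wh 3%N)].
Qed.

(** [flag1] is its own orthogonal, so the chain from [flag0] through [flag1] to the orthogonal of
    [flag0] already contains all orthogonals. *)
Lemma two_step_orth D D' (h : 'M_m) :
    (orthmx B (flag1 D) :=: flag1 D)%MS -> (orthmx B (flag1 D') :=: flag1 D')%MS ->
    (forall i, (i <= 3)%N ->
      (chain_flag (orthmx B (flag0 D)) [:: flag0 D; flag1 D] i *m h :=: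
       chain_flag (orthmx B (flag0 D')) [:: flag0 D'; flag1 D'] i)%MS) ->
    forall i, (i < 2)%N ->
      (nth 0 (flags D) i *m h :=: nth 0 (flags D') i)%MS /\
      (orthmx B (nth 0 (flags D) i) *m h :=: orthmx B (nth 0 (flags D') i))%MS.
Proof.
move=> LD LD' Wh [|[|//]] _.
  by split; [apply: (Wh 1%N) | apply: (Wh 3%N)].
have Uh : (flag1 D *m h :=: flag1 D')%MS by apply: (Wh 2%N).
split=> //; apply: eqmx_trans (eqmxMr h LD) _.
exact: eqmx_trans Uh (eqmx_sym LD').
Qed.

Lemma two_step_wf n1 n2 D : config_wf B1 B2 n1 n2 2 D ->
    (orthmx B (flag1 D) :=: flag1 D)%MS ->
  triad_wf (triad_of B1 B2 D [:: flag0 D; flag1 D] (orthmx B (flag0 D))).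
Proof.
move=> wf LD; have [LU LL _] := flags_2 wf.
apply: (triad_of_wf sB1 sB2 wf) => /=; rewrite !andbT ?LU ?LL //=.
by rewrite -LD orthmxS.
Qed.

Lemma finite_mod_config_line_in_lagrangian n1 :
  finite_mod (fun D => [/\ config_wf B1 B2 n1 0 2 D, (\rank (flag0 D) <= 1)%N
      & (orthmx B (flag1 D) :=: flag1 D)%MS])
    (isometric B1 B2).
Proof.
apply: (finite_mod_triad_of (n1 := n1) (n2 := 0) (n := 2) (k := 2)
  (l := fun D => [:: flag0 D; flag1 D]) (E := fun D => orthmx B (flag0 D)) _ _
  (@finite_mod_line_in_isotropic C (arms n1 0 2) m erefl erefl)) => //.
- by move=> D [wf _ _].
- move=> D [wf rL LD]; split=> //; last exact: triad_of_disjoint wf.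
  exact: two_step_wf wf LD.
- by move=> D D' h [_ _ LD] [_ _ LD']; apply: two_step_orth.
Qed.

Lemma finite_mod_config_isotropic_in_lagrangian :
  finite_mod (fun D => config_wf B1 B2 1 0 2 D /\ (orthmx B (flag1 D) :=: flag1
    D)%MS)
    (isometric B1 B2).
Proof.
apply: (finite_mod_triad_of (n1 := 1) (n2 := 0) (n := 2) (k := 2)
  (l := fun D => [:: flag0 D; flag1 D]) (E := fun D => orthmx B (flag0 D)) _ _
  (@finite_mod_isotropic_in_lagrangian C (arms 1 0 2) m erefl erefl erefl)) => //.
- by move=> D [wf _].
- move=> D [wf LD]; split; last exact: triad_of_disjoint wf.
  exact: two_step_wf wf LD.
- by move=> D D' h [_ LD] [_ LD']; apply: two_step_orth.
Qed.

(** [V2] itself is the line, so the other two arms may be saturated chains of any length. *)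
Lemma finite_mod_config_line_summand n1 n : m2 = 1%N ->
  finite_mod (fun D => config_wf B1 B2 n1 0 n D) (isometric B1 B2).
Proof.
move=> m21.
apply: (finite_mod_triad_of (n1 := n1) (n2 := 0) (n := n) (k := n.*2)
  (l := fun D => saturate B (flags D)) (E := fun D => 1%:M) _ _
  (@finite_mod_two_flags_line C (arms n1 0 n.*2) m erefl)) => //.
- move=> D wf; have [_ _ ch [_ z2 _]] := wf; split.
    apply: (triad_of_wf sB1 sB2 wf).
      exact: pairwise_saturate (block_sym sB1 sB2) ch.
    by apply/allP => X _; apply: submx1.
  rewrite [tflag _ _ _](_ : _ = sub2 m1 1%:M); last first.
    by rewrite /= /chain_flag /= nth_default // size_saturate z2.
  by rewrite genmxE mul1mx (leq_trans (rank_leq_row _)) // m21.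
- move=> D D' h [_ _ _ [_ _ z]] [_ _ _ [_ _ z']] Wh i i_n; split.
    have := Wh i.+1; rewrite /chain_flag /= !nth_saturate_l ?z ?z' //.
    rewrite !(set_nth_default 0 1%:M) ?z ?z' //; apply; lia.
  have := @nth_saturate_r _ _ B (flags D) 1%:M i.
  have := @nth_saturate_r _ _ B (flags D') 1%:M i.
  rewrite z z' => /(_ i_n) E1' /(_ i_n) E1.
  have := Wh (n.*2.-1 - i).+1; rewrite /chain_flag /= E1 E1'.
  rewrite !(set_nth_default 0 1%:M) ?z ?z' //; apply; lia.
Qed.
End FiniteConfigs.

(** * Orbits and cosets *)

Lemma finite_mod_reps (X : Type) (T : finType) (D : X -> Prop) (C : X -> T -> Prop)
  :
  exists rep : T -> option X, forall x t, D x -> C x t ->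
    exists2 y, rep t = Some y & D y /\ C y t.
Proof.
have [|rep repP] := @fin_all_exists T (fun _ => option X) (fun t o =>
  forall x, D x -> C x t -> exists2 y, o = Some y & D y /\ C y t).
  move=> t; have [[x [Dx Cx]]|nex] := pselect (exists x, D x /\ C x t).
    by exists (Some x) => _ _ _; exists x.
  by exists None => x Dx Cx; case: nex; exists x.
by exists rep => x t; apply: repP.
Qed.

(** A representative is fixed for each label, and the index [s] relating it to [x] is added to the
    label of [x]. Elements with equal new labels are reached from one representative by the same
    [s]. *)
Lemma finite_mod_twist (X : Type) (D : X -> Prop) (R R' : X -> X -> Prop)
    (S : finType) (Rs : S -> X -> X -> Prop) :
    finite_mod D R ->
    (forall x y, D x -> D y -> R x y -> exists s, Rs s x y) ->
    (forall s x y z, D x -> D y -> D z -> Rs s x y -> Rs s x z -> R' y z) ->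
  finite_mod D R'.
Proof.
move=> [T [C [Cex CR]]] RRs RsR'; have [rep repP] := finite_mod_reps D C.
exists (T * S)%type, (fun x ts => C x ts.1 /\
  exists2 y, rep ts.1 = Some y & [/\ D y & Rs ts.2 y x]).
split=> [x Dx|x y [t s] Dx Dy /= [_ [z Ez [Dz Rzx]]] [_ [z' Ez' [_ Rzy]]]].
  have [t Ct] := Cex x Dx; have [y Ey [Dy Cy]] := repP x t Dx Ct.
  have [s Rsyx] := RRs _ _ Dy Dx (CR _ _ _ Dy Dx Cy Ct).
  by exists (t, s); split=> //; exists y.
by move: Rzy; rewrite Ez in Ez'; case: Ez' => <-; apply: RsR'.
Qed.

Lemma finite_image_mod (X Y : Type) (y0 : Y) (A : set X) (R : X -> X -> Prop)
    (f : X -> Y) :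
  finite_mod A R -> (forall x y, A x -> A y -> R x y -> f x = f y) ->
  finite_set [set f x | x in A]%classic.
Proof.
move=> [T [C [Cex CR]]] Rf; have [rep repP] := finite_mod_reps A C.
(* [y0] is a filler for labels that no element of [A] carries. *)
pose f' t := if rep t is Some x then f x else y0.
apply: sub_finite_set (finite_image f' (finite_seq (enum T))) => _ [x Ax <-].
have [t Ct] := Cex x Ax; exists t; first by rewrite /= mem_enum.
have [y Ey [Ay Cy]] := repP x t Ax Ct.
by rewrite /f' Ey; apply: Rf => //; apply: CR Cy Ct.
Qed.

Section Cosets.
Local Open Scope classical_set_scope.
Variables (F : fieldType) (m : nat).
Implicit Types (B U g h : 'M[F]_m).

Lemma translateM g h (A : set 'M[F]_m) :
  translate g (translate h A) = translate (g *m h) A.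
Proof.
rewrite /translate image_comp; apply: eq_imagel => a _ /=.
by rewrite mulmxA.
Qed.

Lemma SO_unit B g : SO B g -> g \in unitmx.
Proof. by case=> _ dg; rewrite unitmxE dg unitr1. Qed.

Lemma SO_mul B g h : SO B g -> SO B h -> SO B (g *m h).
Proof.
move=> [gB dg] [hB dh]; split; last by rewrite det_mulmx dg dh mulr1.
by rewrite trmx_mul -!mulmxA (mulmxA B) (mulmxA g^T) (mulmxA g^T) gB mulmxA.
Qed.

Lemma SO_inv B g : SO B g -> SO B (invmx g).
Proof.
move=> Bg; have gu := SO_unit Bg; have [gB dg] := Bg.
split; last by rewrite det_inv dg invr1.
by rewrite -{1}gB trmx_inv !mulmxA mulVmx ?unitmx_tr // mul1mx mulmxK.
Qed.

Lemma coset_eq B r (S : {set 'I_r}) (E : 'I_r -> 'M[F]_m) g h :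
    SO B g -> SO B h ->
    (forall k, k \in S -> (E k *m g^T :=: E k *m h^T)%MS) ->
  translate g (stabilizer B S E) = translate h (stabilizer B S E).
Proof.
suff sub g' h' : SO B g' -> SO B h' ->
    (forall k, k \in S -> (E k *m g'^T :=: E k *m h'^T)%MS) ->
    translate g' (stabilizer B S E) `<=` translate h' (stabilizer B S E).
  move=> Bg Bh Egh; apply/seteqP; split; apply: sub => // k kS.
  exact: eqmx_sym (Egh k kS).
move=> Bg Bh Egh _ [q [Bq Eq] <-]; exists (invmx h' *m (g' *m q)); last first.
  by rewrite mulmxA mulmxV ?mul1mx // (SO_unit Bh).
split=> [|k kS]; first exact: SO_mul (SO_inv Bh) (SO_mul Bg Bq).
apply/eqmxP; rewrite !trmx_mul !mulmxA.
apply: eqmx_trans (eqmxMr _ (eqmxMr _ (eqmxP (Eq k kS)))) _.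
apply: eqmx_trans (eqmxMr _ (Egh k kS)) _.
by rewrite trmx_inv mulmxK ?unitmx_tr ?(SO_unit Bh).
Qed.
End Cosets.

Section Orbits.
Local Open Scope classical_set_scope.
Variables (F : fieldType) (m1 m2 : nat) (B1 : 'M[F]_m1) (B2 : 'M[F]_m2).
Local Notation m := (m1 + m2)%N.
Local Notation B := (orthogonal_sum B1 B2).

Lemma SO_block g1 g2 : SO B1 g1 -> SO B2 g2 -> SO B (block_mx g1 0 0 g2).
Proof.
move=> [gB1 d1] [gB2 d2]; split; last by rewrite det_ublock d1 d2 mulr1.
rewrite tr_block_mx !trmx0 /orthogonal_sum !mulmx_block.
by rewrite !(mulmx0, mul0mx, addr0, add0r) gB1 gB2.
Qed.

Lemma K_orbit_act k x : K_group B1 B2 k -> K_orbit B1 B2 (K_act k x) = K_orbit B1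
  B2 x.
Proof.
have act k' l y : K_act k' (K_act l y) = K_act (k'.1 *m l.1, k'.2 *m l.2) y.
  rewrite /K_act /= !translateM; congr (_, translate _ _).
  by rewrite mulmx_block !(mulmx0, mul0mx, addr0, add0r).
move=> [arm1 arm2]; apply/seteqP; split=> _ [l [l1 l2] <-].
  exists (l.1 *m k.1, l.2 *m k.2); last by rewrite act.
  by split; apply: SO_mul.
exists (l.1 *m invmx k.1, l.2 *m invmx k.2).
  by split; apply: SO_mul => //; apply: SO_inv.
by rewrite act /= !mulmxKV ?(SO_unit arm1) ?(SO_unit arm2) //; case: l {l1 l2}.
Qed.
End Orbits.

Section Isometries.
Variables (F : fieldType) (m : nat) (B : 'M[F]_m).
Hypothesis uB : B \in unitmx.

Lemma isometry_unit g : g *m B *m g^T = B -> g \in unitmx.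
Proof. by move=> gB; move: uB; rewrite -gB !unitmx_mul => /andP[/andP[]]. Qed.

Lemma isometry_inv g : g *m B *m g^T = B -> invmx g *m B *m (invmx g)^T = B.
Proof.
move=> gB; have gu := isometry_unit gB; rewrite -{1}gB trmx_inv !mulmxA.
by rewrite mulVmx // mul1mx -mulmxA mulmxV ?unitmx_tr // mulmx1.
Qed.

Lemma isometry_mul g h : g *m B *m g^T = B -> h *m B *m h^T = B ->
  (g *m h) *m B *m (g *m h)^T = B.
Proof. by move=> gB hB;
  rewrite trmx_mul -!mulmxA (mulmxA B) (mulmxA h) (mulmxA h) hB mulmxA. Qed.

Lemma isometry_det g : g *m B *m g^T = B -> \det g ^+ 2 = 1.
Proof.
move=> gB; have := congr1 (@determinant F m) gB; rewrite !det_mulmx det_tr.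
rewrite mulrAC -expr2 => E; apply: (@mulIf _ (\det B)); last by rewrite mul1r.
by move: uB; rewrite unitmxE unitfE.
Qed.
End Isometries.

(** * From isometries to [K]-orbits *)

Section Relations.
Variables (F : fieldType) (m1 m2 : nat) (B1 : 'M[F]_m1) (B2 : 'M[F]_m2).
Hypotheses (uB1 : B1 \in unitmx) (uB2 : B2 \in unitmx).
Hypotheses (odd_m1 : odd m1) (odd_m2 : odd m2).
Local Notation m := (m1 + m2)%N.
Local Notation B := (orthogonal_sum B1 B2).
Variables (r1 r2 r : nat) (T1 : {set 'I_r1}) (T2 : {set 'I_r2}) (S : {set 'I_r}).
Variables (E1 : 'I_r1 -> 'M[F]_m1) (E2 : 'I_r2 -> 'M[F]_m2) (E : 'I_r -> 'M[F]_m).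
Local Notation X := ('M[F]_m1 * 'M[F]_m2 * 'M[F]_m)%type.
Implicit Types x y z : X.

Definition in_groups x := [/\ SO B1 x.1.1, SO B2 x.1.2 & SO B x.2].

Definition flag_point x :=
  ((translate x.1.1 (stabilizer B1 T1 E1), translate x.1.2 (stabilizer B2 T2 E2)),
   translate x.2 (stabilizer B S E)).

(* The sign records the component of O(V1) x O(V2) modulo K and the centre of
   O(V); the permutation allows the two Lagrangians of a system to be swapped. *)
Definition twisted_equiv (s : bool * {perm 'I_r}) x y :=
  exists (g1 : 'M_m1) (g2 : 'M_m2),
  [/\ g1 *m B1 *m g1^T = B1 /\ g2 *m B2 *m g2^T = B2,
      \det g1 * \det g2 = (-1) ^+ s.1,
      forall k, k \in T1 -> (E1 k *m x.1.1^T *m g1 :=: E1 k *m y.1.1^T)%MS,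
      forall k, k \in T2 -> (E2 k *m x.1.2^T *m g2 :=: E2 k *m y.1.2^T)%MS
    & (forall k, (s.2 k \in S) = (k \in S)) /\
      forall k, k \in S ->
       (E k *m x.2^T *m block_mx g1 0 0 g2 :=: E (s.2 k) *m y.2^T)%MS].

(** Going back along one relation and forth along the other cancels the common sign and
    permutation. *)
Lemma twisted_equiv_comp s x y z :
  twisted_equiv s x y -> twisted_equiv s x z -> twisted_equiv (false, 1%g) y z.
Proof.
move=> [g1 [g2 [[i1 i2] dg e1 e2 [sS e]]]] [h1 [h2 [[j1 j2] dh f1 f2 [_ f]]]].
have u1 := isometry_unit uB1 i1; have u2 := isometry_unit uB2 i2.
pose G := block_mx g1 0 0 g2; pose G' := block_mx (invmx g1) 0 0 (invmx g2).
have GG' : G *m G' = 1%:M.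
  rewrite mulmx_block !(mulmx0, mul0mx, addr0, add0r) !mulmxV //.
  by rewrite -scalar_mx_block.
exists (invmx g1 *m h1), (invmx g2 *m h2); split.
- by split; apply: isometry_mul => //; apply: isometry_inv.
- rewrite !det_mulmx !det_inv mulrACA -invrM ?unitfE; last 2 first.
  + by move: u2; rewrite unitmxE unitfE.
  + by move: u1; rewrite unitmxE unitfE.
  by rewrite [X in X^-1]mulrC dg dh /= expr0 mulVf // signr_eq0.
- move=> k kT; rewrite mulmxA; apply: eqmx_trans _ (f1 k kT); apply: eqmxMr.
  apply: eqmx_trans (eqmxMr _ (eqmx_sym (e1 k kT))) _.
  by rewrite mulmxK.
- move=> k kT; rewrite mulmxA; apply: eqmx_trans _ (f2 k kT); apply: eqmxMr.
  apply: eqmx_trans (eqmxMr _ (eqmx_sym (e2 k kT))) _.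
  by rewrite mulmxK.
split=> [k|k]; rewrite perm1 // => kS.
have [j Dk] : exists j, s.2 j = k by exists ((s.2)^-1 k)%g; rewrite permKV.
have jS : j \in S by rewrite -sS Dk.
have -> : block_mx (invmx g1 *m h1) 0 0 (invmx g2 *m h2) = G' *m block_mx h1 0 0 h2.
  by rewrite mulmx_block !(mulmx0, mul0mx, addr0, add0r).
rewrite mulmxA -Dk; apply: eqmx_trans _ (f j jS); apply: eqmxMr.
apply: eqmx_trans (eqmxMr _ (eqmx_sym (e j jS))) _.
by rewrite -mulmxA GG' mulmx1.
Qed.

(** Both determinants are the same sign [c]. As [m1] and [m2] are odd, multiplying both isometries
    by [c] brings them into [SO] without moving a subspace. Transposes occur because group elements
    act on rows through them. *)
Lemma twisted_equiv_orbit x y : in_groups x -> in_groups y ->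
  twisted_equiv (false, 1%g) x y ->
  K_orbit B1 B2 (flag_point x) = K_orbit B1 B2 (flag_point y).
Proof.
move=> [x1 x2 x3] [y1 y2 y3] [g1 [g2 [[i1 i2] dg e1 e2 [_ e]]]].
have d1 := isometry_det uB1 i1; have d2 := isometry_det uB2 i2.
pose c := \det g1; have c0 : c != 0.
  by apply/eqP => c0; move/eqP: d1; rewrite -/c c0 expr0n /= eq_sym oner_eq0.
have cg2 : \det g2 = c.
  by apply: (mulfI c0); rewrite dg expr0 -expr2 d1.
have cc : c * c = 1 by rewrite -expr2.
have trZ d d' (g : 'M[F]_(d, d')) : (c *: g^T)^T = c *: g
  by rewrite linearZ /= trmxK.
have c_odd d : odd d -> c ^+ d * c = 1.
  by move=> od;
    rewrite -exprSr -[d.+1]odd_double_half /= od add0n -mul2n exprM d1 expr1n.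
have SOk d (b g : 'M[F]_d) : odd d -> g *m b *m g^T = b -> \det g = c -> SO b (c *:
  g^T).
  move=> od gb dgc; split; last by rewrite detZ det_tr dgc c_odd.
  rewrite trZ -!scalemxAl -scalemxAr scalerA cc scale1r.
  by rewrite gb.
have K1 : SO B1 (c *: g1^T) by apply: SOk.
have K2 : SO B2 (c *: g2^T) by apply: SOk.
rewrite -(@K_orbit_act _ _ _ B1 B2 (c *: g1^T, c *: g2^T)); last by split.
congr (K_orbit _ _ _); rewrite /K_act /flag_point /= !translateM.
congr ((_, _), _); apply: coset_eq => //; try exact: SO_mul.
- move=> k kT; rewrite trmx_mul trZ -!scalemxAr mulmxA.
  exact: eqmx_trans (eqmx_scale _ c0) (e1 k kT).
- move=> k kT; rewrite trmx_mul trZ -!scalemxAr mulmxA.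
  exact: eqmx_trans (eqmx_scale _ c0) (e2 k kT).
- exact: SO_mul (SO_block K1 K2) x3.
move=> k kS;
  have -> : block_mx (c *: g1^T) 0 0 (c *: g2^T) = c *: (block_mx g1 0 0 g2)^T.
  by rewrite tr_block_mx !trmx0 scale_block_mx !scaler0.
rewrite trmx_mul trZ -!scalemxAr mulmxA.
by apply: eqmx_trans (eqmx_scale _ c0) _; have := e k kS; rewrite perm1.
Qed.

Lemma finitely_many_of_twisted (R : X -> X -> Prop) :
    finite_mod in_groups R ->
    (forall x y, in_groups x -> in_groups y -> R x y -> exists s, twisted_equiv s x
      y) ->
  finitely_many_K_orbits B1 B2 (stabilizer B1 T1 E1) (stabilizer B2 T2 E2)
    (stabilizer B S E).
Proof.
move=> fin RT.
have fin' := finite_mod_twist fin RT (R' := twisted_equiv (false, 1%g))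
  (fun s x y z _ _ _ => @twisted_equiv_comp s x y z).
have := finite_image_mod set0 (A := [set x | in_groups x])
  (f := fun x => K_orbit B1 B2 (flag_point x)) fin' twisted_equiv_orbit.
apply: sub_finite_set => _ [[[a b] c] [[/= [a' Ha <-] [b' Hb <-]] [c' Hc <-]] <-].
by exists ((a', b'), c').
Qed.
End Relations.

(** * Systems of isotropic subspaces *)

Section Lagrangians.
Variables (C : numFieldType) (m n : nat) (B : 'M[C]_m).
Hypotheses (mn : m = n.*2) (sB : B^T = B) (uB : B \in unitmx).

Lemma lagrangian_orth (U : 'M[C]_m) : (U <= orthmx B U)%MS -> \rank U = n ->
  (orthmx B U :=: U)%MS.
Proof.
move=> UU rU; apply/eqmx_sym/eqmxP; rewrite -(mxrank_leqif_eq UU) rank_orthmx //.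
by rewrite rU mn -addnn addnK.
Qed.

Lemma capmx_unit (U V g : 'M[C]_m) : g \in unitmx ->
  ((U :&: V)%MS *m g :=: U *m g :&: V *m g)%MS.
Proof.
move=> gu; apply/eqmxP/andP; split.
  by rewrite sub_capmx !submxMr ?capmxSl ?capmxSr.
set X := (U *m g :&: V *m g)%MS.
have XU : (X *m invmx g <= U)%MS by rewrite -[U](mulmxK gu) submxMr // capmxSl.
have XV : (X *m invmx g <= V)%MS by rewrite -[V](mulmxK gu) submxMr // capmxSr.
by rewrite -[X](mulmxKV gu) submxMr // sub_capmx XU.
Qed.

Lemma eqmx_of_hyperplane (U V W : 'M[C]_m) (w : 'rV_m) :
    (U <= V)%MS -> (U <= W)%MS -> \rank W = (\rank U).+1 -> \rank V = (\rank U).+1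
      ->
    (w <= W)%MS -> (w <= V)%MS -> ~~ (w <= U)%MS ->
  (W :=: V)%MS.
Proof.
move=> UV UW rW rV wW wV wU.
have rUw : (\rank U < \rank (U + w)%MS)%N.
  by rewrite ltn_neqAle mxrankS ?addsmxSl // andbT (mxrank_leqif_sup (addsmxSl U
    w)) addsmx_sub submx_refl.
have EW : (U + w :=: W)%MS.
  apply/eqmxP; have s : (U + w <= W)%MS by rewrite addsmx_sub UW.
  by rewrite -(mxrank_leqif_eq s) eqn_leq mxrankS //= rW.
have EV : (U + w :=: V)%MS.
  apply/eqmxP; have s : (U + w <= V)%MS by rewrite addsmx_sub UV.
  by rewrite -(mxrank_leqif_eq s) eqn_leq mxrankS //= rV.
exact: eqmx_trans (eqmx_sym EW) EV.
Qed.

(* The quadric of a nondegenerate plane has exactly two points. *)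
Lemma lagrangian_over_cap (U1 U2 W : 'M[C]_m) :
    (U1 <= orthmx B U1)%MS -> (U2 <= orthmx B U2)%MS -> (W <= orthmx B W)%MS ->
    \rank U1 = n -> \rank U2 = n -> \rank W = n -> (0 < n)%N ->
    \rank (U1 :&: U2)%MS = n.-1 -> (U1 :&: U2 <= W)%MS ->
  (W :=: U1)%MS \/ (W :=: U2)%MS.
Proof.
move=> i1 i2 iW r1 r2 rW n0 rU UW; set U := (U1 :&: U2)%MS in rU UW *.
have UU1 : (U <= U1)%MS by apply: capmxSl.
have UU2 : (U <= U2)%MS by apply: capmxSr.
have rUS (V : 'M[C]_m) : \rank V = n -> \rank V = (\rank U).+1 by move=> ->;
  rewrite rU prednK.
(* By dimension, the orthogonal of [U] is [U1 + U2], and it contains [W]. *)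
have W12 : (W <= U1 + U2)%MS.
  have E : (orthmx B U :=: U1 + U2)%MS.
    apply/eqmx_sym/eqmxP; have s : (U1 + U2 <= orthmx B U)%MS.
      rewrite addsmx_sub (submx_trans i1 (orthmxS B UU1)).
      exact: submx_trans i2 (orthmxS B UU2).
    rewrite -(mxrank_leqif_eq s) rank_orthmx // rU.
    have := mxrank_sum_cap U1 U2; rewrite -/U rU r1 r2; move: mn n0; lia.
  by rewrite -E (submx_trans iW) // orthmxS.
have [w wW wU] : exists2 w : 'rV_m, (w <= W)%MS & ~~ (w <= U)%MS.
  have /row_subPn[i iU] : ~~ (W <= U)%MS.
    by apply/negP => /mxrankS; rewrite rW rU; lia.
  by exists (row i W); rewrite ?row_sub.
have /sub_addsmxP[[a b] /= Ew] := submx_trans wW W12.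
have [aU|aU] := boolP (a *m U1 <= U)%MS.
  right; apply: (@eqmx_of_hyperplane U U2 W w) => //; [exact: rUS | exact: rUS |].
  by rewrite Ew addmx_sub ?submxMl // (submx_trans aU).
have [bU|bU] := boolP (b *m U2 <= U)%MS.
  left; apply: (@eqmx_of_hyperplane U U1 W w) => //; [exact: rUS | exact: rUS |].
  by rewrite Ew addmx_sub ?submxMl // (submx_trans bU).
have form0 k l (V : 'M_m) (X : 'M_(k, m)) (Y : 'M_(l, m)) : (V <= orthmx B V)%MS ->
    (X <= V)%MS -> (Y <= V)%MS -> X *m B *m Y^T = 0.
  move=> iV /submxP[D ->] /submxP[D' ->].
  move: iV; rewrite sub_orthmx => /eqP iV.
  by rewrite trmx_mul -!mulmxA (mulmxA B) (mulmxA V) (mulmxA V) iV mul0mx mulmx0.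
have [x xU1 xE] : exists2 x : 'rV_m, (x <= U1)%MS & x = a *m U1
  by exists (a *m U1); rewrite ?submxMl.
have [y yU2 yE] : exists2 y : 'rV_m, (y <= U2)%MS & y = b *m U2
  by exists (b *m U2); rewrite ?submxMl.
rewrite -xE -yE in Ew aU bU.
have xx : x *m B *m x^T = 0 by apply: (form0 _ _ _ _ _ i1).
have yy : y *m B *m y^T = 0 by apply: (form0 _ _ _ _ _ i2).
have yx : y *m B *m x^T = x *m B *m y^T.
  have t1 (A : 'M[C]_1) : A^T = A by apply/matrixP => i j; rewrite !mxE !ord1.
  by rewrite -[LHS]t1 !trmx_mul trmxK sB mulmxA.
(* [x], [y] and [w = x + y] are isotropic, so twice the product of [x] and [y] vanishes; the
   characteristic is 0. *)
have xy : x *m B *m y^T = 0.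
  have := form0 _ _ _ _ _ iW wW wW; rewrite Ew linearD /=.
  rewrite !mulmxDl !mulmxDr xx yy yx add0r addr0 -mulr2n -scaler_nat => /eqP.
  by rewrite scaler_eq0 pnatr_eq0 /= => /eqP.
have E1 : (U + x :=: U1)%MS.
  have s : (U + x <= U1)%MS by rewrite addsmx_sub UU1.
  apply/eqmxP; rewrite -(mxrank_leqif_eq s) eqn_leq mxrankS //= (rUS _ r1).
  by rewrite ltn_neqAle mxrankS ?addsmxSl // andbT (mxrank_leqif_sup (addsmxSl U
    x)) addsmx_sub submx_refl.
have E2 : (U + y :=: U2)%MS.
  have s : (U + y <= U2)%MS by rewrite addsmx_sub UU2.
  apply/eqmxP; rewrite -(mxrank_leqif_eq s) eqn_leq mxrankS //= (rUS _ r2).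
  by rewrite ltn_neqAle mxrankS ?addsmxSl // andbT (mxrank_leqif_sup (addsmxSl U
    y)) addsmx_sub submx_refl.
(* Over [U], the vectors [x] and [y] span [U1] and [U2]. Being orthogonal, they place [U2] in the
   orthogonal of [U1], which is [U1]; this contradicts the rank of [U]. *)
have U21 : (U2 <= U1)%MS.
  rewrite -(lagrangian_orth i1 r1) -E2 addsmx_sub (submx_trans UU1 i1) /=.
  have : (U1 <= kermx (B *m y^T))%MS.
    by rewrite -E1 addsmx_sub !sub_kermx !mulmxA xy (form0 _ _ _ _ _ i2 UU2 yU2)
      !eqxx.
  by rewrite orthmx_sym // sub_kermx mulmxA.
have rUn : \rank U = n by rewrite (capmx_idPr U21).
by move: rU n0; rewrite rUn; case: (n) => //= n' /eqP;
  rewrite -[_ == _]negbK neq_ltn ltnSn orbT.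
Qed.
End Lagrangians.

(** * Simple roots, and systems up to a swap of Lagrangians *)

Section Roots.
Variables (n : nat) (S : {set 'I_n}).

(** The ordinal [k] is the root of index [k.+1], so the condition is index at most [n - 2]: the
    subspace is not of Lagrangian type. *)
Definition small_root (k : 'I_n) := (k.+3 <= n)%N.

Definition small_roots := [seq k <- enum S | small_root k].
Definition large_roots := [seq k <- enum S | ~~ small_root k].

Lemma sorted_enum (A : {set 'I_n}) : sorted (relpre val ltn) (enum A).
Proof.
rewrite /enum_mem; apply: sorted_filter => [x y z|]; first exact: ltn_trans.
by rewrite -enumT -sorted_map val_enum_ord iota_ltn_sorted.
Qed.

Lemma sorted_roots (P : pred 'I_n) :
  sorted (relpre val ltn) [seq k <- enum S | P k].
Proof. by apply: sorted_filter (sorted_enum S) => x y z; apply: ltn_trans. Qed.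

Lemma roots_eq (P : pred 'I_n) l : sorted (relpre val ltn) l ->
  (forall k, (k \in l) = (k \in S) && P k) -> [seq k <- enum S | P k] = l.
Proof.
move=> sl lE; apply: (irr_sorted_eq (leT := relpre val ltn)) => //.
- by move=> x y z; apply: ltn_trans.
- by move=> x /=; apply: ltnn.
- exact: sorted_roots.
by move=> k; rewrite lE mem_filter mem_enum andbC.
Qed.

(** Only the ordinals [n - 2] and [n - 1] can be large, so two entries exhaust the list. *)
Lemma large_rootsP : match large_roots with
  | [::] => forall k, k \in S -> small_root k
  | [:: u] => [/\ u \in S, ~~ small_root u & forall k, k \in S -> ~~ small_root k
    -> k = u]
  | u :: v :: _ => [/\ u \in S, v \in S, (u < v)%N, ~~ small_root u & ~~ small_root
    v /\
       forall k, k \in S -> ~~ small_root k -> k = u \/ k = v]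
  end.
Proof.
have mem k : (k \in large_roots) = (k \in S) && ~~ small_root k.
  by rewrite mem_filter mem_enum andbC.
have := sorted_roots (fun k => ~~ small_root k); rewrite -/large_roots.
case: large_roots mem => [|u [|v l]] mem.
- by move=> _ k kS; apply/negPn/negP => sk; have := mem k; rewrite kS sk.
- move=> _; have := mem u; rewrite inE eqxx => /esym/andP[uS su];
    split=> // k kS sk.
  by have := mem k; rewrite kS sk inE => /eqP.
move=> /= /andP[uv _].
have := mem u; rewrite inE eqxx => /esym/andP[uS su].
have := mem v; rewrite !inE eqxx orbT => /esym/andP[vS sv].
split=> //; split=> // k kS sk.
have := ltn_ord v; have := ltn_ord k; move: su sk;
  rewrite /small_root => su sk kn vn.
have [->|ku] := eqVneq k u; first by left.
right; apply: val_inj; move: ku; rewrite -val_eqE /=; lia.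
Qed.

End Roots.

Section Systems.
Variables (C : numFieldType) (m n : nat) (B L0 : 'M[C]_m).
Variables (S : {set 'I_n}) (E : 'I_n -> 'M[C]_m).
Hypothesis sysE : system_D B L0 S E.

Lemma system_isotropic k : k \in S -> (E k <= orthmx B (E k))%MS.
Proof.
move=> kS; have := sysE.1 k kS; rewrite /has_type_D sub_orthmx.
by case: ifP => _; [case=> -> | case=> -[-> _]].
Qed.

Lemma system_small k : k \in S -> small_root k -> \rank (E k) = k.+1.
Proof. by move=> kS; rewrite /small_root => sk; have := sysE.1 k kS;
  rewrite /has_type_D sk; case. Qed.

Lemma system_lagrangian k : k \in S -> ~~ small_root k -> \rank (E k) = n.
Proof.
by move=> kS; rewrite /small_root => /negPf sk; have := sysE.1 k kS;
  rewrite /has_type_D sk; case=> -[].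
Qed.

Lemma system_incident k l : k \in S -> l \in S -> (k < l)%N -> small_root k ->
  (E k <= E l)%MS.
Proof. by move=> kS lS kl; rewrite /small_root => sk; have := sysE.2 k l kS lS kl;
  rewrite /incident_D sk. Qed.

Lemma system_cap k l : k \in S -> l \in S -> (k < l)%N -> ~~ small_root k ->
  \rank (E k :&: E l)%MS = n.-1.
Proof.
by move=> kS lS kl; rewrite /small_root => /negPf sk; have := sysE.2 k l kS lS kl;
  rewrite /incident_D sk.
Qed.

(* Two Lagrangians of a system are replaced by their intersection, which
   determines the pair up to order. *)
Definition base_flags : seq 'M[C]_m :=
  [seq E k | k <- small_roots S] ++
  match large_roots S with
  | [::] => [::]
  | [:: u] => [:: E u]
  | u :: v :: _ => [:: (E u :&: E v)%MS]
  end.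

Lemma base_flags_chain : isotropic_chain B base_flags.
Proof.
have sS k : k \in small_roots S -> k \in S /\ small_root k.
  by rewrite mem_filter mem_enum => /andP[].
have psm : pairwise submx [seq E k | k <- small_roots S].
  rewrite pairwise_map.
  have := sorted_roots S (@small_root n); rewrite sorted_pairwise => [|x y z];
    last exact: ltn_trans.
  apply: sub_in_pairwise (fun k => k \in small_roots S) _ _ _ _ _ => [k l /sS[kS
    sk] /sS[lS _] /= kl|].
    exact: system_incident.
  exact/allP.
have ism : all (fun X => (X <= orthmx B X)%MS) [seq E k | k <- small_roots S].
  by apply/allP => _ /mapP[k /sS[kS _] ->]; apply: system_isotropic.
have sl k u : k \in small_roots S -> u \in S -> ~~ small_root u -> (E k <= E u)%MS.
  move=> /sS[kS sk] uS su; apply: system_incident => //.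
  move: sk su; rewrite /small_root; lia.
rewrite /isotropic_chain /base_flags pairwise_cat all_cat psm ism /=.
have := large_rootsP S; case: (large_roots S) => [|u [|v l]].
- by move=> _; rewrite allrel0r.
- move=> [uS su _]; rewrite /= system_isotropic //= !andbT.
  by apply/allrelP => _ X /mapP[k kl ->]; rewrite inE => /eqP->; apply: sl.
move=> [uS vS uv su [sv _]]; rewrite /= !andbT; apply/andP; split.
  apply/allrelP => _ X /mapP[k kl ->]; rewrite inE => /eqP->.
  by rewrite sub_capmx !sl.
apply: submx_trans (capmxSl _ _) (submx_trans (system_isotropic uS) _).
by rewrite orthmxS ?capmxSl.
Qed.
End Systems.

Section Transport.
Variables (F : fieldType) (m : nat).
Implicit Types (B g h : 'M[F]_m) (s : seq 'M[F]_m).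

Definition translate_flags g s := [seq X *m g | X <- s].

Lemma isotropic_chain_translate B g s : B \in unitmx -> g *m B *m g^T = B ->
  isotropic_chain B s -> isotropic_chain B (translate_flags g s).
Proof.
move=> uB gB /andP[ps iso]; apply/andP; split.
  by rewrite pairwise_map; apply: sub_pairwise ps => X Y /= XY; apply: submxMr.
rewrite all_map; apply: sub_all iso => X /= XX.
by rewrite -(orthmx_isometry X gB (isometry_unit uB gB)) submxMr.
Qed.

Lemma translate_flags_nth g g' h s :
    (forall i, (i < size (translate_flags g s))%N ->
      (nth 0 (translate_flags g s) i *m h :=: nth 0 (translate_flags g' s) i)%MS) ->
  forall X, X \in s -> (X *m g *m h :=: X *m g')%MS.
Proof.
move=> H X /(nthP 0)[i si <-]; have := H i; rewrite size_map !(nth_map 0) //.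
exact.
Qed.
End Transport.

Section TransportSystem.
Variables (C : numFieldType) (m n : nat) (B L0 : 'M[C]_m).
Hypotheses (mn : m = n.*2) (sB : B^T = B) (uB : B \in unitmx).
Variables (S : {set 'I_n}) (E : 'I_n -> 'M[C]_m).
Hypothesis sysE : system_D B L0 S E.

(** Of a pair of Lagrangians only the intersection is known to be matched. By [lagrangian_over_cap]
    the two Lagrangians are the only ones above it, so the pair is matched up to a swap, recorded in
    [w]. *)
Lemma system_transport c c' g :
    c *m B *m c^T = B -> c' *m B *m c'^T = B -> g *m B *m g^T = B ->
    (forall X, X \in base_flags S E -> (X *m c *m g :=: X *m c')%MS) ->
  exists w : {perm 'I_n}, (forall k, (w k \in S) = (k \in S)) /\
    forall k, k \in S -> (E k *m c *m g :=: E (w k) *m c')%MS.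
Proof.
move=> cB cB' gB Xg.
have small k : k \in S -> small_root k -> (E k *m c *m g :=: E k *m c')%MS.
  move=> kS sk; apply: Xg; rewrite mem_cat; apply/orP; left.
  by apply: map_f; rewrite mem_filter sk mem_enum.
have [cu cu' gu] := And3 (isometry_unit uB cB) (isometry_unit uB cB')
  (isometry_unit uB gB).
have := large_rootsP S; move: Xg; rewrite /base_flags.
case: (large_roots S) => [|u [|v l]] Xg.
- by move=> allS; exists 1%g; split=> k; rewrite perm1 // => kS; apply/small/allS.
- move=> [uS su lu]; exists 1%g; split=> k; rewrite perm1 // => kS.
  have [sk|sk] := boolP (small_root k); first exact: small.
  by rewrite (lu k kS sk); apply: Xg; rewrite mem_cat mem_head orbT.
move=> [uS vS uv su [sv luv]].
have n0 : (0 < n)%N by apply: leq_ltn_trans (ltn_ord u).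
pose G := c *m g; have Gu : G \in unitmx by rewrite unitmx_mul cu.
have GB : G *m B *m G^T = B by apply: isometry_mul.
have iso h k : h *m B *m h^T = B -> k \in S -> (E k *m h <= orthmx B (E k *m h))%MS.
  move=> hB kS; rewrite -(orthmx_isometry _ hB (isometry_unit uB hB)) submxMr //.
  exact: system_isotropic sysE _ kS.
have rk h k : h \in unitmx -> k \in S -> ~~ small_root k -> \rank (E k *m h) = n.
  move=> hu kS sk; rewrite mxrankMfree ?row_free_unit //.
  exact: system_lagrangian sysE _ kS sk.
have cap h : h \in unitmx -> (((E u :&: E v)%MS *m h :=: E u *m h :&: E v *m h))%MS.
  exact: capmx_unit.
have rcap h : h \in unitmx -> \rank (E u *m h :&: E v *m h)%MS = n.-1.
  move=> hu; rewrite -(cap h hu) mxrankMfree ?row_free_unit //.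
  exact: system_cap sysE _ _ uS vS uv su.
have capG : (E u *m c' :&: E v *m c' :=: E u *m G :&: E v *m G)%MS.
  apply: eqmx_trans (eqmx_sym (cap _ cu')) (eqmx_trans _ (cap _ Gu)).
  rewrite mulmxA; apply/eqmx_sym/Xg.
  by rewrite mem_cat mem_head orbT.
have over k : k \in S -> ~~ small_root k -> (E u *m c' :&: E v *m c' <= E k *m
  G)%MS ->
    (E k *m G :=: E u *m c')%MS \/ (E k *m G :=: E v *m c')%MS.
  move=> kS sk sub; apply: (lagrangian_over_cap mn sB uB) => //;
    try exact: iso; try exact: rk; exact: rcap.
have Wu : (E u *m c' :&: E v *m c' <= E u *m G)%MS by rewrite capG capmxSl.
have Wv : (E u *m c' :&: E v *m c' <= E v *m G)%MS by rewrite capG capmxSr.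
(* The two Lagrangians cannot be sent to the same one, as their intersection has rank [n.-1]. *)
have diff (W : 'M_m) : (E u *m G :=: W)%MS -> (E v *m G :=: W)%MS -> False.
  move=> uW vW; have := rcap G Gu;
    rewrite (cap_eqmx uW vW) (capmx_idPl (submx_refl W)).
  by rewrite -uW rk //; move: n0; clear; case: n => // n' _ /eqP;
    rewrite /= eqn_leq ltnn.
have fin (w : {perm 'I_n}) : (forall k, (w k \in S) = (k \in S)) ->
    (forall k, small_root k -> w k = k) ->
    (E u *m G :=: E (w u) *m c')%MS -> (E v *m G :=: E (w v) *m c')%MS ->
  exists w : {perm 'I_n}, (forall k, (w k \in S) = (k \in S)) /\
    forall k, k \in S -> (E k *m c *m g :=: E (w k) *m c')%MS.
  move=> wS wk wu wv; exists w; split=> // k kS.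
  have [sk|sk] := boolP (small_root k); first by rewrite wk //; apply: small.
  by rewrite -mulmxA; case: (luv k kS sk) => ->.
case: (over u uS su Wu) => Eu; case: (over v vS sv Wv) => Ev.
- by case: (diff _ Eu Ev).
- by apply: (fin 1%g) => [k|k _||]; rewrite perm1.
- apply: (fin (tperm u v)) => [k|k sk||]; rewrite ?tpermL ?tpermR //.
    by case: tpermP => // ->; rewrite uS vS.
  rewrite tpermD //; first by apply: contraNneq su => ->.
  by apply: contraNneq sv => ->.
- by case: (diff _ Eu Ev).
Qed.

Lemma base_flags1 u : (forall k, (k \in S) = (k == u)) -> base_flags S E = [:: E u].
Proof.
move=> Su; rewrite /base_flags /small_roots /large_roots.
have [su|su] := boolP (small_root u).
  rewrite (@roots_eq _ S _ [:: u]) //= => [|k]; last first.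
    by rewrite inE Su; case: eqP => // ->.
  rewrite (@roots_eq _ S _ [::]) //= => k; rewrite Su.
  by case: eqP => // ->; rewrite su.
rewrite (@roots_eq _ S _ [::]) //= => [|k]; last first.
  by rewrite Su; case: eqP => // ->; rewrite (negPf su).
rewrite (@roots_eq _ S _ [:: u]) //= => k; rewrite inE Su.
by case: eqP => // ->.
Qed.

Lemma base_flags2 u v : (forall k, (k \in S) = (k == u) || (k == v)) ->
    (u < v)%N -> small_root u -> ~~ small_root v ->
  base_flags S E = [:: E u; E v].
Proof.
move=> Su uv su sv; rewrite /base_flags /small_roots /large_roots.
rewrite (@roots_eq _ S _ [:: u]) //= => [|k]; last first.
  rewrite inE Su; have [->|ku] := eqVneq k u; first by rewrite su.
  by case: eqP => // ->; rewrite (negPf sv).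
rewrite (@roots_eq _ S _ [:: v]) //= => k; rewrite inE Su.
have [->|kv] := eqVneq k v; first by rewrite orbT.
by rewrite orbF; case: eqP => // ->; rewrite su.
Qed.

Lemma base_flags2_large u v : (forall k, (k \in S) = (k == u) || (k == v)) ->
    (u < v)%N -> ~~ small_root u ->
  size (base_flags S E) = 1%N.
Proof.
move=> Su uv su; rewrite /base_flags /small_roots /large_roots.
have sv : ~~ small_root v by clear -su uv; move: su; rewrite /small_root; lia.
rewrite (@roots_eq _ S _ [::]) //= => [|k]; last first.
  rewrite Su; have [->|ku] := eqVneq k u; first by rewrite (negPf su).
  by case: eqP => // ->; rewrite (negPf sv).
rewrite (@roots_eq _ S _ [:: u; v]) //= => [|k]; first by rewrite uv.
rewrite !inE Su; have [->|kv] := eqVneq k u; first by rewrite su.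
by case: eqP => // ->.
Qed.
End TransportSystem.

Lemma flag_B_chain (F : fieldType) m (B : 'M[F]_m) r (T : {set 'I_r}) E :
  flag_B B T E -> isotropic_chain B [seq E k | k <- enum T].
Proof.
move=> [iso inc]; apply/andP; split.
  rewrite pairwise_map.
  have := sorted_enum T; rewrite sorted_pairwise => [|x y z]; last exact: ltn_trans.
  apply: sub_in_pairwise (fun k => k \in T) _ _ _ _ _ => [k l kT lT /= kl|].
    exact: inc.
  by apply/allP => k; rewrite mem_enum.
apply/allP => _ /mapP[k + ->]; rewrite mem_enum => kT.
by rewrite sub_orthmx; have [-> _] := iso k kT.
Qed.

(** * Finiteness of the orbit sets in the four cases *)

Section FiniteOrbits.
Variables (C : numClosedFieldType) (p q n : nat).
Hypothesis hn : n = (p + q + 1)%N.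
Local Notation m1 := (2 * p + 1)%N.
Local Notation m2 := (2 * q + 1)%N.
Local Notation m := (m1 + m2)%N.
Variables (B1 : 'M[C]_m1) (B2 : 'M[C]_m2) (L0 : 'M[C]_m).
Local Notation B := (orthogonal_sum B1 B2).
Hypotheses (hB1 : nondegenerate_symmetric B1) (hB2 : nondegenerate_symmetric B2).
Variables (S : {set 'I_n}) (T1 : {set 'I_p}) (T2 : {set 'I_q}).
Variables (E : 'I_n -> 'M[C]_m) (E1 : 'I_p -> 'M[C]_m1) (E2 : 'I_q -> 'M[C]_m2).
Hypotheses (sysE : system_D B L0 S E) (flE1 : flag_B B1 T1 E1) (flE2 : flag_B B2 T2
  E2).
Local Notation X := ('M[C]_m1 * 'M[C]_m2 * 'M[C]_m)%type.

Definition config_at (x : X) : config C m1 m2 :=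
  Config (translate_flags x.1.1^T [seq E1 k | k <- enum T1])
    (translate_flags x.1.2^T [seq E2 k | k <- enum T2])
    (translate_flags x.2^T (base_flags S E)).

Let mn : m = n.*2. Proof. by rewrite hn; lia. Qed.
Let sB : B^T = B. Proof. exact: block_sym hB1.1 hB2.1. Qed.
Let uB : B \in unitmx. Proof. exact: block_unit hB1.2 hB2.2. Qed.

Lemma SO_row d (b g : 'M[C]_d) : SO b g -> g^T *m b *m g^T^T = b.
Proof. by case=> gb _; rewrite trmxK. Qed.

Lemma config_at_wf x : in_groups B1 B2 x ->
  config_wf B1 B2 #|T1| #|T2| (size (base_flags S E)) (config_at x).
Proof.
move=> [x1 x2 x3]; split.
- exact: isotropic_chain_translate hB1.2 (SO_row x1) (flag_B_chain flE1).
- exact: isotropic_chain_translate hB2.2 (SO_row x2) (flag_B_chain flE2).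
- exact: isotropic_chain_translate uB (SO_row x3) (base_flags_chain sysE).
by rewrite !size_map -!cardE.
Qed.

(** The index [s] consists of the sign of the product of determinants and of the permutation from
    [system_transport]. *)
Lemma isometric_twisted x y : in_groups B1 B2 x -> in_groups B1 B2 y ->
    isometric B1 B2 (config_at x) (config_at y) ->
  exists s, twisted_equiv B1 B2 T1 T2 S E1 E2 E s x y.
Proof.
move=> [x1 x2 x3] [y1 y2 y3] [g1 [g2 [i1 i2 f1 f2 f]]].
have dg : (\det g1 * \det g2) ^+ 2 == 1.
  by rewrite exprMn (isometry_det hB1.2 i1) (isometry_det hB2.2 i2) mulr1.
have [d dE] : exists d : bool, \det g1 * \det g2 = (-1) ^+ d.
  by move: dg; rewrite sqrf_eq1 => /orP[]/eqP->; [exists false | exists true].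
have iG : block_mx g1 0 0 g2 *m B *m (block_mx g1 0 0 g2)^T = B.
  rewrite tr_block_mx !trmx0 /orthogonal_sum !mulmx_block.
  by rewrite !(mulmx0, mul0mx, addr0, add0r) i1 i2.
have [w [wS wE]] := system_transport mn sB uB sysE (SO_row x3) (SO_row y3) iG
  (translate_flags_nth f).
exists (d, w), g1, g2; split=> // k kT.
  by apply: (translate_flags_nth f1); apply: map_f; rewrite mem_enum.
by apply: (translate_flags_nth f2); apply: map_f; rewrite mem_enum.
Qed.

Lemma finitely_many_of_configs (P : config C m1 m2 -> Prop) :
    finite_mod P (isometric B1 B2) ->
    (forall x, in_groups B1 B2 x -> P (config_at x)) ->
  finitely_many_K_orbits B1 B2 (stabilizer B1 T1 E1) (stabilizer B2 T2 E2)
    (stabilizer B S E).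
Proof.
move=> finP inP.
have odd1 k : odd (2 * k + 1)%N by rewrite addn1 /= mul2n odd_double.
apply: (finitely_many_of_twisted hB1.2 hB2.2 (odd1 p) (odd1 q)
  (R := fun x y => isometric B1 B2 (config_at x) (config_at y))).
  exact: (finite_mod_refine (f := config_at) (g := fun _ => tt) finP inP).
exact: isometric_twisted.
Qed.

Lemma lagrangian_at x k : in_groups B1 B2 x -> k \in S -> ~~ small_root k ->
  (orthmx B (E k *m x.2^T) :=: E k *m x.2^T)%MS.
Proof.
move=> [_ _ x3] kS sk; have x3' := SO_row x3.
apply: (lagrangian_orth mn uB).
  rewrite -(orthmx_isometry _ x3' (isometry_unit uB x3')) submxMr //.
  exact: system_isotropic sysE _ kS.
rewrite mxrankMfree ?row_free_unit ?(isometry_unit uB x3') //.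
exact: system_lagrangian sysE _ kS sk.
Qed.

Lemma finite_orbits_single u : (forall k, (k \in S) = (k == u)) ->
    u = 0%N :> nat \/ ~~ small_root u ->
  finitely_many_K_orbits B1 B2 (stabilizer B1 T1 E1) (stabilizer B2 T2 E2)
    (stabilizer B S E).
Proof.
move=> Su u_or; have bf := base_flags1 E Su.
have uS : u \in S by rewrite Su.
have [su|su] := boolP (small_root u); last first.
  apply: (finitely_many_of_configs (finite_mod_config_lagrangian hB1.1 hB1.2 hB2.1
    hB2.2 #|T1| #|T2|)).
  move=> x hx; split; first by have := config_at_wf hx; rewrite bf.
  by rewrite /flag0 /config_at /= bf /=; apply: lagrangian_at.
apply: (finitely_many_of_configs (finite_mod_config_line hB1.1 hB1.2 hB2.1 hB2.2
  #|T1| #|T2|)).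
move=> x hx; split; first by have := config_at_wf hx; rewrite bf.
rewrite /flag0 /config_at /= bf /= (leq_trans (mxrankM_maxl _ _)) //.
rewrite (system_small sysE uS su); case: u_or => [-> //|]; by rewrite su.
Qed.

(** Applies to a single root and also to the pair of Lagrangian roots, whose only base flag is the
    intersection. *)
Lemma finite_orbits_size1 : T2 = finset.set0 -> size (base_flags S E) = 1%N ->
  finitely_many_K_orbits B1 B2 (stabilizer B1 T1 E1) (stabilizer B2 T2 E2)
    (stabilizer B S E).
Proof.
move=> T20 bf.
apply: (finitely_many_of_configs (finite_mod_config_isotropic hB1.1 hB1.2 hB2.1
  hB2.2 #|T1|)).
by move=> x hx; have := config_at_wf hx; rewrite bf T20 cards0.
Qed.

(** The first root is arbitrary, so it may coincide with the second or be Lagrangian as well; then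
    there is one base flag and [finite_orbits_size1] applies. *)
Lemma finite_orbits_pair u v : T2 = finset.set0 ->
    (forall k, (k \in S) = (k == u) || (k == v)) -> ~~ small_root v ->
    u = 0%N :> nat \/ #|T1| = 1%N ->
  finitely_many_K_orbits B1 B2 (stabilizer B1 T1 E1) (stabilizer B2 T2 E2)
    (stabilizer B S E).
Proof.
move=> T20 Suv sv u_or.
have vS : v \in S by rewrite Suv eqxx orbT.
have uS : u \in S by rewrite Suv eqxx.
have [uv|uv] := eqVneq u v.
  apply: finite_orbits_size1 => //; rewrite (base_flags1 E (u := v)) //= => k.
  by rewrite Suv uv orbb.
have [su|su] := boolP (small_root u); last first.
  apply: finite_orbits_size1 => //; case: (ltngtP u v) => [ltuv|ltvu|/val_inj].
  - exact: (base_flags2_large E Suv ltuv su).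
  - by apply: (base_flags2_large E (u := v) (v := u)) => // k; rewrite Suv orbC.
  by move/eqP; rewrite (negPf uv).
have ltuv : (u < v)%N by move: su sv; rewrite /small_root; lia.
have bf := base_flags2 E Suv ltuv su sv.
case: u_or => [u0|T1_1].
  apply: (finitely_many_of_configs (finite_mod_config_line_in_lagrangian hB1.1
    hB1.2 hB2.1 hB2.2 #|T1|)).
  move=> x hx; split.
  - by have := config_at_wf hx; rewrite bf T20 cards0.
  - rewrite /flag0 /config_at /= bf /= (leq_trans (mxrankM_maxl _ _)) //.
    by rewrite (system_small sysE uS su) u0.
  by rewrite /flag1 /config_at /= bf /=; apply: lagrangian_at.
apply: (finitely_many_of_configs (finite_mod_config_isotropic_in_lagrangian hB1.1
  hB1.2 hB2.1 hB2.2)).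
move=> x hx; split; first by have := config_at_wf hx; rewrite bf T20 cards0 T1_1.
by rewrite /flag1 /config_at /= bf /=; apply: lagrangian_at.
Qed.

Lemma finite_orbits_q0 : q = 0%N ->
  finitely_many_K_orbits B1 B2 (stabilizer B1 T1 E1) (stabilizer B2 T2 E2)
    (stabilizer B S E).
Proof.
move=> q0; have m21 : m2 = 1%N by rewrite q0.
apply: (finitely_many_of_configs (finite_mod_config_line_summand hB1.1 hB1.2 hB2.1
  hB2.2
  #|T1| (size (base_flags S E)) m21)) => x hx.
have := config_at_wf hx; suff -> : #|T2| = 0%N by [].
by apply/eqP; rewrite -leqn0 -q0 -[X in (_ <= X)%N]card_ord max_card.
Qed.
End FiniteOrbits.

Lemma root_indicesP r (S : {set 'I_r}) i :
  reflect (exists2 k, k \in S & i = k.+1) (i \in root_indices S).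
Proof.
by apply: (iffP mapP) => -[k]; rewrite ?mem_enum => kS ->; exists k;
  rewrite ?mem_enum.
Qed.

Lemma mem_root_indices r (S : {set 'I_r}) (k : 'I_r) :
  (k.+1 \in root_indices S) = (k \in S).
Proof.
apply/root_indicesP/idP => [[l lS [kl]]|kS]; last by exists k.
by rewrite (val_inj kl : k = l).
Qed.

Lemma root_indices1 r (S : {set 'I_r}) i : root_indices S =i [:: i] ->
  exists2 u : 'I_r, i = u.+1 & forall k, (k \in S) = (k == u).
Proof.
move=> Si;
  have /root_indicesP[u uS iu] : i \in root_indices S by rewrite Si mem_head.
by exists u => // k; rewrite -mem_root_indices Si inE iu.
Qed.

Lemma root_indices2 r (S : {set 'I_r}) i j : root_indices S =i [:: i; j] ->
  exists u v : 'I_r, [/\ i = u.+1, j = v.+1 & forall k, (k \in S) = (k == u) || (k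
    == v)].
Proof.
move=> Si;
  have /root_indicesP[u uS iu] : i \in root_indices S by rewrite Si mem_head.
have /root_indicesP[v vS jv] : j \in root_indices S by rewrite Si !inE eqxx orbT.
by exists u, v; split=> // k; rewrite -mem_root_indices Si !inE iu jv.
Qed.

Lemma large_rootP n (u : 'I_n) : u.+1 = n.-1 \/ u.+1 = n -> ~~ small_root u.
Proof. by rewrite /small_root; lia. Qed.

Local Open Scope complex_scope.

Theorem mainTheorem12 (R : realType) (p q : nat)
    (n : nat) (hn : n = (p + q + 1)%N)
    (B1 : 'M[R[i]]_(2 * p + 1)) (B2 : 'M[R[i]]_(2 * q + 1))
    (hB1 : nondegenerate_symmetric B1) (hB2 : nondegenerate_symmetric B2)
    (L0 : 'M[R[i]]_((2 * p + 1) + (2 * q + 1)))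
    (hL0 : lagrangian n (orthogonal_sum B1 B2) L0)
    (S : {set 'I_n}) (T1 : {set 'I_p}) (T2 : {set 'I_q})
    (P : set 'M[R[i]]_((2 * p + 1) + (2 * q + 1)))
    (Q1 : set 'M[R[i]]_(2 * p + 1)) (Q2 : set 'M[R[i]]_(2 * q + 1))
    (hP : parabolic_D (orthogonal_sum B1 B2) L0 S P)
    (hQ1 : parabolic_B B1 T1 Q1) (hQ2 : parabolic_B B2 T2 Q2)
    (hcases :
      (* (1) *)
      (root_indices S =i [:: 1%N] \/ root_indices S =i [:: n.-1] \/
       root_indices S =i [:: n])
      \/
      (* (2) *)
      (((exists i : nat, root_indices S =i [:: i]) \/
        root_indices S =i [:: n.-1; n] \/
        root_indices S =i [:: 1%N; n.-1] \/
        root_indices S =i [:: 1%N; n]) /\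
       T2 = finset.set0)
      \/
      (* (3) *)
      ((exists i : nat, root_indices S =i [:: i; n.-1] \/
                        root_indices S =i [:: i; n]) /\
       (exists j : nat, root_indices T1 =i [:: j]) /\
       T2 = finset.set0)
      \/
      (* (4) *)
      (q = 0%N)) :
  finitely_many_K_orbits B1 B2 Q1 Q2 P.
Proof.
have [E sysE ->] := hP; have [E1 flE1 ->] := hQ1; have [E2 flE2 ->] := hQ2.
case: hcases => [S1|[[S2 T20]|[[[i S3] [[j T1j] T20]]|q0]]]; last first.
- exact: (finite_orbits_q0 hn hB1 hB2 sysE flE1 flE2 q0).
- have T1_1 : #|T1| = 1%N.
    have [u _ T1u] := root_indices1 T1j.
    by rewrite (_ : T1 = [set u]%SET) ?cards1 //; apply/setP => k; rewrite T1u inE.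
  have [u [v [_ v_eq Suv]]] : exists u v : 'I_n, [/\ i = u.+1, v.+1 = n.-1 \/ v.+1
    = n
      & forall k, (k \in S) = (k == u) || (k == v)].
    by case: S3 => /root_indices2[u [v [iu jv Suv]]]; exists u, v; split=> //;
      [left | right].
  exact: (finite_orbits_pair hn hB1 hB2 sysE flE1 flE2 T20 Suv (large_rootP v_eq)
    (or_intror T1_1)).
- case: S2 => [[i /root_indices1[u _ Su]]|].
    apply: (finite_orbits_size1 hn hB1 hB2 sysE flE1 flE2 T20).
    by rewrite (base_flags1 E Su).
  case=> [/root_indices2[u [v [u_eq v_eq Suv]]]|S2].
    apply: (finite_orbits_size1 hn hB1 hB2 sysE flE1 flE2 T20).
    have su : ~~ small_root u by apply: large_rootP; left.
    by apply: (base_flags2_large E Suv) => //; lia.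
  have [u [v [u0 v_eq Suv]]] : exists u v : 'I_n, [/\ u = 0%N :> nat, v.+1 = n.-1
    \/ v.+1 = n
      & forall k, (k \in S) = (k == u) || (k == v)].
    by case: S2 => /root_indices2[u [v [[iu] jv Suv]]]; exists u, v; split=> //;
      [left | right].
  exact: (finite_orbits_pair hn hB1 hB2 sysE flE1 flE2 T20 Suv (large_rootP v_eq)
    (or_introl u0)).
have [u Su u_or] : exists2 u : 'I_n, (forall k, (k \in S) = (k == u)) &
    u = 0%N :> nat \/ ~~ small_root u.
  case: S1 => [|[]] /root_indices1[u u_eq Su]; exists u => //.
  - by left; case: u_eq.
  - by right; apply: large_rootP; left.
  - by right; apply: large_rootP; right.
exact: (finite_orbits_single hn hB1 hB2 sysE flE1 flE2 Su u_or).
Qed.
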